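(* Let $A$ be a locally compact Abelian group with dual group $\widehat{A}$. Let $f\in L^2(A)$ with $\|f\|_{L^2(A)}=1$, let $\Gamma\subset A\times\widehat{A}$, and put $G_f=\{z\in A\times\widehat{A}:\ V_ff(z)\neq 0\}$. Then [$\mathcal{G}(f,\Gamma)=\{\pi(z)f:\ z\in\Gamma\}$ is an orthonormal basis of $L^2(A)$ and $|G_f|=1$] if and only if [$f=c\,T_{x_0}h$ for some $c\in\mathbb{C}\setminus\{0\}$, $x_0\in A$ and some subcharacter $h$ of second degree of $A$, and $\Gamma$ is a set of representatives of the cosets of $G_f$ in $A\times\widehat{A}$].
   Context: Groups are written additively, and $\langle x,\xi\rangle\in\mathbb{T}$ (the complex numbers of modulus $1$) denotes the duality pairing of $x\in A$, $\xi\in\widehat{A}$. The Haar measures on $A$ and $\widehat{A}$ are normalized so that the Plancherel formula holds, and $A\times\widehat{A}$ carries the product measure; $|S|$ is the measure of a set $S$. Operators on $L^2(A)$: $T_xf(y)=f(y-x)$, $M_\xi f(y)=\langle y,\xi\rangle f(y)$, $\pi(x,\xi)=M_\xi T_x$. Short-time Fourier transform: for $f,g\in L^2(A)$, $V_gf(x,\xi)=\langle f,\pi(x,\xi)g\rangle_{L^2(A)}=\int_A\overline{\langle y,\xi\rangle}f(y)\overline{g(y-x)}\,dy$, a continuous function on $A\times\widehat{A}$. The set $\Gamma$ need not be countable. ''$\mathcal{G}(f,\Gamma)$ is an orthonormal basis'' refers to the family $(\pi(z)f)_{z\in\Gamma}$ indexed by $\Gamma$. A set of representatives of the cosets of a subgroup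 contains exactly one element of each coset. (Under either side of the equivalence $G_f$ is a subgroup of $A\times\widehat{A}$.) For an LCA group $B$, a continuous homomorphism $\phi:B\to\widehat{B}$ is symmetric if $\langle x,\phi(y)\rangle=\langle y,\phi(x)\rangle$ for all $x,y\in B$; a character of second degree of $B$ associated to such a $\phi$ is a continuous function $f:B\to\mathbb{T}$ with $f(x+y)=f(x)f(y)\langle x,\phi(y)\rangle$ for all $x,y\in B$. A subcharacter of second degree of $A$ is a function $h:A\to\mathbb{C}$ for which there are a compact open subgroup $H\subset A$ and a continuous symmetric homomorphism $\phi:H\to\widehat{H}$ such that $h|_H$ is a character of second degree of $H$ associated to $\phi$, and $h(x)=0$ for $x\in A\setminus H$. *)

(* Defs.v *)
From HB Require Import structures.
From mathcomp Require Import all_boot all_order all_algebra.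
From mathcomp Require Import all_classical all_reals all_analysis.
From mathcomp Require Import complex ring.

Set Implicit Arguments.
Unset Strict Implicit.
Unset Printing Implicit Defensive.

Import Order.TTheory GRing.Theory Num.Theory.
Import numFieldNormedType.Exports.
Import Normc.

Local Open Scope classical_set_scope.
Local Open Scope ring_scope.
Local Open Scope complex_scope.

Section dual_group.
Variables (R : realType) (B : topologicalZmodType).

(* The dual group of B: continuous characters, with pointwise multiplication
   (written additively) and the compact-open topology. The pairing <x, chi> is
   the application chi x. The topology on the complex numbers is the one of
   R[i]^o. *)
Record dual := Character {
  char_fun :> B -> R[i];
  char_continuous : continuous (char_fun : B -> R[i]^o);
  char_norm1 : forall x, `|char_fun x| = 1;
  char_add : forall x y, char_fun (x + y) = char_fun x * char_fun y }.

HB.instance Definition _ := gen_eqMixin dual.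
HB.instance Definition _ := gen_choiceMixin dual.

Lemma dual_ext (chi psi : dual) : (forall x, chi x = psi x) -> chi = psi.
Proof.
case: chi psi => [f fc fn fm] [g gc gn gm] /= /funext fg.
case: _ / fg in gc gn gm *.
by congr Character; exact: Prop_irrelevance.
Qed.

Lemma char_neq0 (chi : dual) x : chi x != 0.
Proof. by rewrite -normr_eq0 char_norm1 oner_neq0. Qed.

Definition char_zero : dual.
Proof.
apply: (@Character (fun=> 1)) => [x|x|x y].
- exact: cvg_cst.
- exact: normr1.
- by rewrite mulr1.
Defined.

Definition char_opp (chi : dual) : dual.
Proof.
apply: (@Character (fun x => (chi x)^-1)) => [x|x|x y].
- by apply: cvgV; [exact: char_neq0 | exact: char_continuous].
- by rewrite normfV char_norm1 invr1.
- by rewrite char_add invfM.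
Defined.

Definition char_plus (chi psi : dual) : dual.
Proof.
apply: (@Character (fun x => chi x * psi x)) => [x|x|x y].
- by apply: cvgM; exact: char_continuous.
- by rewrite normrM !char_norm1 mulr1.
- by rewrite !char_add mulrACA.
Defined.

Lemma char_plusA : associative char_plus.
Proof. by move=> a b c; apply: dual_ext => x /=; rewrite mulrA. Qed.
Lemma char_plusC : commutative char_plus.
Proof. by move=> a b; apply: dual_ext => x /=; rewrite mulrC. Qed.
Lemma char_plus0 : left_id char_zero char_plus.
Proof. by move=> a; apply: dual_ext => x /=; rewrite mul1r. Qed.
Lemma char_plusN : left_inverse char_zero char_opp char_plus.
Proof. by move=> a; apply: dual_ext => x /=; rewrite mulVf ?char_neq0. Qed.

HB.instance Definition _ :=
  GRing.isZmodule.Build dual char_plusA char_plusC char_plus0 char_plusN.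

HB.instance Definition _ := Topological.copy dual
  (initial_topology (char_fun : dual -> {compact-open, B -> R[i]^o})).



Lemma dual_near (a : dual) (K : set B) (e : R[i]) : compact K -> 0 < e ->
  nbhs a [set b : dual | forall x, K x -> `|a x - b x| < e].
Proof.
move=> cK e0; pose aco : {compact-open, B -> R[i]^o} := a.
have cts : continuous (a : B -> R[i]^o) by exact: char_continuous.
have cvg_aco : {compact-open, nbhs aco --> (a : B -> R[i]^o)} by [].
move/(compact_open_fam_compactP cts) : cvg_aco => cvg_fam.
apply: (@initial_continuous _ _ (char_fun : dual -> {compact-open, B -> R[i]^o})
  a [set g | forall x, K x -> `|a x - g x| < e]).
apply: cvg_fam.
apply: (@fam_nbhs B R[i]^o compact K (fun z => `|z.1 - z.2| < e)) => //.
by rewrite -entourage_ballE; exists e.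
Qed.

Fact dual_sub_continuous : continuous (fun z : dual * dual => z.1 - z.2).
Proof.
apply: continuous_comp_initial => -[chi psi].
have cts : continuous (char_fun (chi - psi) : B -> R[i]^o).
  exact: char_continuous.
apply/(compact_open_fam_compactP cts)/fam_cvgP => K cK P /uniform_nbhs.
move=> [E [+ sEP]]; rewrite -entourage_ballE => -[e /= e0 sE].
have e20 : 0 < e / 2 by rewrite divr_gt0.
near=> z; apply: sEP => x Kx; apply: sE.
have h1 : forall y, K y -> `|chi y - z.1 y| < e / 2.
  by near: z; exact: (cvg_fst (dual_near _ cK e20)).
have h2 : forall y, K y -> `|psi y - z.2 y| < e / 2.
  by near: z; exact: (cvg_snd (dual_near _ cK e20)).
rewrite /ball /= /ball_ /=.
have key (F : fieldType) (a b c d : F) : b != 0 -> d != 0 ->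
    a * b^-1 - c * d^-1 = b^-1 * ((a - c) - c * d^-1 * (b - d)).
  by move=> b0 d0; field; rewrite ?b0 ?d0.
rewrite key ?char_neq0//.
rewrite normrM normfV char_norm1 invr1 mul1r.
rewrite (le_lt_trans (ler_normB _ _))// normrM normrM normfV !char_norm1.
by rewrite invr1 !mul1r [e]splitr ltrD ?h1 ?h2.
Unshelve. all: by end_near. Qed.

HB.instance Definition _ :=
  PreTopologicalNmodule_isTopologicalZmodule.Build dual dual_sub_continuous.

End dual_group.

(* On pairs the library has this structure only for topological vector
   spaces. *)
HB.instance Definition _ (M N : PreTopologicalZmodule.type) :=
  Topological.on (M * N)%type.

Section subgroup.
Variable A : topologicalZmodType.

Record subgroup := Subgroup {
  subgroup_carrier :> set A;
  subgroup_closed : zmod_closed (mem subgroup_carrier) }.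

Variable H : subgroup.

Definition subgroup_type : Type := set_type (subgroup_carrier H).

HB.instance Definition _ := SubChoice.on subgroup_type.
HB.instance Definition _ := Topological.on subgroup_type.
HB.instance Definition _ :=
  GRing.SubChoice_isSubZmodule.Build A _ subgroup_type (subgroup_closed H).

Fact subgroup_sub_continuous :
  continuous (fun z : subgroup_type * subgroup_type => z.1 - z.2).
Proof.
apply: continuous_comp_initial => z.
have -> : set_val \o (fun z : subgroup_type * subgroup_type => z.1 - z.2) =
    (fun x : A * A => x.1 - x.2) \o
    (fun z : subgroup_type * subgroup_type => (set_val z.1, set_val z.2)).
  by apply/funext.
apply: continuous_comp; last exact: sub_continuous.
by apply: cvg_pair; apply: continuous_comp;
  (exact: cvg_fst || exact: cvg_snd || exact: initial_continuous).
Qed.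

HB.instance Definition _ :=
  PreTopologicalNmodule_isTopologicalZmodule.Build subgroup_type
    subgroup_sub_continuous.
End subgroup.

(* B with its Borel sigma-algebra; the point is only needed because measurable
   types are pointed in the library. *)
Definition borel (B : PreTopologicalZmodule.type) : Type := B.

Section borel_instances.
Variable B : PreTopologicalZmodule.type.
HB.instance Definition _ := Choice.on (borel B).
HB.instance Definition _ := isPointed.Build (borel B) (0 : B).
HB.instance Definition _ := Measurable.copy (borel B)
  (g_sigma_algebraType (@open B : set (set (borel B)))).
End borel_instances.

Section haar.
Variables (R : realType) (B : PreTopologicalZmodule.type).
Variable mu : {measure set (borel B) -> \bar R}.

(* A nonzero, translation-invariant Radon measure: finite on compact sets, outer
   regular on Borel sets and inner regular on open sets. B need not be
   sigma-compact, so mu need not be sigma-finite. *)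
Definition haar_measure : Prop :=
  [/\ mu [set: borel B] != 0%E,
      (forall (x : B) (E : set (borel B)), measurable E ->
         mu [set x + y | y in (E : set B)] = mu E),
      (forall K : set B, compact K -> (mu K < +oo)%E),
      (forall E : set (borel B), measurable E ->
         mu E = ereal_inf [set mu U | U in [set U : set B | open U /\ E `<=` U]]) &
      (forall U : set B, open U ->
         mu U = ereal_sup [set mu K | K in [set K : set B | compact K /\ K `<=` U]])].

Definition cmeasurable (f : B -> R[i]) : Prop :=
  measurable_fun [set: borel B] (fun x => complex.Re (f x)) /\
  measurable_fun [set: borel B] (fun x => complex.Im (f x)).

(* Elements of L^p(B) are represented by Borel functions; equality in L^p(B) is
   equality mu-almost everywhere. *)
Definition cnorm_L (p : \bar R) (f : B -> R[i]) : \bar R :=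
  Lnorm mu p (fun x => (normc (f x))%:E).

Definition in_L (p : \bar R) (f : B -> R[i]) : Prop :=
  cmeasurable f /\ (cnorm_L p f < +oo)%E.

Definition cintegral (f : B -> R[i]) : R[i] :=
  (\int[mu]_x complex.Re (f x)) +i* (\int[mu]_x complex.Im (f x)).

Definition inner (f g : B -> R[i]) : R[i] :=
  cintegral (fun y => f y * (g y)^*).

(* The family (e i) indexed by i in J is orthonormal and its linear span is
   dense in L^2(B). *)
Definition orthonormal_basis (I : eqType) (J : set I) (e : I -> B -> R[i]) : Prop :=
  [/\ (forall i, J i -> in_L 2%:E (e i)),
      (forall i j, J i -> J j -> inner (e i) (e j) = (i == j)%:R) &
      (forall u, in_L 2%:E u -> forall eps : R, 0 < eps ->
         exists (s : seq I) (c : I -> R[i]), (forall i, i \in s -> J i) /\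
           (cnorm_L 2%:E (fun y => (u y - \sum_(i <- s) c i * e i y)%R)
              < eps%:E)%E)].
End haar.

Section time_frequency.
Variables (R : realType) (A : topologicalZmodType).
Variable mu : {measure set (borel A) -> \bar R}.

Definition fourier (f : A -> R[i]) (xi : dual R A) : R[i] :=
  cintegral mu (fun x => f x * (xi x)^*).

(* The Plancherel formula on the intersection of L^1(A) and L^2(A), which
   normalizes nu relatively to mu. *)
Definition plancherel (nu : {measure set (borel (dual R A)) -> \bar R}) : Prop :=
  forall f : A -> R[i], in_L mu 1%:E f -> in_L mu 2%:E f ->
    cnorm_L nu 2%:E (fourier f) = cnorm_L mu 2%:E f.

(* The measures need not be sigma-finite, and the Borel sigma-algebra of the
   product may be larger than the product sigma-algebra, so the product measure
   is characterized, among Haar measures of the product group, by its values on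
   Borel rectangles with sides of finite measure. *)
Definition product_measure_of
    (nu : {measure set (borel (dual R A)) -> \bar R})
    (lam : {measure set (borel (A * dual R A)%type) -> \bar R}) : Prop :=
  forall (E : set (borel A)) (F : set (borel (dual R A))),
    measurable E -> measurable F -> (mu E < +oo)%E -> (nu F < +oo)%E ->
    lam (E `*` F) = (mu E * nu F)%E.

Definition translation (x : A) (f : A -> R[i]) : A -> R[i] :=
  fun y => f (y - x).

Definition modulation (xi : dual R A) (f : A -> R[i]) : A -> R[i] :=
  fun y => xi y * f y.

Definition tf_shift (z : A * dual R A) (f : A -> R[i]) : A -> R[i] :=
  modulation z.2 (translation z.1 f).

(* stft g f is the short-time Fourier transform V_g f of f with window g. *)
Definition stft (g f : A -> R[i]) (z : A * dual R A) : R[i] :=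
  inner mu f (tf_shift z g).

Definition stft_support (f : A -> R[i]) : set (A * dual R A) :=
  [set z | stft f f z != 0].
End time_frequency.

Definition symmetric_hom (R : realType) (B : topologicalZmodType)
    (phi : B -> dual R B) : Prop :=
  [/\ continuous phi,
      (forall x y, phi (x + y) = phi x + phi y) &
      (forall x y, phi y x = phi x y)].

Definition char_second_degree (R : realType) (B : topologicalZmodType)
    (phi : B -> dual R B) (f : B -> R[i]) : Prop :=
  [/\ continuous (f : B -> R[i]^o),
      (forall x, `|f x| = 1) &
      (forall x y, f (x + y) = f x * f y * phi y x)].

Definition subchar_second_degree (R : realType) (A : topologicalZmodType)
    (h : A -> R[i]) : Prop :=
  exists (H : subgroup A) (phi : subgroup_type H -> dual R (subgroup_type H)),
    [/\ compact H, open H, symmetric_hom phi,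
        char_second_degree phi (fun x => h (val x)) &
        (forall x, ~ (H : set A) x -> h x = 0)].

(* T contains exactly one element of each coset w + G of G. *)
Definition coset_representatives (M : zmodType) (G T : set M) : Prop :=
  forall w : M, exists! z, T z /\ [set w + g | g in G] z.

(* Main.v *)
Require Import Defs.
From HB Require Import structures.
From mathcomp Require Import all_boot all_order all_algebra.
From mathcomp Require Import all_classical all_reals all_analysis.
From mathcomp Require Import measurable_realfun.
From mathcomp Require Import complex ring lra.

Set Implicit Arguments.
Unset Strict Implicit.
Unset Printing Implicit Defensive.

Import Order.TTheory GRing.Theory Num.Theory.
Import numFieldNormedType.Exports.

Local Open Scope classical_set_scope.
Local Open Scope ring_scope.
Local Open Scope complex_scope.
Local Open Scope ring_scope.

Import Normc.

(** Write V for V_f f, G for its support, and let H be the projection of G to A,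
    N = {eta | G (0, eta)}, and ann the annihilator of H in the dual group.

    From the basis to the subcharacter. By Plancherel in the second variable the
    integral of |V|^2 over A x dual A is ||f||^4 = 1; since |V| <= 1 by the
    inequality of Cauchy and Schwarz, V is continuous and G has measure 1, we get
    |V| = 1 on G (stft_unimodular). This is Moyal's identity; as the measures need
    not be sigma-finite, its use of Tonelli's theorem is restricted to open sets
    (tonelli_open), where it follows from the regularity of the measures, and |f|^2
    is approximated from above by series of indicators of open sets. The equality
    case of Cauchy and Schwarz gives f = V z * pi z f for z in G (stft_eigen), and
    the commutation relation of the time-frequency shifts makes G an open subgroup
    on which V is multiplicative up to a phase and on which the pairing is
    symmetric: xi y = eta x for (x, xi) and (y, eta) in G.

    The function |f| is H-invariant and integrable to the square, so the open
    subgroup H is compact. By isotropy N is contained in ann. The group G is a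
    finite disjoint union of rectangles, whence mu H * nu N = lam G = 1
    (subgroup_product_measure), while mu H * nu ann = 1 by Plancherel for the
    indicator of H (nu_annihilator); hence N = ann. Choose x0 such that f does not
    vanish on x0 + H. Elements of ann separate the cosets of H and f is an
    eigenvector of the multiplication by each of them, so f vanishes outside
    x0 + H. On H, phi x is the restriction of any xi with G (x, xi), and
    h x = V (x, xi) xi (x0 + x) is a character of second degree for phi; f (x0 + .)
    and h are multiplied by the same factors under translations by elements of H,
    so their quotient is constant (window_equation). Finally pi z f and pi w f are
    orthogonal when z - w is not in G and proportional when it is, so an
    orthonormal basis takes exactly one index in each coset of G.

    From the subcharacter to the basis. For f = c T_x0 h the support of V is
    {(x, xi) | x in H and xi extends phi x}, with |V| = 1 on it
    (stft_support_subchar): the characters phi x extend to A, and xi - xi' in ann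
    is forced by the orthogonality of characters. By continuity of phi and because
    the unit circle has no small subgroups, phi vanishes near 0; so the rectangle
    formula applies with N = ann and gives lam G = 1. Orthonormality follows as
    above. For the density, a compact set carries most of the mass of a function u,
    hence so do finitely many cosets of H; on each coset x1 + H the vectors
    pi (x1 - x0, xi) f are the characters multiplied by one unimodular function,
    and the characters span a dense subspace of L^2(H) (character_approximation).

    Everything in Fourier analysis that is needed on the compact open subgroup H,
    such as the extension of characters and the separation of cosets, is deduced
    from Plancherel's formula and the orthogonality of characters. *)

(** * Complex modulus and finite covers *)

Section complex_modulus.
Variable R : realType.
Implicit Types z w : R[i].

Lemma normcrE z : `|z| = (normc z)%:C. Proof. by []. Qed.

Lemma normc_ge0 z : 0 <= normc z.
Proof. by case: z => a b; exact: sqrtr_ge0. Qed.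

Lemma normc_sqrE z : normc z ^+ 2 = complex.Re z ^+ 2 + complex.Im z ^+ 2.
Proof. by case: z => a b /=; rewrite sqr_sqrtr// addr_ge0// sqr_ge0. Qed.

Lemma mulJc z : z * z^* = (normc z ^+ 2)%:C.
Proof. by rewrite normc_sqrE; case: z => a b /=; congr Complex; rewrite /=; ring. Qed.

Lemma normc_conj z : normc z^* = normc z.
Proof. by case: z => a b /=; rewrite sqrrN. Qed.

Lemma normcrM z w : normc (z * w) = normc z * normc w.
Proof. exact: normcM. Qed.

Lemma normcr0 : normc (0 : R[i]) = 0.
Proof. exact: normc0. Qed.

Lemma normcr1 : normc (1 : R[i]) = 1.
Proof. by rewrite /= expr0n /= addr0 expr1n sqrtr1. Qed.

Lemma normc_eq0 z : (normc z == 0) = (z == 0).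
Proof.
by apply/eqP/eqP => [/eq0_normc //|->]; rewrite normcr0.
Qed.

Lemma normr1_normc z : `|z| = 1 <-> normc z = 1.
Proof. by rewrite normcrE; split=> [[]|->]. Qed.

Lemma unit_conjV z : `|z| = 1 -> z^-1 = z^*.
Proof.
move=> z1; have z0 : z != 0 by rewrite -normr_eq0 z1 oner_neq0.
apply: (mulfI z0); rewrite mulfV// mulJc.
by move/normr1_normc : z1 => ->; rewrite expr1n.
Qed.

Lemma Re_le_normc z : `|complex.Re z| <= normc z.
Proof.
rewrite -(@ler_pXn2r _ 2)// ?nnegrE ?normc_ge0// normc_sqrE real_normK ?num_real//.
by rewrite lerDl sqr_ge0.
Qed.

Lemma Im_le_normc z : `|complex.Im z| <= normc z.
Proof.
rewrite -(@ler_pXn2r _ 2)// ?nnegrE ?normc_ge0// normc_sqrE real_normK ?num_real//.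
by rewrite lerDr sqr_ge0.
Qed.

Lemma near_normc (T : topologicalType) (f : T -> R[i]) x (e : R) : 0 < e ->
  {for x, continuous (f : T -> R[i]^o)} -> \forall y \near x, normc (f x - f y) < e.
Proof.
move=> e0 cf; have e0C : 0 < e%:C by rewrite ltcR.
move/cvgrPdist_lt : cf => /(_ _ e0C).
by apply: filterS => y; rewrite /= ltcR.
Qed.

Lemma continuous_normcP (T : topologicalType) (f : T -> R[i]) x :
  (forall e : R, 0 < e -> \forall y \near x, normc (f x - f y) < e) ->
  {for x, continuous (f : T -> R[i]^o)}.
Proof.
move=> h; apply/cvgrPdist_lt => -[a b]; rewrite ltcE /= => /andP[/eqP -> a0].
by apply: filterS (h _ a0) => y; rewrite normcrE ltcE /= eqxx.
Qed.

Lemma Re_continuous (T : topologicalType) (f : T -> R[i]) :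
  continuous (f : T -> R[i]^o) -> continuous (fun x => complex.Re (f x)).
Proof.
move=> cf x; apply/cvgrPdist_lt => e e0.
apply: filterS (near_normc e0 (cf x)) => y; apply: le_lt_trans.
by have := Re_le_normc (f x - f y); case: (f x) (f y) => a b [c d].
Qed.

Lemma Im_continuous (T : topologicalType) (f : T -> R[i]) :
  continuous (f : T -> R[i]^o) -> continuous (fun x => complex.Im (f x)).
Proof.
move=> cf x; apply/cvgrPdist_lt => e e0.
apply: filterS (near_normc e0 (cf x)) => y; apply: le_lt_trans.
by have := Im_le_normc (f x - f y); case: (f x) (f y) => a b [c d].
Qed.

Lemma normc_continuous (T : topologicalType) (f : T -> R[i]) :
  continuous (f : T -> R[i]^o) -> continuous (fun x => normc (f x)).
Proof.
move=> cf x; apply/cvgrPdist_lt => e e0.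
apply: filterS (near_normc e0 (cf x)) => y; apply: le_lt_trans.
have h1 := le_normcD (f x - f y) (f y); have h2 := le_normcD (f y - f x) (f x).
rewrite !subrK in h1 h2; rewrite -(normcN (f y - f x)) opprB in h2.
by rewrite ler_norml; lra.
Qed.
End complex_modulus.

Section compact_finite_cover.

Lemma compact_finite_subcover (T : topologicalType) (K : set T) (W : T -> set T) :
  compact K -> (forall x, K x -> nbhs x (W x)) ->
  exists s : seq T, (forall x, x \in s -> K x) /\
    forall y, K y -> exists2 x, x \in s & W x y.
Proof.
move=> /compact_near_coveringP cK nW.
pose F : set_system (seq T) := [set S | exists2 s0 : seq T,
  (forall x, x \in s0 -> K x) & forall s : seq T, (forall x, x \in s -> K x) ->
    {subset s0 <= s} -> S s].
have FF : Filter F.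
  split.
  - by exists [::].
  - move=> P Q [s1 K1 h1] [s2 K2 h2]; exists (s1 ++ s2).
      by move=> x; rewrite mem_cat => /orP[/K1|/K2].
    by move=> s Ks ss; split; [apply: h1 => // x xs|apply: h2 => // x xs];
      apply: ss; rewrite mem_cat xs ?orbT.
  - by move=> P Q PQ [s1 K1 h1]; exists s1 => // s Ks ss; apply/PQ/h1.
have := cK _ F (fun s y => exists2 x, x \in s & W x y) FF.
case=> [x Kx|s0 K0 h].
  exists (W x, [set s : seq T | x \in s]) => /=.
    split; first exact: nW.
    exists [:: x]; first by move=> y; rewrite inE => /eqP->.
    by move=> s _; apply; exact: mem_head.
  by move=> -[y s] [/= Wy xs]; exists x.
by exists s0; split=> // y Ky; exact: (h s0).
Qed.
End compact_finite_cover.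

(** * Borel measurability *)

Section borel_measurability.
Variable R : realType.

Lemma open_borel (B : PreTopologicalZmodule.type) (U : set B) :
  open U -> measurable (U : set (borel B)).
Proof. by move=> oU; apply: sub_sigma_algebra. Qed.

Lemma closed_borel (B : PreTopologicalZmodule.type) (U : set B) :
  closed U -> measurable (U : set (borel B)).
Proof.
move=> cU; rewrite -[U]setCK; apply: measurableC.
by apply: open_borel; exact: closed_openC.
Qed.

Lemma continuous_borel (B : PreTopologicalZmodule.type) (f : B -> R) :
  continuous f -> measurable_fun [set: borel B] (f : borel B -> R).
Proof.
move=> cf; apply: (measurability _ (RGenOInfty.measurableE R)).
move=> _ [_ [x ->] <-]; rewrite setTI; apply: open_borel.
by apply: open_comp => //; exact: open_gt.
Qed.

Lemma continuous_borel_borel (B1 B2 : PreTopologicalZmodule.type) (g : B1 -> B2) :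
  continuous g -> measurable_fun [set: borel B1] (g : borel B1 -> borel B2).
Proof.
move=> cg; apply: (@measurability _ _ _ _ setT (g : borel B1 -> borel B2)
  (@open B2 : set (set (borel B2)))) => //.
move=> _ [U oU <-]; rewrite setTI; apply: open_borel.
by apply: open_comp.
Qed.

Section cmeasurable_ops.
Variable B : PreTopologicalZmodule.type.
Implicit Types f g : B -> R[i].

Lemma cmeasurable_continuous f : continuous (f : B -> R[i]^o) -> cmeasurable f.
Proof.
by move=> cf; split; apply: continuous_borel;
  [exact: Re_continuous|exact: Im_continuous].
Qed.

Lemma cmeasurable_cst (c : R[i]) : cmeasurable (fun _ : B => c).
Proof. by split; exact: measurable_cst. Qed.

Lemma cmeasurableD f g : cmeasurable f -> cmeasurable g ->
  cmeasurable (fun x => f x + g x).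
Proof.
move=> [f1 f2] [g1 g2]; split.
  rewrite (_ : (fun x => _) = (fun x : borel B => complex.Re (f x) + complex.Re (g x))).
    exact: measurable_funD.
  by apply/funext => x; case: (f x) (g x) => a b [].
rewrite (_ : (fun x => _) = (fun x : borel B => complex.Im (f x) + complex.Im (g x))).
  exact: measurable_funD.
by apply/funext => x; case: (f x) (g x) => a b [].
Qed.

Lemma cmeasurableM f g : cmeasurable f -> cmeasurable g ->
  cmeasurable (fun x => f x * g x).
Proof.
move=> [f1 f2] [g1 g2]; split.
  rewrite (_ : (fun x => _) = (fun x : borel B => complex.Re (f x) * complex.Re (g x)
     - complex.Im (f x) * complex.Im (g x))).
    by apply: measurable_funB; exact: measurable_funM.
  by apply/funext => x; case: (f x) (g x) => a b [].
rewrite (_ : (fun x => _) = (fun x : borel B => complex.Re (f x) * complex.Im (g x)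
   + complex.Im (f x) * complex.Re (g x))).
  by apply: measurable_funD; exact: measurable_funM.
by apply/funext => x; case: (f x) (g x) => a b [].
Qed.

Lemma cmeasurableJ f : cmeasurable f -> cmeasurable (fun x => (f x)^*).
Proof.
move=> [f1 f2]; split.
  by rewrite (_ : (fun x => _) = (fun x : borel B => complex.Re (f x)))//;
     apply/funext => x; case: (f x).
rewrite (_ : (fun x => _) = (fun x : borel B => - complex.Im (f x))).
  exact: measurable_funN.
by apply/funext => x; case: (f x).
Qed.

Lemma cmeasurable_indic (E : set B) : measurable (E : set (borel B)) ->
  cmeasurable (fun x => (\1_E x : R)%:C).
Proof.
move=> mE; split => /=; last exact: measurable_cst.
exact: (@measurable_indic _ (borel B)).
Qed.

Lemma measurable_normc f : cmeasurable f ->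
  measurable_fun [set: borel B] (fun x => normc (f x)).
Proof.
move=> [f1 f2].
rewrite (_ : (fun x => _) = (fun x : borel B =>
    Num.sqrt (complex.Re (f x) ^+ 2 + complex.Im (f x) ^+ 2))).
  apply: (measurableT_comp (f := @Num.sqrt R)).
    exact: (continuous_measurable_fun (@sqrt_continuous R)).
  by apply: measurable_funD; exact: measurable_funX.
by apply/funext => x; case: (f x).
Qed.
End cmeasurable_ops.

Lemma cmeasurable_comp (B1 B2 : PreTopologicalZmodule.type) (g : B1 -> B2)
    (f : B2 -> R[i]) :
  continuous g -> cmeasurable f -> cmeasurable (fun x => f (g x)).
Proof.
by move=> cg [f1 f2]; split;
  [apply: (measurableT_comp f1)|apply: (measurableT_comp f2)];
  exact: continuous_borel_borel.
Qed.
End borel_measurability.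

Section topological_group.
Variable B : topologicalZmodType.

Lemma shift_continuous (a : B) : continuous (fun y : B => a + y).
Proof.
move=> y; apply: (@continuous_comp _ _ _ (fun y => (a, y)) (fun x : B * B => x.1 + x.2)).
  by apply: cvg_pair => /=; [exact: cvg_cst|exact: cvg_id].
exact: add_continuous.
Qed.

Lemma nbhs_shift (a : B) (U : set B) : nbhs 0 U -> nbhs a [set y | U (y - a)].
Proof.
move=> nU.
have : (fun y : B => - a + y) @ a --> - a + a by exact: shift_continuous.
rewrite addNr => /(_ _ nU) h; have {}h : nbhs a [set y | U (- a + y)] by [].
by apply: filterS h => y /=; rewrite addrC.
Qed.
End topological_group.

(** * Haar measures: regularity, positivity, tightness *)

Lemma ge0_markov d (T : measurableType d) (R : realType)
    (m : {measure set T -> \bar R}) (p : T -> R) (a : R) :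
  measurable_fun setT p -> (forall y, 0 <= p y) -> 0 <= a ->
  (a%:E * m [set y | a < p y]%R <= \int[m]_y (p y)%:E)%E.
Proof.
move=> mp p0 a0.
have mE : measurable [set y | a < p y].
  rewrite (_ : [set _ | _] = p @^-1` `]a, +oo[); last first.
    by apply/seteqP; split => y; rewrite /= in_itv/= andbT.
  by rewrite -[X in measurable X]setTI; exact: mp.
rewrite -[m _](_ : (\int[m]_y (\1_[set y | a < p y]%R y)%:E)%E = _); last first.
  by rewrite integral_indic// setIT.
rewrite -ge0_integralZl//=.
- apply: ge0_le_integral => //.
  + by move=> y _; rewrite mule_ge0// lee_fin.
  + by apply: measurable_funeM; apply/measurable_EFinP; exact: measurable_indic.
  + exact/measurable_EFinP.
  + move=> y _; rewrite -EFinM lee_fin indicE; have [|] := boolP (_ \in _).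
      by rewrite inE /= mulr1 => /ltW.
    by rewrite mulr0.
- by apply/measurable_EFinP; exact: measurable_indic.
Qed.

Section haar_theory.
Variables (R : realType) (B : topologicalZmodType).
Variable m : {measure set (borel B) -> \bar R}.
Hypothesis hB : hausdorff_space B.
Hypothesis hm : haar_measure m.

Lemma measurable_shift (a : B) (E : set (borel B)) :
  measurable E -> measurable ([set y | E (a + y)] : set (borel B)).
Proof.
move=> mE; rewrite -[X in measurable X]setTI.
exact: (continuous_borel_borel (@shift_continuous B a)).
Qed.

Lemma haar_shift (a : B) (E : set (borel B)) : measurable E ->
  m [set y | E (a + y)] = m E.
Proof.
move=> mE; have [_ + _ _ _] := hm => /(_ (- a) _ mE) <-; congr (m _).
apply/seteqP; split=> [y /= Ey|_ [y Ey <-]] /=; last by rewrite addrA subrr add0r.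
by exists (a + y); rewrite // addrA addNr add0r.
Qed.

Lemma ge0_integral_shift (a : B) (f : borel B -> \bar R) :
  measurable_fun setT f -> (forall y, 0 <= f y)%E ->
  (\int[m]_y f (a + y)%R = \int[m]_y f y)%E.
Proof.
move=> mf f0.
have ms : measurable_fun [set: borel B] ((fun y : B => a + y) : borel B -> borel B).
  by apply: continuous_borel_borel; exact: shift_continuous.
have := @ge0_integral_pushforward _ _ _ _ R _ ms m setT f measurableT mf.
move=> /(_ _)/=; rewrite preimage_setT => <-; last by move=> y _; exact: f0.
apply: eq_measure_integral => E mE _.
by rewrite /pushforward -(haar_shift a mE).
Qed.

Lemma ae_shift (a : B) (P : set B) :
  {ae m, forall y, P y} -> {ae m, forall y, P (a + y)}.
Proof.
move=> [N [mN N0 sN]]; exists [set y | N (a + y)]; split.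
- exact: measurable_shift.
- by rewrite haar_shift.
- by move=> y /= nP; apply: sN.
Qed.

Lemma haar_inner_open (U : set B) (t : \bar R) : open U -> (t < m U)%E ->
  exists K : set B, [/\ compact K, K `<=` U & (t < m K)%E].
Proof.
move=> oU; have [_ _ _ _ ->//] := hm.
by move=> /ereal_sup_gt[_ [K [cK KU] <-] tK]; exists K.
Qed.

Lemma haar_outer (E : set B) (e : R) : measurable (E : set (borel B)) -> 0 < e ->
  exists U : set B, [/\ open U, E `<=` U & (m U <= m E + e%:E)%E].
Proof.
move=> mE e0; have [Eoo|Efin] := leP +oo%E (m E).
  by exists setT; split=> //; [exact: openT|rewrite (le_trans (leey _))// (le_trans Eoo)// leeDl// lee_fin ltW].
have [_ _ _ mo _] := hm.
have := mo _ mE; move/eqP; rewrite eq_le => /andP[_ mo'].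
have /ereal_inf_lt[_ [U [oU EU] <-] Ul] :
    (ereal_inf [set m U | U in [set U : set B | open U /\ E `<=` U]] < m E + e%:E)%E.
  by apply: le_lt_trans mo' _; rewrite lteDl ?lte_fin// fin_num_abs gee0_abs.
by exists U; split=> //; exact: ltW.
Qed.

Lemma haar_compact_lty (K : set B) : compact K -> (m K < +oo)%E.
Proof. by have [_ _ + _ _] := hm; apply. Qed.

Lemma compact_borel (K : set B) : compact K -> measurable (K : set (borel B)).
Proof. by move=> cK; apply: closed_borel; exact: compact_closed. Qed.

(** If an open neighbourhood of 0 were null, finitely many translates of it
    would cover any compact set, so every compact set, hence B, would be null. *)
Lemma haar_open_gt0 (U : set B) : open U -> U !=set0 -> (0 < m U)%E.
Proof.
move=> oU [u Uu]; rewrite lt0e measure_ge0 andbT; apply/eqP => mU0.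
have [/eqP mT _ _ _ _] := hm; apply: mT; apply/eqP; rewrite eq_le measure_ge0 andbT.
rewrite leNgt; apply/negP => /(haar_inner_open openT)[K [cK _]]; apply/negP.
rewrite -leNgt.
have nW x : K x -> nbhs x [set y | U (u + (y - x))].
  move=> _; apply: (@nbhs_shift B x [set y | U (u + y)]).
  have : (fun y : B => u + y) @ 0 --> u + 0 by exact: shift_continuous.
  by rewrite addr0; apply; exact: open_nbhs_nbhs.
have [s [_ Ks]] := compact_finite_subcover cK nW.
have mW x : measurable ([set y | U (u + (y - x))] : set (borel B)).
  rewrite (_ : [set _ | _] = [set y | U ((u - x) + y)]).
    by apply: measurable_shift; exact: open_borel.
  by apply/funext => y /=; rewrite addrA addrAC.
have mK0 : (m (\big[setU/set0]_(x <- s) [set y | U (u + (y - x))%R]) <= 0)%E.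
  elim: s {Ks} => [|x s ih]; first by rewrite big_nil measure0.
  rewrite big_cons; apply: le_trans (measureU2 _ _ _) _ => //.
    by apply: bigsetU_measurable.
  rewrite -[leRHS]adde0; apply: leeD => //.
  rewrite -mU0 -(haar_shift (u - x)); last exact: open_borel.
  rewrite (_ : [set _ | _] = [set y | U ((u - x) + y)])//.
  by apply/funext => y /=; rewrite addrA addrAC.
apply: le_trans mK0; apply: le_measure; rewrite ?inE.
- exact: compact_borel.
- exact: bigsetU_measurable.
- move=> y /Ks[x xs Wxy]; by rewrite -bigcup_seq; exists x.
Qed.

(** Outer regularity of the difference U minus E, for an open U slightly larger
    than E, cuts out of a compact subset of U a compact subset of E. *)
Lemma haar_inner (E : set B) (e : R) : measurable (E : set (borel B)) ->
  (m E < +oo)%E -> 0 < e ->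
  exists K : set B, [/\ compact K, K `<=` E & (m (E `\` K) < e%:E)%E].
Proof.
move=> mE Efin e0; have e30 : 0 < e / 4 by rewrite divr_gt0.
have [U [oU EU mU]] := haar_outer mE e30.
have mUb := open_borel oU.
have Efn : m E \is a fin_num by rewrite ge0_fin_numE.
have Ufin : (m U < +oo)%E.
  by rewrite (le_lt_trans mU)// lte_add_pinfty// ltry.
have Ufn : m U \is a fin_num by rewrite ge0_fin_numE.
have mUE : (m (U `\` E) <= (e / 4)%:E)%E.
  by rewrite measureD// setIidr// leeBlDl.
have [W [oW UEW mW]] := haar_outer (measurableD mUb mE) e30.
have [K [cK KU mK]] : exists K : set B,
    [/\ compact K, K `<=` U & (m U - (e / 4)%:E < m K)%E].
  by apply: haar_inner_open => //; rewrite lteBlDr// lteDl// lte_fin.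
have mKb := compact_borel cK.
have mUK : (m (U `\` K) <= (e / 4)%:E)%E.
  rewrite measureD// setIidr// leeBlDl; last first.
    by rewrite ge0_fin_numE// haar_compact_lty.
  by move/ltW : mK; rewrite leeBlDr.
exists (K `\` W); split.
- by rewrite setDE; apply: compact_closedI => //; exact: open_closedC.
- move=> y [Ky nWy]; apply: contrapT => nEy; apply: nWy; apply: UEW.
  by split=> //; exact: KU.
- have mWb := open_borel oW.
  have sub : E `\` (K `\` W) `<=` (U `\` K) `|` W.
    move=> y [Ey nKW]; have [Ky|nKy] := pselect (K y).
      by right; apply: contrapT => nWy; apply: nKW.
    by left; split=> //; exact: EU.
  apply: (@le_lt_trans _ _ (m ((U `\` K) `|` W))).
    by apply: le_measure => //; rewrite inE;
       do ?[apply: measurableU|apply: measurableD].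
  apply: (@le_lt_trans _ _ ((e / 4)%:E + ((e / 4)%:E + (e / 4)%:E))%E).
    apply: (le_trans (measureU2 _ _ _)) => //; first exact: measurableD.
    by apply: leeD => //; apply: (le_trans mW); exact: leeD.
  by rewrite -!EFinD lte_fin; lra.
Qed.

Lemma integral_truncation_cvg (p : borel B -> R) :
  measurable_fun setT p -> (forall y, 0 <= p y) ->
  (\int[m]_y (if (n.+1%:R^-1 < p y) then Num.min (p y) n.+1%:R else 0)%:E
     @[n --> \oo] --> \int[m]_y (p y)%:E)%E.
Proof.
move=> mp p0.
pose g n y := (if (n.+1%:R^-1 < p y) then Num.min (p y) n.+1%:R else 0)%:E.
have lim y : limn (g ^~ y) = (p y)%:E.
  apply/cvg_lim => //; apply: cvg_near_cst.
  have [py0|] := eqVneq (p y) 0.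
    by apply: nearW => n; rewrite /g py0 ltNge invr_ge0 ler0n.
  move=> py0; have {py0}py : 0 < p y by rewrite lt0r py0 p0.
  near=> n.
  have n1 : (Num.truncn (p y)^-1 <= n)%N by near: n; exact: nbhs_infty_ge.
  have n2 : (Num.truncn (p y) <= n)%N by near: n; exact: nbhs_infty_ge.
  rewrite /g ifT; last first.
    rewrite invf_plt ?posrE// (lt_le_trans (truncnS_gt _))//.
    by rewrite ler_nat ltnS.
  by rewrite min_l// (le_trans (ltW (truncnS_gt _)))// ler_nat ltnS.
rewrite (_ : (fun y => (p y)%:E) = (fun y => limn (g ^~ y))); last first.
  by apply/funext => y; rewrite lim.
apply: cvg_monotone_convergence => //.
- move=> n; apply/measurable_EFinP.
  apply: measurable_fun_ifT => //.
    by apply: measurable_fun_ltr.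
  by apply: measurable_minr.
- move=> n y _; rewrite lee_fin; case: ifP => // _.
  by rewrite le_min p0 ler0n.
- move=> y _ k l kl; rewrite lee_fin.
  have ivl : l.+1%:R^-1 <= k.+1%:R^-1 :> R by rewrite lef_pV2 ?posrE// ler_nat ltnS.
  case: ifPn => [h1|_]; last by case: ifP => // _; rewrite le_min p0 ler0n.
  rewrite (le_lt_trans ivl h1) le_min ge_min lexx /= ge_min.
  by rewrite ler_nat ltnS kl orbT.
Unshelve. all: by end_near. Qed.

(** Little of the integral of p is lost by truncating p at the height n + 1
    and dropping its values below 1/(n+1); the set where p is larger than
    1/(n+1) has finite measure by Markov, and regularity replaces it by a
    compact subset. This is what makes measures without sigma-finiteness
    tractable in the sequel. *)
Lemma haar_tight (p : borel B -> R) (e : R) :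
  measurable_fun setT p -> (forall y, 0 <= p y) ->
  (\int[m]_y (p y)%:E < +oo)%E -> 0 < e ->
  exists K : set B, compact K /\ (\int[m]_(y in ~` K) (p y)%:E < e%:E)%E.
Proof.
move=> mp p0 pfin e0.
have e20 : 0 < e / 2 by rewrite divr_gt0.
have cv := integral_truncation_cvg mp p0.
set I := (\int[m]_y (p y)%:E)%E in pfin cv *.
have I0 : (0 <= I)%E by apply: integral_ge0 => y _; rewrite lee_fin.
have Ifn : I \is a fin_num by rewrite ge0_fin_numE.
pose q n y := if (n.+1%:R^-1 < p y) then Num.min (p y) n.+1%:R else 0.
have [n In] : exists n, (I - (e / 2)%:E < \int[m]_y (q n y)%:E)%E.
  apply: contrapT => /forallNP h.
  have /cvge_to_le := cv => /(_ (I - (e / 2)%:E)%E).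
  have /[swap]/[apply] : \forall n \near \oo,
      (\int[m]_y (q n y)%:E <= I - (e / 2)%:E)%E.
    by apply: nearW => n; rewrite leNgt; apply/negP/h.
  by rewrite leNgt lteBlDr// lteDl// lte_fin e20.
have q0 y : 0 <= q n y.
  by rewrite /q; case: ifP => // _; rewrite le_min p0 ler0n.
have qp y : q n y <= p y.
  by rewrite /q; case: ifP => // _; rewrite ge_min lexx.
have mq : measurable_fun [set: borel B] (q n).
  apply: measurable_fun_ifT => //; first exact: measurable_fun_ltr.
  exact: measurable_minr.
pose E := [set y : borel B | n.+1%:R^-1 < p y].
have mE : measurable E.
  rewrite (_ : E = p @^-1` `]n.+1%:R^-1, +oo[); last first.
    by apply/seteqP; split => y; rewrite /E/= in_itv/= andbT.
  by rewrite -[X in measurable X]setTI; exact: mp.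
have Efin : (m E < +oo)%E.
  have n0 : 0 < n.+1%:R^-1 :> R by rewrite invr_gt0 ltr0n.
  have : (n.+1%:R^-1%:E * m E < +oo)%E.
    apply: le_lt_trans pfin; apply: ge0_markov => //; exact: ltW.
  by rewrite !ltey; apply: contraNneq => ->; rewrite gt0_muley// lte_fin.
have N0 : 0 < n.+1%:R :> R by rewrite ltr0n.
have [K [cK KE mK]] := haar_inner mE Efin (divr_gt0 e20 N0).
exists K; split=> //.
have mKc : measurable (~` K : set (borel B)).
  by apply: measurableC; exact: compact_borel.
have -> : (\int[m]_(y in ~` K) (p y)%:E =
    \int[m]_(y in ~` K) (p y - q n y)%:E + \int[m]_(y in ~` K) (q n y)%:E)%E.
  rewrite -ge0_integralD//=; last first.
  - by apply/measurable_EFinP; apply: measurable_funS mq.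
  - by move=> y _; rewrite lee_fin.
  - by apply/measurable_EFinP; apply: measurable_funB;
      [apply: measurable_funS mp|apply: measurable_funS mq].
  - by move=> y _; rewrite lee_fin subr_ge0.
  by apply: eq_integral => y _; rewrite -EFinD subrK.
have h1 : (\int[m]_(y in ~` K) (p y - q n y)%:E <= (e / 2)%:E)%E.
  apply: (@le_trans _ _ (\int[m]_y (p y - q n y)%:E)%E).
    apply: ge0_subset_integral => //.
    - by apply/measurable_EFinP; apply: measurable_funB.
    - by move=> y _; rewrite lee_fin subr_ge0.
  have : (I = \int[m]_y (p y - q n y)%:E + \int[m]_y (q n y)%:E)%E.
    rewrite -ge0_integralD//=.
    - by apply: eq_integral => y _; rewrite -EFinD subrK.
    - by move=> y _; rewrite lee_fin subr_ge0.
    - by apply/measurable_EFinP; apply: measurable_funB.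
    - by move=> y _; rewrite lee_fin.
    - exact/measurable_EFinP.
  move=> IE; rewrite IE in In Ifn.
  move: Ifn In; rewrite fin_numD => /andP[].
  move: (\int[m]_y (p y - q n y)%:E)%E (\int[m]_y (q n y)%:E)%E.
  by move=> [a||] [b||]//= _ _; rewrite lte_fin lee_fin; lra.
have h2 : (\int[m]_(y in ~` K) (q n y)%:E < (e / 2)%:E)%E.
  have mEK : measurable (E `\` K) by apply: measurableD => //; exact: compact_borel.
  apply: (@le_lt_trans _ _ (\int[m]_y (n.+1%:R%:E * (\1_(E `\` K) y)%:E))%E).
    rewrite integral_mkcond; apply: ge0_le_integral => //.
    - by move=> y _; rewrite patchE; case: ifP => // _; rewrite lee_fin.
    - apply/(measurable_restrictT _ _).1 => //.
      by apply/measurable_EFinP; apply: measurable_funS mq.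
    - by apply: measurable_funeM; apply/measurable_EFinP; exact: measurable_indic.
    - move=> y _; rewrite patchE; case: ifPn => [|_]; last first.
        by rewrite mule_ge0// lee_fin.
      rewrite inE => /= nKy; rewrite -EFinM lee_fin /q indicE.
      case: ifPn => [h|_]; last by rewrite mulr_ge0.
      by rewrite mem_set//= mulr1 ge_min lexx orbT.
  rewrite ge0_integralZl//=.
  - by rewrite integral_indic// setIT -lte_pdivlMl// -EFinM mulrC.
  - by apply/measurable_EFinP; exact: measurable_indic.
have -> : e%:E = ((e / 2)%:E + (e / 2)%:E)%E by rewrite -EFinD -splitr.
by apply: (le_lt_trans (leeD h1 (lexx _))); rewrite lteD2lE.
Qed.
End haar_theory.

(** * Square integrable functions *)

Section almost_everywhere_borel.
Variables (R : realType) (B : PreTopologicalZmodule.type).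
Variable m : {measure set (borel B) -> \bar R}.

(** Statements that hold almost everywhere on B and on borel B are
    convertible but do not unify; these lemmas fix the former. *)
Lemma aeS (P Q : B -> Prop) : (forall y, P y -> Q y) ->
  {ae m, forall y : B, P y} -> {ae m, forall y : B, Q y}.
Proof. by move=> PQ; apply: (@filterS _ _ (ae_filter_ringOfSetsType m)). Qed.

Lemma aeS2 (P Q S : B -> Prop) : (forall y, P y -> Q y -> S y) ->
  {ae m, forall y : B, P y} -> {ae m, forall y : B, Q y} ->
  {ae m, forall y : B, S y}.
Proof. by move=> PQ; apply: (@filterS2 _ _ (ae_filter_ringOfSetsType m)). Qed.

Lemma aeT (P : B -> Prop) : (forall y, P y) -> {ae m, forall y : B, P y}.
Proof. by move=> PT; apply: (@filterS _ _ (ae_filter_ringOfSetsType m) setT) => //; exact: filterT. Qed.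
End almost_everywhere_borel.

Section square_integrable.
Variables (R : realType) (B : PreTopologicalZmodule.type).
Variable m : {measure set (borel B) -> \bar R}.
Implicit Types f g h : B -> R[i].

Definition sqint f : \bar R := (\int[m]_y ((normc (f y)) ^+ 2)%:E)%E.
Definition sqnorm f : R := fine (sqint f).

Lemma sqint_ge0 f : (0 <= sqint f)%E.
Proof. by apply: integral_ge0 => y _; rewrite lee_fin sqr_ge0. Qed.

Lemma sqnorm_ge0 f : 0 <= sqnorm f.
Proof. exact/fine_ge0/sqint_ge0. Qed.

Lemma measurable_sqr_normc f : cmeasurable f ->
  measurable_fun [set: borel B] (fun y => (normc (f y)) ^+ 2).
Proof. by move=> mf; apply: measurable_funX; exact: measurable_normc. Qed.

Lemma cnorm_L2E f : (cnorm_L m 2%:E f `^ 2 = sqint f)%E.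
Proof.
rewrite /cnorm_L poweR_Lnorm//; apply: eq_integral => y _.
by rewrite gee0_abs ?lee_fin ?normc_ge0// poweR_EFin powR_mulrn// normc_ge0.
Qed.

Lemma cnorm_L2_sqint f : cnorm_L m 2%:E f = sqrte (sqint f).
Proof.
rewrite -poweR12_sqrt ?sqint_ge0// -cnorm_L2E -poweRrM mulfV// poweRe1//; exact: Lnorm_ge0.
Qed.

Lemma cnorm_L2_lt f (e : R) : 0 <= e ->
  (cnorm_L m 2%:E f < e%:E)%E = (sqint f < (e ^+ 2)%:E)%E.
Proof.
move=> e0; rewrite cnorm_L2_sqint; have := sqint_ge0 f.
case: (sqint f) => [r| |] //=; rewrite lee_fin !lte_fin => r0.
by rewrite -[in RHS](sqr_sqrtr r0) ltr_pXn2r// nnegrE sqrtr_ge0.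
Qed.

Lemma cnorm_L2_lty f : (cnorm_L m 2%:E f < +oo)%E = (sqint f < +oo)%E.
Proof. by rewrite cnorm_L2_sqint; case: (sqint f) => [r||]//=; rewrite !ltry. Qed.

Lemma cnorm_L2_eq1 f : cnorm_L m 2%:E f = 1%E -> sqint f = 1%E.
Proof. by rewrite -cnorm_L2E => ->; rewrite poweR1r. Qed.

Definition L2 f := in_L m 2%:E f.

Lemma L2P f : L2 f <-> cmeasurable f /\ (sqint f < +oo)%E.
Proof. by rewrite /L2 /in_L cnorm_L2_lty. Qed.

Lemma sqint_fin f : L2 f -> sqint f = (sqnorm f)%:E.
Proof. by move=> /L2P[_ ff]; rewrite fineK// ge0_fin_numE// sqint_ge0. Qed.

Definition cintegrable f :=
  cmeasurable f /\ (\int[m]_y (normc (f y))%:E < +oo)%E.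

Lemma cintegrable_Re f : cintegrable f ->
  m.-integrable setT (EFin \o (fun x : borel B => complex.Re (f x))).
Proof.
move=> [mf fi]; apply: (@le_integrable _ _ _ _ _ _ _ (fun x : borel B => (normc (f x))%:E)) => //.
- by apply/measurable_EFinP; case: mf.
- by move=> x _; rewrite /= lee_fin (ger0_norm (normc_ge0 _)) Re_le_normc.
- apply/integrableP; split; first by apply/measurable_EFinP; exact: measurable_normc.
  rewrite (eq_integral (fun y : borel B => (normc (f y))%:E))// => y _.
  by rewrite gee0_abs// lee_fin normc_ge0.
Qed.

Lemma cintegrable_Im f : cintegrable f ->
  m.-integrable setT (EFin \o (fun x : borel B => complex.Im (f x))).
Proof.
move=> [mf fi]; apply: (@le_integrable _ _ _ _ _ _ _ (fun x : borel B => (normc (f x))%:E)) => //.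
- by apply/measurable_EFinP; case: mf.
- by move=> x _; rewrite /= lee_fin (ger0_norm (normc_ge0 _)) Im_le_normc.
- apply/integrableP; split; first by apply/measurable_EFinP; exact: measurable_normc.
  rewrite (eq_integral (fun y : borel B => (normc (f y))%:E))// => y _.
  by rewrite gee0_abs// lee_fin normc_ge0.
Qed.

Lemma cintegralD f g : cintegrable f -> cintegrable g ->
  cintegral m (fun x => f x + g x) = cintegral m f + cintegral m g.
Proof.
move=> fi gi; rewrite /cintegral.
have -> : (fun x : borel B => complex.Re (f x + g x)) =
    (fun x : borel B => complex.Re (f x) + complex.Re (g x)).
  by apply/funext => x; case: (f x) (g x) => a b [].
have -> : (fun x : borel B => complex.Im (f x + g x)) =
    (fun x : borel B => complex.Im (f x) + complex.Im (g x)).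
  by apply/funext => x; case: (f x) (g x) => a b [].
by rewrite !RintegralD//; (exact: cintegrable_Re || exact: cintegrable_Im).
Qed.

Lemma cintegralZ (c : R[i]) f : cintegrable f ->
  cintegral m (fun x => c * f x) = c * cintegral m f.
Proof.
move=> fi; rewrite /cintegral; case: c => a b.
have -> : (fun x : borel B => complex.Re ((a +i* b) * f x)) =
    (fun x : borel B => a * complex.Re (f x) - b * complex.Im (f x)).
  by apply/funext => x; case: (f x).
have -> : (fun x : borel B => complex.Im ((a +i* b) * f x)) =
    (fun x : borel B => a * complex.Im (f x) + b * complex.Re (f x)).
  by apply/funext => x; case: (f x).
have fR := cintegrable_Re fi; have fI := cintegrable_Im fi.
have ZR c : m.-integrable setT (EFin \o (fun x : borel B => c * complex.Re (f x))).
  by have := integrableZl measurableT c fR.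
have ZI c : m.-integrable setT (EFin \o (fun x : borel B => c * complex.Im (f x))).
  by have := integrableZl measurableT c fI.
by rewrite RintegralB// RintegralD// !RintegralZl//; congr Complex.
Qed.

Lemma cintegralJ f : cintegrable f ->
  cintegral m (fun x => (f x)^*) = (cintegral m f)^*.
Proof.
move=> fi; rewrite /cintegral /=; congr Complex.
  by apply: eq_Rintegral => x _; case: (f x).
rewrite -mulN1r -RintegralZl//; last exact: cintegrable_Im.
by apply: eq_Rintegral => x _; case: (f x) => a b /=; rewrite mulN1r.
Qed.

Lemma cintegral_ae f g : cmeasurable f -> cmeasurable g ->
  {ae m, forall y : B, f y = g y} -> cintegral m f = cintegral m g.
Proof.
move=> [f1 f2] [g1 g2] fg; rewrite /cintegral /Rintegral; congr (fine _ +i* fine _);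
  apply: ae_eq_integral => //; do ?exact/measurable_EFinP;
  by apply: aeS fg => y /= ->.
Qed.

Lemma normcD_sqr_le (z w : R[i]) :
  normc (z + w) ^+ 2 <= 2 * (normc z ^+ 2 + normc w ^+ 2).
Proof.
rewrite !normc_sqrE; case: z w => a b [c d] /=.
have := sqr_ge0 (a - c); have := sqr_ge0 (b - d); nra.
Qed.

Lemma L2D f g : L2 f -> L2 g -> L2 (fun x => f x + g x).
Proof.
move=> /L2P[mf fi] /L2P[mg gi]; apply/L2P; split; first exact: cmeasurableD.
apply: (@le_lt_trans _ _ (2%:E * (sqint f + sqint g))%E); last first.
  by rewrite lte_mul_pinfty// ?lee_fin// lte_add_pinfty.
rewrite -ge0_integralD//=; first last.
- by apply/measurable_EFinP; exact: measurable_sqr_normc.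
- by move=> y _; rewrite lee_fin sqr_ge0.
- by apply/measurable_EFinP; exact: measurable_sqr_normc.
- by move=> y _; rewrite lee_fin sqr_ge0.
rewrite -ge0_integralZl//=; first last.
- by move=> y _; rewrite -EFinD lee_fin addr_ge0// sqr_ge0.
- by apply: emeasurable_funD; by apply/measurable_EFinP; exact: measurable_sqr_normc.
apply: ge0_le_integral => //=.
- by move=> y _; rewrite lee_fin sqr_ge0.
- by apply/measurable_EFinP; apply: measurable_sqr_normc; exact: cmeasurableD.
- by apply: measurable_funeM; apply: emeasurable_funD;
    by apply/measurable_EFinP; exact: measurable_sqr_normc.
- by move=> y _; rewrite -EFinD -EFinM lee_fin normcD_sqr_le.
Qed.

Lemma L2_mul_bounded (u f : B -> R[i]) (c : R) : cmeasurable u ->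
  (forall y, normc (u y) <= c) -> L2 f -> L2 (fun x => u x * f x).
Proof.
move=> mu uc /L2P[mf fi]; apply/L2P; split; first exact: cmeasurableM.
apply: (@le_lt_trans _ _ ((c ^+ 2)%:E * sqint f)%E); last first.
  by rewrite lte_mul_pinfty// lee_fin sqr_ge0.
rewrite -ge0_integralZl//=; first last.
- by rewrite lee_fin sqr_ge0.
- by move=> y _; rewrite lee_fin sqr_ge0.
- by apply/measurable_EFinP; exact: measurable_sqr_normc.
apply: ge0_le_integral => //=.
- by move=> y _; rewrite lee_fin sqr_ge0.
- by apply/measurable_EFinP; apply: measurable_sqr_normc; exact: cmeasurableM.
- by apply: measurable_funeM; by apply/measurable_EFinP; exact: measurable_sqr_normc.
- move=> y _; rewrite -EFinM lee_fin normcM exprMn ler_wpM2r ?sqr_ge0//.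
  by rewrite lerXn2r ?nnegrE ?normc_ge0// (le_trans (normc_ge0 _) (uc y)).
Qed.

Lemma L2Z (c : R[i]) f : L2 f -> L2 (fun x => c * f x).
Proof. by apply: L2_mul_bounded; [exact: cmeasurable_cst|move=> y; exact: lexx]. Qed.

Lemma cintegrable_mulJ f g : L2 f -> L2 g -> cintegrable (fun x => f x * (g x)^*).
Proof.
move=> /L2P[mf fi] /L2P[mg gi].
have mfg : cmeasurable (fun x => f x * (g x)^*).
  by apply: cmeasurableM => //; exact: cmeasurableJ.
split=> //; apply: (@le_lt_trans _ _ (sqint f + sqint g)%E); last first.
  exact: lte_add_pinfty.
rewrite -ge0_integralD//=; first last.
- by apply/measurable_EFinP; exact: measurable_sqr_normc.
- by move=> y _; rewrite lee_fin sqr_ge0.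
- by apply/measurable_EFinP; exact: measurable_sqr_normc.
- by move=> y _; rewrite lee_fin sqr_ge0.
apply: ge0_le_integral => //=.
- by move=> y _; rewrite lee_fin normc_ge0.
- by apply/measurable_EFinP; exact: measurable_normc.
- by apply: emeasurable_funD; by apply/measurable_EFinP; exact: measurable_sqr_normc.
- move=> y _; rewrite -EFinD lee_fin normcM normc_conj.
  have := normc_ge0 (f y); have := normc_ge0 (g y).
  by have := sqr_ge0 (normc (f y) - normc (g y)); nra.
Qed.

Lemma innerJ f g : L2 f -> L2 g -> inner m g f = (inner m f g)^*.
Proof.
move=> f2 g2; rewrite /inner -cintegralJ; last exact: cintegrable_mulJ.
by congr cintegral; apply/funext => y; rewrite rmorphM /= conjCK mulrC.
Qed.

Lemma innerDl f g h : L2 f -> L2 g -> L2 h ->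
  inner m (fun x => f x + g x) h = inner m f h + inner m g h.
Proof.
move=> f2 g2 h2; rewrite /inner -cintegralD; do ?exact: cintegrable_mulJ.
by congr cintegral; apply/funext => y; rewrite mulrDl.
Qed.

Lemma innerZl (c : R[i]) f h : L2 f -> L2 h ->
  inner m (fun x => c * f x) h = c * inner m f h.
Proof.
move=> f2 h2; rewrite /inner -cintegralZ; do ?exact: cintegrable_mulJ.
by congr cintegral; apply/funext => y; rewrite mulrA.
Qed.

Lemma innerDr f g h : L2 f -> L2 g -> L2 h ->
  inner m h (fun x => f x + g x) = inner m h f + inner m h g.
Proof.
move=> f2 g2 h2; rewrite (innerJ (L2D f2 g2) h2) innerDl//.
by rewrite (innerJ f2 h2) (innerJ g2 h2); exact: rmorphD.
Qed.

Lemma innerZr (c : R[i]) f h : L2 f -> L2 h ->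
  inner m h (fun x => c * f x) = c^* * inner m h f.
Proof.
move=> f2 h2; rewrite (innerJ (L2Z c f2) h2) innerZl//.
by rewrite (innerJ f2 h2); exact: rmorphM.
Qed.

Lemma inner_self f : inner m f f = (sqnorm f)%:C.
Proof.
rewrite /inner /cintegral /sqnorm /sqint /Rintegral; congr (fine _ +i* _).
  by apply: eq_integral => y _; rewrite mulJc.
by under eq_integral do rewrite mulJc /=; rewrite integral0.
Qed.

Lemma sqnormD f g : L2 f -> L2 g ->
  sqnorm (fun x => f x + g x) =
  sqnorm f + sqnorm g + 2 * complex.Re (inner m f g).
Proof.
move=> f2 g2; apply: (@complexI R).
rewrite -inner_self innerDl//; do ?exact: L2D.
rewrite !innerDr// !inner_self (innerJ f2 g2).
by case: (inner m f g) => a b; congr Complex; rewrite /=; ring.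
Qed.

Lemma sqnormZ (c : R[i]) f : L2 f ->
  sqnorm (fun x => c * f x) = normc c ^+ 2 * sqnorm f.
Proof.
move=> f2; apply: (@complexI R); rewrite -inner_self innerZl//; last exact: L2Z.
by rewrite innerZr// mulrA mulJc inner_self -rmorphM.
Qed.

(** The defect in the inequality of Cauchy and Schwarz: if it is an equality
    then f is almost everywhere a multiple of g. *)
Lemma sqnorm_sub_proj f g : L2 f -> L2 g -> sqnorm g = 1 ->
  sqnorm (fun x => f x + (- inner m f g) * g x) =
  sqnorm f - normc (inner m f g) ^+ 2.
Proof.
move=> f2 g2 g1; rewrite sqnormD//; last exact: L2Z.
rewrite sqnormZ// g1 innerZr// normcN normc_sqrE rmorphN /=.
by case: (inner m f g) => a b /=; ring.
Qed.

Lemma cauchy_schwarz_unit f g : L2 f -> L2 g -> sqnorm g = 1 ->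
  normc (inner m f g) ^+ 2 <= sqnorm f.
Proof.
by move=> f2 g2 g1; rewrite -subr_ge0 -sqnorm_sub_proj// sqnorm_ge0.
Qed.

Lemma sqnorm_eq0 f : L2 f -> sqnorm f = 0 -> {ae m, forall y : B, f y = 0}.
Proof.
move=> f2 f0; have [mf _] := (L2P f).1 f2.
have : (\int[m]_y `|((normc (f y)) ^+ 2)%:E| = 0)%E.
  under eq_integral do rewrite gee0_abs ?lee_fin ?sqr_ge0//.
  by rewrite -/(sqint f) sqint_fin// f0.
move/ae_eq_integral_abs => /(_ measurableT).
have /measurable_EFinP mf2 := measurable_sqr_normc mf.
move=> /(_ mf2); apply: aeS => y /= /(_ I)[] /eqP.
by rewrite sqrf_eq0 normc_eq0 => /eqP.
Qed.

Lemma inner_ae f f' g g' : cmeasurable f -> cmeasurable f' ->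
  cmeasurable g -> cmeasurable g' ->
  {ae m, forall y : B, f y = f' y} -> {ae m, forall y : B, g y = g' y} ->
  inner m f g = inner m f' g'.
Proof.
move=> mf mf' mg mg' ff gg; apply: cintegral_ae.
- by apply: cmeasurableM => //; exact: cmeasurableJ.
- by apply: cmeasurableM => //; exact: cmeasurableJ.
- by apply: aeS2 ff gg => y /= -> ->.
Qed.

Lemma sqint_ae f g : cmeasurable f -> cmeasurable g ->
  {ae m, forall y : B, f y = g y} -> sqint f = sqint g.
Proof.
move=> mf mg fg; apply: ae_eq_integral => //;
  try by apply/measurable_EFinP; exact: measurable_sqr_normc.
by apply: aeS fg => y /= ->.
Qed.

Lemma inner_unimodular (u f g : B -> R[i]) : (forall y, normc (u y) = 1) ->
  inner m (fun y => u y * f y) (fun y => u y * g y) = inner m f g.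
Proof.
move=> u1; congr cintegral; apply/funext => y.
by rewrite rmorphM /= mulrACA mulJc u1 expr1n mul1r.
Qed.

Lemma sqint_unimodular (u f : B -> R[i]) : (forall y, normc (u y) = 1) ->
  sqint (fun y => u y * f y) = sqint f.
Proof.
by move=> u1; apply: eq_integral => y _; rewrite normcM u1 mul1r.
Qed.
End square_integrable.

(** * Series of indicators with harmonic coefficients *)

Section harmonic_decomposition.
Context d (T : measurableType d) (R : realType).
Variable p : T -> \bar R.

(** Greedy expansion of p y with steps 1, 1/2, 1/3, ...: a step is taken
    exactly when the partial sum stays below p y. *)
Fixpoint harmonic_greedy (n : nat) (y : T) : R :=
  if n is k.+1 then
    harmonic_greedy k y +
      (if ((harmonic_greedy k y + k.+1%:R^-1)%:E <= p y)%E then k.+1%:R^-1 else 0)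
  else 0.

Definition harmonic_level (k : nat) : set T :=
  [set y | ((harmonic_greedy k y + k.+1%:R^-1)%:E <= p y)%E].

Lemma harmonic_greedy_sum n y :
  harmonic_greedy n y = \sum_(0 <= k < n) k.+1%:R^-1 * \1_(harmonic_level k) y.
Proof.
elim: n => [|n ih]; first by rewrite big_nil.
rewrite big_nat_recr//= -ih; congr (_ + _); rewrite indicE.
have [h|h] := boolP (_ <= p y)%E; first by rewrite mem_set ?mulr1.
by rewrite memNset ?mulr0//; exact/negP.
Qed.

Lemma harmonic_greedy_homo y : {homo harmonic_greedy ^~ y : m n / (m <= n)%N >-> m <= n}.
Proof.
apply/nondecreasing_seqP => n /=; rewrite lerDl; case: ifP => // _.
Qed.

Hypothesis p0 : forall y, (0 <= p y)%E.

Lemma harmonic_greedy_le n y : ((harmonic_greedy n y)%:E <= p y)%E.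
Proof. by elim: n => [//|n ih] /=; case: ifP => //; rewrite addr0. Qed.

(** If the limit were smaller than p y, all late steps would be taken, and
    the harmonic series would converge. *)
Lemma harmonic_greedy_cvg y : (harmonic_greedy n y)%:E @[n --> \oo] --> p y.
Proof.
have nd : {homo (fun n => (harmonic_greedy n y)%:E) : m n / (m <= n)%N >-> (m <= n)%E}.
  by move=> k n kn; rewrite lee_fin harmonic_greedy_homo.
have cv := ereal_nondecreasing_cvgn nd.
set l := ereal_sup _ in cv.
have lp : (l <= p y)%E.
  by apply: ge_ereal_sup => _ [n _ <-]; exact: harmonic_greedy_le.
have Sl n : ((harmonic_greedy n y)%:E <= l)%E by apply: ereal_sup_ubound; exists n.
have [<-//|lneq] := eqVneq l (p y).
have {lneq lp}ltp : (l < p y)%E by rewrite lt_neqAle lneq.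
exfalso; have l0 : (0 <= l)%E := Sl 0%N.
have [r lr] : exists r, l = r%:E.
  by move: l0 ltp; case: (l) => [r _ _| |//]; [exists r|case: (p y)].
have [e e0 rep] : exists2 e, 0 < e & ((r + e)%:E <= p y)%E.
  move: ltp; rewrite lr; case: (p y) => [q| |//]; rewrite ?lte_fin => h.
    by exists (q - r); rewrite ?subr_gt0// addrC subrK.
  by exists 1; rewrite ?leey.
pose N := Num.truncn e^-1.
have inE k : (N <= k)%N -> ((harmonic_greedy k y + k.+1%:R^-1)%:E <= p y)%E.
  move=> Nk; apply: le_trans rep; rewrite lee_fin; apply: lerD.
    by rewrite -lee_fin -lr.
  rewrite invf_ple ?posrE//; apply: le_trans (ltW (truncnS_gt _)) _.
  by rewrite ler_nat ltnS.
have SH n : harmonic_greedy (N + n) y =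
    harmonic_greedy N y + \sum_(N <= k < N + n) k.+1%:R^-1.
  elim: n => [|n ih]; first by rewrite addn0 big_geq ?addr0.
  by rewrite addnS big_nat_recr ?leq_addr//= inE ?leq_addr// ih addrA.
apply: (@dvg_harmonic R); apply: nondecreasing_is_cvgn.
  apply/nondecreasing_seqP => n; rewrite /series/= big_nat_recr//= lerDl.
  by rewrite invr_ge0.
exists (\sum_(0 <= k < N) k.+1%:R^-1 + r) => _ [n _ <-].
rewrite /series /=; apply: (@le_trans _ _ (\sum_(0 <= k < N + n) harmonic k)).
  rewrite [leRHS](big_cat_nat (n := n)) ?leq_addl//= lerDl sumr_ge0//.
rewrite (big_cat_nat (n := N)) ?leq_addr//= lerD2l.
have := Sl (N + n)%N; rewrite lr lee_fin SH; apply: le_trans.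
by rewrite lerDr; have := harmonic_greedy_homo y (leq0n N).
Qed.

Lemma harmonic_levelE y :
  p y = (\sum_(0 <= k <oo) (k.+1%:R^-1 * \1_(harmonic_level k) y)%:E)%E.
Proof.
apply/esym/cvg_lim => //.
have -> : (fun n => \sum_(0 <= k < n) (k.+1%:R^-1 * \1_(harmonic_level k) y)%:E)%E =
   (fun n => (harmonic_greedy n y)%:E).
  by apply/funext => n; rewrite harmonic_greedy_sum sumEFin.
exact: harmonic_greedy_cvg.
Qed.

Hypothesis mp : measurable_fun setT p.

Lemma measurable_harmonic_greedy n : measurable_fun setT (harmonic_greedy n).
Proof.
elim: n => [|n ih]; first exact: measurable_cst.
apply: measurable_funD => //; apply: measurable_fun_ifT => //.
by apply: measurable_fun_lee => //; apply/measurable_EFinP; exact: measurable_funD.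
Qed.

Lemma measurable_harmonic_level k : measurable (harmonic_level k).
Proof.
rewrite -[X in measurable X]setTI.
apply: measurable_lee => //; apply/measurable_EFinP.
by apply: measurable_funD => //; exact: measurable_harmonic_greedy.
Qed.
End harmonic_decomposition.

(** * Continuity of translations in L^1 *)

Section translation_continuity.
Variables (R : realType) (B : topologicalZmodType).
Variable m : {measure set (borel B) -> \bar R}.
Hypothesis hB : hausdorff_space B.
Hypothesis hm : haar_measure m.

Lemma near0_opp (P : B -> Prop) : (\forall x \near (0 : B), P x) ->
  \forall x \near (0 : B), P (- x).
Proof.
have : (-%R : B -> B) @ (0 : B) --> (- 0 : B) by exact: opp_continuous.
by rewrite oppr0 => h /h.
Qed.

Lemma measurable_shiftN (x : B) (E : set (borel B)) : measurable E ->
  measurable ([set y | E (y - x)] : set (borel B)).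
Proof.
move=> mE; rewrite (_ : [set _ | _] = [set y | E (- x + y)]); last first.
  by apply/funext => y /=; rewrite addrC.
exact: measurable_shift.
Qed.

Lemma haar_shiftN (x : B) (E : set (borel B)) : measurable E ->
  m [set y | E (y - x)%R] = m E.
Proof.
move=> mE; rewrite (_ : [set _ | _] = [set y | E (- x + y)%R]); last first.
  by apply/funext => y /=; rewrite addrC.
exact: haar_shift.
Qed.

Lemma near_compact_shift (K U : set B) : compact K -> open U -> K `<=` U ->
  \forall x \near (0 : B), forall k, K k -> U (k + x).
Proof.
move=> /compact_near_coveringP cK oU KU.
apply: (cK B (nbhs 0) (fun x k => U (k + x))) => k Kk.
have := @add_continuous B (k, 0 : B); rewrite /continuous_at /=.
rewrite addr0 => /(_ U); apply.
by apply: open_nbhs_nbhs; split=> //; exact: KU.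
Qed.

(** A compact K inside E and an open U around E differ little in measure, and
    K + x stays inside U for small x. *)
Lemma near_shift_diff (E : set (borel B)) (e : R) : measurable E ->
  (m E < +oo)%E -> 0 < e ->
  \forall x \near (0 : B), (m [set y | E (y - x)%R /\ ~ E y] < e%:E)%E.
Proof.
move=> mE Efin e0; have e20 : 0 < e / 2 by rewrite divr_gt0.
have [K [cK KE mK]] := haar_inner hB hm mE Efin e20.
have [U [oU EU mU]] := haar_outer hm mE e20.
have mKb := compact_borel hB cK; have mUb := open_borel oU.
have mUE : (m (U `\` E) <= (e / 2)%:E)%E.
  have Efn : m E \is a fin_num by rewrite ge0_fin_numE.
  rewrite measureD// ?setIidr// ?leeBlDl//.
  by rewrite (le_lt_trans mU)// lte_add_pinfty// ltry.
apply: filterS (near_compact_shift cK oU (subset_trans KE EU)) => x KxU.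
apply: (@le_lt_trans _ _ (m ([set y | (E `\` K) (y - x)%R] `|` (U `\` E)))).
  apply: le_measure; rewrite ?inE.
  - rewrite (_ : [set _ | _] = [set y | E (y - x)] `\` E)//.
    by apply: measurableD => //; exact: measurable_shiftN.
  - apply: measurableU; last exact: measurableD.
    by apply: measurable_shiftN; exact: measurableD.
  - move=> y /= [Eyx nEy]; have [Kyx|nKyx] := pselect (K (y - x)); last by left.
    by right; split=> //; rewrite -[y](subrK x); exact: KxU.
apply: (le_lt_trans (measureU2 _ _ _)) => //.
- by apply: measurable_shiftN; exact: measurableD.
- exact: measurableD.
rewrite [X in (X + _)%E](_ : _ = m (E `\` K)); last first.
  exact: (haar_shiftN x (measurableD mE mKb)).
have -> : e%:E = ((e / 2)%:E + (e / 2)%:E)%E by rewrite -EFinD -splitr.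
by apply: (le_lt_trans (leeD (lexx _) mUE)); rewrite lteD2rE.
Qed.

Lemma measurable_fun_shiftN (x : B) (p : borel B -> R) : measurable_fun setT p ->
  measurable_fun [set: borel B] (fun y : B => p (y - x)).
Proof.
move=> mp; rewrite (_ : (fun _ => _) = p \o ((fun y : B => - x + y) : borel B -> borel B)).
  by apply: measurableT_comp => //; apply: continuous_borel_borel; exact: shift_continuous.
by apply/funext => y /=; rewrite addrC.
Qed.

Lemma ge0_integral_shiftN (x : B) (p : borel B -> R) : measurable_fun setT p ->
  (forall y, 0 <= p y) -> (\int[m]_y (p (y - x)%R)%:E = \int[m]_y (p y)%:E)%E.
Proof.
move=> mp p0; rewrite -(ge0_integral_shift hm (- x) (f := fun y => (p y)%:E))//.
  by apply: eq_integral => y _; rewrite [in RHS]addrC.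
exact/measurable_EFinP.
Qed.

Definition shift_dist (p : B -> R) (x : B) : \bar R :=
  (\int[m]_y (`| p (y - x)%R - p y |)%:E)%E.

Lemma measurable_shift_dist (p : borel B -> R) x : measurable_fun setT p ->
  measurable_fun [set: borel B] (fun y : B => `| p (y - x) - p y |).
Proof.
move=> mp; apply: measurableT_comp => //.
by apply: measurable_funB => //; exact: measurable_fun_shiftN.
Qed.

Lemma shift_dist_indic (E : set (borel B)) (e : R) : measurable E ->
  (m E < +oo)%E -> 0 < e -> \forall x \near (0 : B), (shift_dist \1_E x < e%:E)%E.
Proof.
move=> mE Efin e0; have e20 : 0 < e / 2 by rewrite divr_gt0.
have n1 := near_shift_diff mE Efin e20; have n2 := near0_opp n1.
apply: filterS2 n1 n2 => x h1 h2.
have mEx := measurable_shiftN x mE.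
have mD1 : measurable ([set y | E (y - x) /\ ~ E y] : set (borel B)).
  by apply: measurableD.
have mD2 : measurable ([set y | E y /\ ~ E (y - x)] : set (borel B)).
  by apply: measurableD.
have -> : shift_dist \1_E x = (\int[m]_y ((\1_[set y | E (y - x) /\ ~ E y] y)%:E
    + (\1_[set y | E y /\ ~ E (y - x)] y)%:E))%E.
  apply: eq_integral => y _; rewrite -EFinD; congr EFin; rewrite !indicE.
  have [Ex|nEx] := pselect (E (y - x)); have [Ey|nEy] := pselect (E y);
   rewrite ?(mem_set Ex) ?(mem_set Ey) ?(memNset nEx) ?(memNset nEy);
   do ?[rewrite (memNset (A := [set y | E (y - x) /\ ~ E y])); last by case]
    ; do ?[rewrite (memNset (A := [set y | E y /\ ~ E (y - x)])); last by case]
    ; do ?[rewrite (mem_set (A := [set y | E (y - x) /\ ~ E y])); last by split]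
    ; do ?[rewrite (mem_set (A := [set y | E y /\ ~ E (y - x)])); last by split];
   rewrite ?subrr ?subr0 ?sub0r ?normrN ?normr1 ?normr0 ?addr0 ?add0r//.
rewrite ge0_integralD//=; do ?[by move=> y _; rewrite lee_fin];
  do ?[by apply/measurable_EFinP; exact: measurable_indic].
rewrite !integral_indic// !setIT.
have -> : m [set y | E y /\ ~ E (y - x)%R] = m [set y | E (y - - x)%R /\ ~ E y].
  rewrite -(haar_shiftN (- x) mD2); congr (m _).
  by apply/seteqP; split => y /=; rewrite opprK addrK.
have -> : e%:E = ((e / 2)%:E + (e / 2)%:E)%E by rewrite -EFinD -splitr.
exact: lteD.
Qed.

Lemma shift_dist_add (p q : borel B -> R) x : measurable_fun setT p ->
  measurable_fun setT q ->
  (shift_dist (fun y => p y + q y)%R x <= shift_dist p x + shift_dist q x)%E.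
Proof.
move=> mp mq; rewrite -ge0_integralD//=; first last.
- by apply/measurable_EFinP; exact: measurable_shift_dist.
- by apply/measurable_EFinP; exact: measurable_shift_dist.
apply: ge0_le_integral => //=.
- apply/measurable_EFinP; apply: (@measurable_shift_dist (fun y => p y + q y)).
  exact: measurable_funD.
- by apply: emeasurable_funD; apply/measurable_EFinP; exact: measurable_shift_dist.
- move=> y _; rewrite -EFinD lee_fin.
  by rewrite (le_trans _ (ler_normD _ _))// opprD addrACA.
Qed.

Lemma shift_dist_scale (c : R) (p : borel B -> R) x : 0 <= c ->
  measurable_fun setT p ->
  shift_dist (fun y => c * p y)%R x = (c%:E * shift_dist p x)%E.
Proof.
move=> c0 mp; rewrite -ge0_integralZl//=; last first.
  by apply/measurable_EFinP; exact: measurable_shift_dist.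
apply: eq_integral => y _; rewrite -mulrBr normrM (ger0_norm c0) EFinM//.
Qed.

(** The partial sums of the harmonic expansion of p reduce this to indicators
    of sets of finite measure; the remainder has small integral, and so do
    its translates. *)
Lemma near_shift_dist (p : borel B -> R) (e : R) : measurable_fun setT p ->
  (forall y, 0 <= p y) -> (\int[m]_y (p y)%:E < +oo)%E -> 0 < e ->
  \forall x \near (0 : B), (shift_dist p x < e%:E)%E.
Proof.
move=> mp p0 pfin e0; pose P := EFin \o p.
have mP : measurable_fun setT P by exact/measurable_EFinP.
have P0 y : (0 <= P y)%E by rewrite lee_fin.
pose S n := harmonic_greedy P n; pose E k := harmonic_level P k.
have mS n : measurable_fun setT (S n) by exact: measurable_harmonic_greedy.
have S0 n y : 0 <= S n y by have := harmonic_greedy_homo P y (leq0n n).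
have Sp n y : S n y <= p y by rewrite -lee_fin; exact: harmonic_greedy_le.
have mE k : measurable (E k) by exact: measurable_harmonic_level.
have Efin k : (m (E k) < +oo)%E.
  have k0 : 0 < k.+1%:R^-1 :> R by rewrite invr_gt0 ltr0n.
  have k20 : 0 < k.+1%:R^-1 / 2 :> R by rewrite divr_gt0.
  apply: (@le_lt_trans _ _ (m [set y | k.+1%:R^-1 / 2 < p y]%R)).
    apply: le_measure; rewrite ?inE//.
      rewrite -[X in measurable X]setTI (_ : [set _ | _] = p @^-1` `]k.+1%:R^-1 / 2, +oo[).
        exact: mp.
      by apply/seteqP; split => y; rewrite /= in_itv/= andbT.
    move=> y; rewrite /E /harmonic_level /= lee_fin -/(S k) => h.
    rewrite (lt_le_trans _ h)// (@lt_le_trans _ _ k.+1%:R^-1)//.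
      by rewrite ltr_pdivrMr// ltr_pMr// ltr1n.
    by rewrite lerDr.
  have := ge0_markov m mp p0 (ltW k20).
  move=> /le_lt_trans/(_ pfin); rewrite !ltey; apply: contraNneq => ->.
  by rewrite gt0_muley// lte_fin.
have nS n : forall d : R, 0 < d -> \forall x \near (0 : B), (shift_dist (S n) x < d%:E)%E.
  elim: n => [|n ih] d d0.
    apply: nearW => x; rewrite /shift_dist.
    by under eq_integral do rewrite /S/= subrr normr0; rewrite integral0 lte_fin.
  have d20 : 0 < d / 2 by rewrite divr_gt0.
  have nE := shift_dist_indic (mE n) (Efin n) (mulr_gt0 d20 (ltr0Sn R n)).
  apply: filterS2 (ih _ d20) nE => x h1 h2.
  rewrite (_ : S n.+1 = (fun y => S n y + n.+1%:R^-1 * \1_(E n) y)); last first.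
    apply/funext => y; rewrite /S !harmonic_greedy_sum.
    by rewrite big_nat_recr.
  have me : measurable_fun [set: borel B] (\1_(E n) : borel B -> R) by exact: measurable_indic.
  apply: (le_lt_trans (shift_dist_add _ _ _)) => //.
    exact: measurable_funM.
  have -> : d%:E = ((d / 2)%:E + (d / 2)%:E)%E by rewrite -EFinD -splitr.
  apply: lteD => //; rewrite shift_dist_scale//.
  by rewrite -lte_pdivlMl ?invr_gt0 ?ltr0n// invrK -EFinM mulrC.
have e40 : 0 < e / 4 by rewrite divr_gt0.
set I := (\int[m]_y (p y)%:E)%E in pfin.
have Ifn : I \is a fin_num.
  by rewrite ge0_fin_numE//; apply: integral_ge0 => y _; rewrite lee_fin.
have cv : (\int[m]_y (S n y)%:E @[n --> \oo] --> I)%E.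
  rewrite /I (_ : (fun y => (p y)%:E) = (fun y => limn (fun n => (S n y)%:E))); last first.
    by apply/funext => y; apply/esym/cvg_lim => //; exact: harmonic_greedy_cvg.
  apply: cvg_monotone_convergence => //.
  - by move=> n; exact/measurable_EFinP.
  - by move=> n y _; rewrite lee_fin.
  - by move=> y _ k l kl; rewrite lee_fin; exact: harmonic_greedy_homo.
have [n In] : exists n, (I - (e / 4)%:E < \int[m]_y (S n y)%:E)%E.
  apply: contrapT => /forallNP h.
  have /cvge_to_le := cv => /(_ (I - (e / 4)%:E)%E).
  have /[swap]/[apply] : \forall n \near \oo,
      (\int[m]_y (S n y)%:E <= I - (e / 4)%:E)%E.
    by apply: nearW => n; rewrite leNgt; apply/negP/h.
  by rewrite leNgt lteBlDr// lteDl// lte_fin e40.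
have mr : measurable_fun [set: borel B] (fun y => p y - S n y) by exact: measurable_funB.
have r0 y : 0 <= p y - S n y by rewrite subr_ge0.
have Ir : (\int[m]_y (p y - S n y)%:E < (e / 4)%:E)%E.
  have : (I = \int[m]_y (p y - S n y)%:E + \int[m]_y (S n y)%:E)%E.
    rewrite -ge0_integralD//=.
    - by apply: eq_integral => y _; rewrite -EFinD subrK.
    - by move=> y _; rewrite lee_fin.
    - exact/measurable_EFinP.
    - by move=> y _; rewrite lee_fin.
    - exact/measurable_EFinP.
  move=> IE; rewrite IE in In Ifn.
  move: Ifn In; rewrite fin_numD => /andP[].
  move: (\int[m]_y (p y - S n y)%:E)%E (\int[m]_y (S n y)%:E)%E.
  by move=> [a||] [b||]//= _ _; rewrite !lte_fin; lra.
apply: filterS (nS n _ (divr_gt0 e0 (ltr0Sn R 1))) => x hx.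
rewrite (_ : p = (fun y => S n y + (p y - S n y))); last first.
  by apply/funext => y; rewrite addrC subrK.
apply: (le_lt_trans (shift_dist_add _ _ _)) => //.
have -> : e%:E = ((e / 2)%:E + (e / 2)%:E)%E by rewrite -EFinD -splitr.
apply: lteD => //.
apply: (@le_lt_trans _ _ (\int[m]_y ((p (y - x)%R - S n (y - x)%R)%:E + (p y - S n y)%:E))%E).
  apply: ge0_le_integral => //=.
  - by apply/measurable_EFinP; exact: (@measurable_shift_dist (fun y => p y - S n y)).
  - apply: emeasurable_funD; last exact/measurable_EFinP.
    by apply/measurable_EFinP; exact: (@measurable_fun_shiftN x (fun y => p y - S n y)).
  - move=> y _; rewrite -EFinD lee_fin (le_trans (ler_normB _ _))//.
    by rewrite !ger0_norm.
rewrite ge0_integralD//=; first last.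
- exact/measurable_EFinP.
- by move=> y _; rewrite lee_fin.
- by apply/measurable_EFinP; exact: (@measurable_fun_shiftN x (fun y => p y - S n y)).
- by move=> y _; rewrite lee_fin.
rewrite (ge0_integral_shiftN x mr r0).
have -> : (e / 2)%:E = ((e / 4)%:E + (e / 4)%:E)%E.
  by rewrite -EFinD; congr EFin; lra.
exact: lteD.
Qed.
End translation_continuity.

(** * Time-frequency shifts *)

Section time_frequency_shifts.
Variables (R : realType) (A : topologicalZmodType).
Variable mu : {measure set (borel A) -> \bar R}.
Hypothesis hA : hausdorff_space A.
Hypothesis hmu : haar_measure mu.
Implicit Types (f g : A -> R[i]) (z w : A * dual R A).

(** For s, t >= 0 one has (s - t)^2 <= |s^2 - t^2|; a real number is the
    difference of its positive and negative parts. *)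
Lemma sqr_sub_le_pos (a b : R) : (a - b) ^+ 2 <=
  2 * (`|Num.max a 0 ^+ 2 - Num.max b 0 ^+ 2| +
       `|Num.max (- a) 0 ^+ 2 - Num.max (- b) 0 ^+ 2|).
Proof.
have h (s t : R) : 0 <= s -> 0 <= t -> (s - t) ^+ 2 <= `|s ^+ 2 - t ^+ 2|.
  move=> s0 t0; rewrite subr_sqr normrM -(real_normK (num_real (s - t))) expr2 ler_wpM2l//.
  by rewrite (le_trans (ler_normB _ _))// (ger0_norm s0) (ger0_norm t0) ler_norm.
have m0 (s : R) : 0 <= Num.max s 0 by rewrite le_max lexx orbT.
have := h _ _ (m0 a) (m0 b); have := h _ _ (m0 (- a)) (m0 (- b)).
have E (s : R) : s = Num.max s 0 - Num.max (- s) 0.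
  have [s0|] := boolP (0 <= s); last rewrite -ltNge => /ltW s0.
    by rewrite (max_l s0) max_r ?oppr_le0// subr0.
  by rewrite (max_r s0) max_l ?oppr_ge0// sub0r opprK.
rewrite {5}(E a) {5}(E b).
set u := Num.max a 0; set u' := Num.max (- a) 0.
set v := Num.max b 0; set v' := Num.max (- b) 0.
have := sqr_ge0 ((u - v) + (u' - v')); rewrite !expr2; nra.
Qed.

Lemma tf_shiftE z f y : tf_shift z f y = z.2 y * f (y - z.1).
Proof. by []. Qed.

Lemma normc_char (xi : dual R A) y : normc (xi y) = 1.
Proof. exact/normr1_normc/char_norm1. Qed.

Lemma cmeasurable_char (xi : dual R A) : cmeasurable xi.
Proof. by apply: cmeasurable_continuous; exact: char_continuous. Qed.

Lemma cmeasurable_translation (x : A) f : cmeasurable f -> cmeasurable (translation x f).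
Proof.
move=> mf; apply: (cmeasurable_comp (g := fun y : A => y - x)) => //.
rewrite (_ : (fun y => y - x) = (fun y => - x + y)); first exact: shift_continuous.
by apply/funext => z; rewrite addrC.
Qed.

Lemma sqint_translation (x : A) f : cmeasurable f ->
  sqint mu (translation x f) = sqint mu f.
Proof.
move=> mf; rewrite /sqint /translation.
rewrite (@ge0_integral_shiftN _ _ _ hmu x (fun y => normc (f y) ^+ 2))//.
  exact: measurable_sqr_normc.
by move=> y; exact: sqr_ge0.
Qed.

Lemma L2_translation (x : A) f : L2 mu f -> L2 mu (translation x f).
Proof.
move=> /L2P[mf ff]; apply/L2P; split; first exact: cmeasurable_translation.
by rewrite sqint_translation.
Qed.

Lemma L2_modulation (xi : dual R A) f : L2 mu f -> L2 mu (fun y => xi y * f y).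
Proof.
apply: (L2_mul_bounded (c := 1)); first exact: cmeasurable_char.
by move=> y; rewrite normc_char.
Qed.

Lemma L2_tf_shift z f : L2 mu f -> L2 mu (tf_shift z f).
Proof. by move=> f2; apply: L2_modulation; exact: L2_translation. Qed.

Lemma sqint_tf_shift z f : cmeasurable f -> sqint mu (tf_shift z f) = sqint mu f.
Proof.
move=> mf; rewrite -(sqint_translation z.1 mf).
by apply: sqint_unimodular => y; exact: normc_char.
Qed.

Lemma sqnorm_tf_shift z f : cmeasurable f -> sqnorm mu (tf_shift z f) = sqnorm mu f.
Proof. by move=> mf; rewrite /sqnorm sqint_tf_shift. Qed.

Lemma char0 (xi : dual R A) : xi 0 = 1.
Proof.
have := char_add xi 0 0; rewrite addr0 => /eqP.
by rewrite -{1}[xi 0]mulr1 (inj_eq (mulfI (char_neq0 _ _))) => /eqP.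
Qed.

Lemma charN (xi : dual R A) y : xi (- y) = (xi y)^*.
Proof.
rewrite -unit_conjV ?char_norm1//; apply: (mulfI (char_neq0 xi y)).
by rewrite -char_add subrr char0 mulfV// char_neq0.
Qed.

Lemma char_mulJ (xi : dual R A) y : xi y * (xi y)^* = 1.
Proof. by have <- := charN xi y; rewrite -char_add subrr char0. Qed.

Lemma dualDE (xi eta : dual R A) y : (xi + eta) y = xi y * eta y. Proof. by []. Qed.
Lemma dual0E y : (0 : dual R A) y = 1. Proof. by []. Qed.
Lemma dualNE (xi : dual R A) y : (- xi) y = (xi y)^*.
Proof. by rewrite /= unit_conjV// char_norm1. Qed.

(** Commutation relation: pi z (pi w f) and pi (z + w) f differ by a phase
    that depends on z and w only. All the algebra of the support of V_f f
    comes from it. *)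
Lemma tf_shift_comp z w f y :
  tf_shift z (tf_shift w f) y = (w.2 z.1)^* * tf_shift (z + w) f y.
Proof.
rewrite !tf_shiftE dualDE char_add charN /= opprD addrA.
by rewrite !mulrA [_ * (w.2 z.1)^*]mulrC !mulrA.
Qed.

Lemma tf_shift0 f y : tf_shift 0 f y = f y.
Proof. by rewrite tf_shiftE dual0E mul1r subr0. Qed.

Lemma cintegral_shiftN (x : A) (f : A -> R[i]) : cmeasurable f ->
  cintegral mu (fun y => f (y - x)) = cintegral mu f.
Proof.
move=> [f1 f2]; rewrite /cintegral /Rintegral.
have key (p : borel A -> R) : measurable_fun setT p ->
    (\int[mu]_y (p (y - x)%R)%:E = \int[mu]_y (p y)%:E)%E.
  move=> mp; rewrite [LHS]integralE [RHS]integralE.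
  have mpE : measurable_fun setT (EFin \o p) by exact/measurable_EFinP.
  congr (_ - _)%E.
    rewrite -(ge0_integral_shift hmu (- x) (measurable_funepos mpE))//.
    by apply: eq_integral => y _; rewrite !funeposE /= addrC.
  rewrite -(ge0_integral_shift hmu (- x) (measurable_funeneg mpE))//.
  by apply: eq_integral => y _; rewrite !funenegE /= addrC.
by congr (fine _ +i* fine _);
  [exact: (key (fun y => complex.Re (f y)))|exact: (key (fun y => complex.Im (f y)))].
Qed.

Lemma inner_translation (x : A) f g : cmeasurable f -> cmeasurable g ->
  inner mu (translation x f) (translation x g) = inner mu f g.
Proof.
move=> mf mg; rewrite /inner -[RHS](cintegral_shiftN x)//.
by apply: cmeasurableM => //; exact: cmeasurableJ.
Qed.

Lemma inner_tf_shift z f g : cmeasurable f -> cmeasurable g ->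
  inner mu (tf_shift z f) (tf_shift z g) = inner mu f g.
Proof.
move=> mf mg; rewrite -(inner_translation z.1 mf mg).
by apply: inner_unimodular => y; exact: normc_char.
Qed.

Lemma inner_tf_shift2 z w f : L2 mu f ->
  inner mu (tf_shift z f) (tf_shift w f) =
  ((w.2 - z.2) z.1)^* * stft mu f f (w - z).
Proof.
move=> f2; have [mf _] := (L2P mu f).1 f2.
have E : tf_shift w f = (fun y => (w.2 - z.2) z.1 * tf_shift z (tf_shift (w - z) f) y).
  apply/funext => y; rewrite tf_shift_comp mulrA char_mulJ mul1r.
  by congr (tf_shift _ f y); rewrite addrC subrK.
rewrite {1}E innerZr//; do ?exact: L2_tf_shift.
  rewrite inner_tf_shift//.
  by have [] := (L2P mu _).1 (L2_tf_shift (w - z) f2).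
by apply: L2_tf_shift; exact: L2_tf_shift.
Qed.

Lemma stft_self0 f : stft mu f f 0 = (sqnorm mu f)%:C.
Proof.
by rewrite /stft -inner_self; congr inner; apply/funext => y; rewrite tf_shift0.
Qed.

Lemma normc_stft_le1 f z : L2 mu f -> sqnorm mu f = 1 -> normc (stft mu f f z) <= 1.
Proof.
move=> f2 f1; have [mf _] := (L2P mu f).1 f2.
have := cauchy_schwarz_unit f2 (L2_tf_shift z f2).
rewrite sqnorm_tf_shift// => /(_ f1); rewrite f1.
by rewrite expr_le1 ?normc_ge0.
Qed.

(** Real and imaginary parts, positive and negative parts: on nonnegative
    functions the squared L^2 distance is at most the L^1 distance of the
    squares. *)
Lemma near_translation f (e : R) : L2 mu f -> 0 < e ->
  \forall x \near (0 : A), (sqint mu (fun y => translation x f y - f y)%R < e%:E)%E.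
Proof.
move=> f2 e0; have [mf ff] := (L2P mu f).1 f2; have [mR mI] := mf.
pose q1 (y : borel A) := Num.max (complex.Re (f y)) 0 ^+ 2.
pose q2 (y : borel A) := Num.max (- complex.Re (f y)) 0 ^+ 2.
pose q3 (y : borel A) := Num.max (complex.Im (f y)) 0 ^+ 2.
pose q4 (y : borel A) := Num.max (- complex.Im (f y)) 0 ^+ 2.
have mq1 : measurable_fun setT q1.
  by apply: measurable_funX; exact: measurable_maxr.
have mq2 : measurable_fun setT q2.
  by apply: measurable_funX; apply: measurable_maxr => //; exact: measurable_funN.
have mq3 : measurable_fun setT q3.
  by apply: measurable_funX; exact: measurable_maxr.
have mq4 : measurable_fun setT q4.
  by apply: measurable_funX; apply: measurable_maxr => //; exact: measurable_funN.
have fin (q : borel A -> R) : measurable_fun setT q -> (forall y, 0 <= q y) ->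
    (forall y, q y <= normc (f y) ^+ 2) -> (\int[mu]_y (q y)%:E < +oo)%E.
  move=> mq q0 qf; apply: le_lt_trans ff; apply: ge0_le_integral => //.
  - by move=> y _; rewrite lee_fin.
  - exact/measurable_EFinP.
  - by apply/measurable_EFinP; exact: measurable_sqr_normc.
  - by move=> y _; rewrite lee_fin.
have sq_le (a : R) : Num.max a 0 ^+ 2 <= a ^+ 2.
  by rewrite /Num.max; case: ifP => // _; rewrite expr0n sqr_ge0.
have e80 : 0 < e / 8 by rewrite divr_gt0.
have n1 : \forall x \near (0 : A), (shift_dist mu q1 x < (e / 8)%:E)%E.
  apply: near_shift_dist => //; first by move=> y; exact: sqr_ge0.
  apply: fin => // y; first exact: sqr_ge0.
  by rewrite normc_sqrE (le_trans (sq_le _))// lerDl sqr_ge0.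
have n2 : \forall x \near (0 : A), (shift_dist mu q2 x < (e / 8)%:E)%E.
  apply: near_shift_dist => //; first by move=> y; exact: sqr_ge0.
  apply: fin => // y; first exact: sqr_ge0.
  by rewrite normc_sqrE (le_trans (sq_le _))// sqrrN lerDl sqr_ge0.
have n3 : \forall x \near (0 : A), (shift_dist mu q3 x < (e / 8)%:E)%E.
  apply: near_shift_dist => //; first by move=> y; exact: sqr_ge0.
  apply: fin => // y; first exact: sqr_ge0.
  by rewrite normc_sqrE (le_trans (sq_le _))// lerDr sqr_ge0.
have n4 : \forall x \near (0 : A), (shift_dist mu q4 x < (e / 8)%:E)%E.
  apply: near_shift_dist => //; first by move=> y; exact: sqr_ge0.
  apply: fin => // y; first exact: sqr_ge0.
  by rewrite normc_sqrE (le_trans (sq_le _))// sqrrN lerDr sqr_ge0.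
near=> x.
have h1 : (shift_dist mu q1 x < (e / 8)%:E)%E by near: x.
have h2 : (shift_dist mu q2 x < (e / 8)%:E)%E by near: x.
have h3 : (shift_dist mu q3 x < (e / 8)%:E)%E by near: x.
have h4 : (shift_dist mu q4 x < (e / 8)%:E)%E by near: x.
have md (q : borel A -> R) : measurable_fun setT q -> measurable_fun [set: borel A]
    (fun y : A => (`|q (y - x) - q y|)%:E).
  by move=> mq; apply/measurable_EFinP; exact: measurable_shift_dist.
apply: (@le_lt_trans _ _ (2%:E * (shift_dist mu q1 x + shift_dist mu q2 x +
    (shift_dist mu q3 x + shift_dist mu q4 x)))%E); last first.
  have -> : e%:E = (2%:E * ((e / 8)%:E + (e / 8)%:E + ((e / 8)%:E + (e / 8)%:E)))%E.
    by rewrite -!EFinD -EFinM; congr EFin; lra.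
  by rewrite lte_pmul2l// !lteD.
rewrite -!ge0_integralD//=; do ?[by apply: md|by move=> y _; rewrite ?adde_ge0
  |by apply: emeasurable_funD; apply: md].
rewrite -ge0_integralZl//=; first last.
- by move=> y _; rewrite !adde_ge0.
- by apply: emeasurable_funD; apply: emeasurable_funD; apply: md.
apply: ge0_le_integral => //=.
- by move=> y _; rewrite lee_fin sqr_ge0.
- apply/measurable_EFinP; apply: measurable_sqr_normc.
  apply: cmeasurableD; first exact: cmeasurable_translation.
  rewrite (_ : (fun _ => _) = (fun y => (-1) * f y)); last first.
    by apply/funext => y; rewrite mulN1r.
  by apply: cmeasurableM => //; exact: cmeasurable_cst.
- apply: measurable_funeM.
  by apply: emeasurable_funD; apply: emeasurable_funD; apply: md.
- move=> y _; rewrite -!EFinD -EFinM lee_fin /q1 /q2 /q3 /q4 /translation normc_sqrE.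
  rewrite mulrDr; case: (f (y - x)) => a b; case: (f y) => c d /=.
  by apply: lerD; exact: sqr_sub_le_pos.
Unshelve. all: by end_near. Qed.
End time_frequency_shifts.

(** * Continuity of the short-time Fourier transform *)

Section stft_continuity.
Variables (R : realType) (A : topologicalZmodType).
Variable mu : {measure set (borel A) -> \bar R}.
Hypothesis hA : hausdorff_space A.
Hypothesis hmu : haar_measure mu.
Implicit Types (f g : A -> R[i]) (z w : A * dual R A).

Lemma dual_hausdorff : hausdorff_space (dual R A).
Proof.
move=> chi psi h; apply: dual_ext => x; apply/eqP; rewrite -subr_eq0 -normr_eq0.
apply: contrapT => /negP; rewrite -normr_gt0 normr_id => n0.
set d := `|_| in n0; have d20 : 0 < d / 2 by rewrite divr_gt0.
have := h _ _ (dual_near chi (@compact_set1 _ x) d20) (dual_near psi (@compact_set1 _ x) d20).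
move=> [xi [/= /(_ x erefl) h1 /(_ x erefl) h2]].
have : d < d.
  rewrite {1}/d (_ : chi x - psi x = (chi x - xi x) - (psi x - xi x)); last first.
    by rewrite opprB addrA subrK.
  by rewrite (le_lt_trans (ler_normB _ _))// [d]splitr ltrD.
by rewrite ltxx.
Qed.

(** A compact set carries most of the mass of f, and in the compact-open
    topology xi is uniformly close to xi0 there; elsewhere |xi - xi0| <= 2. *)
Lemma near_modulation f (xi0 : dual R A) (e : R) : L2 mu f -> 0 < e ->
  \forall xi \near xi0, (sqint mu (fun y => ((xi : dual R A) y - xi0 y) * f y)%R < e%:E)%E.
Proof.
move=> f2 e0; have [mf ff] := (L2P mu f).1 f2.
have m2 := measurable_sqr_normc mf.
have [K [cK hK]] := haar_tight hA hmu m2 (fun y => sqr_ge0 _) ff (divr_gt0 e0 (ltr0Sn R 7)).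
pose s := sqnorm mu f; have s0 : 0 <= s by exact: sqnorm_ge0.
pose d := Num.min 1 (e / (2 * (s + 1))).
have d0 : 0 < d.
  by rewrite lt_min ltr01 divr_gt0// mulr_gt0// ltr_wpDl.
have d0C : 0 < d%:C by rewrite ltcR.
apply: filterS (dual_near xi0 cK d0C) => xi /= hxi.
have mKc : measurable (~` K : set (borel A)).
  by apply: measurableC; exact: compact_borel.
pose g (y : borel A) : R := d * normc (f y) ^+ 2 + 4 * (normc (f y) ^+ 2 * \1_(~` K) y).
have mg2 : measurable_fun [set: borel A] (fun y => normc (f y) ^+ 2 * \1_(~` K) y).
  by apply: measurable_funM => //; exact: measurable_indic.
apply: (@le_lt_trans _ _ (\int[mu]_y (d%:E * (normc (f y) ^+ 2)%:E +
    4%:E * (normc (f y) ^+ 2 * \1_(~` K) y)%:E))%E).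
  apply: ge0_le_integral => //=.
  - by move=> y _; rewrite lee_fin sqr_ge0.
  - apply/measurable_EFinP; apply: measurable_sqr_normc.
    apply: cmeasurableM => //; apply: cmeasurableD; first exact: cmeasurable_char.
    rewrite (_ : (fun _ => _) = (fun y => (-1) * xi0 y)); last first.
      by apply/funext => y; rewrite mulN1r.
    by apply: cmeasurableM; [exact: cmeasurable_cst|exact: cmeasurable_char].
  - apply: emeasurable_funD; apply: measurable_funeM; apply/measurable_EFinP => //.
  - move=> y _; rewrite -!EFinM -EFinD lee_fin normcM exprMn indicE.
    have f0 := sqr_ge0 (normc (f y)).
    have [Ky|nKy] := pselect (K y).
      rewrite memNset; last by apply.
      rewrite mulr0 mulr0 addr0 ler_wpM2r//.
      have hd : normc (xi y - xi0 y) <= d.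
        have := hxi _ Ky; rewrite -normrN opprB normcrE ltcR; exact: ltW.
      have n0 := normc_ge0 (xi y - xi0 y).
      have d1 : d <= 1 by rewrite ge_min lexx.
      by rewrite expr2; nra.
    rewrite mem_set// mulr1; apply: ler_wpDl; first by rewrite mulr_ge0// ltW.
    rewrite ler_wpM2r//.
    have := le_normcD (xi y) (- xi0 y); rewrite normcN !normc_char => h.
    have n0 := normc_ge0 (xi y - xi0 y).
    by rewrite expr2; nra.
rewrite ge0_integralD//=; first last.
- by apply: measurable_funeM; apply/measurable_EFinP.
- by move=> y _; apply: mule_ge0; rewrite lee_fin// mulr_ge0// sqr_ge0.
- by apply: measurable_funeM; apply/measurable_EFinP.
- by move=> y _; apply: mule_ge0; rewrite lee_fin ?sqr_ge0// ltW.
rewrite !ge0_integralZl//=; do ?[exact/measurable_EFinP | by rewrite lee_fin// ltW].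
- rewrite -/(sqint mu f) (sqint_fin f2) -/s -EFinM.
  have -> : (\int[mu]_y (normc (f y) ^+ 2 * \1_(~` K) y)%:E =
     \int[mu]_(y in ~` K) (normc (f y) ^+ 2)%:E)%E.
    rewrite [RHS]integral_mkcond; apply: eq_integral => y _; rewrite patchE indicE.
    by case: ifP => _; rewrite ?mulr1 ?mulr0.
  have ds : d * s < e / 2.
    have : d <= e / (2 * (s + 1)) by rewrite ge_min lexx orbT.
    move=> /(ler_wpM2r s0)/le_lt_trans; apply.
    have s1 : 0 < 2 * (s + 1) by rewrite mulr_gt0// ltr_wpDl.
    by rewrite mulrAC ltr_pdivrMr//; nra.
  have -> : e%:E = ((e / 2)%:E + (4%:E * (e / 8)%:E))%E.
    by rewrite -EFinM -EFinD; congr EFin; lra.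
  apply: lteD; first by rewrite lte_fin.
  by rewrite lte_pmul2l.
- by move=> y _; rewrite lee_fin mulr_ge0// sqr_ge0.
- by move=> y _; rewrite lee_fin sqr_ge0.
Qed.

Lemma sqint_addr_le f g (a b : R) : L2 mu f -> L2 mu g ->
  (sqint mu f < a%:E)%E -> (sqint mu g < b%:E)%E ->
  sqnorm mu (fun y => f y + g y) < 2 * (a + b).
Proof.
move=> f2 g2; rewrite !sqint_fin// !lte_fin => fa gb.
have g2' := L2Z (-1) g2.
have := sqnorm_ge0 mu (fun y => f y + (-1) * g y).
rewrite !sqnormD// innerZr// sqnormZ// normcN normcr1 expr1n mul1r.
rewrite rmorphN1 mulN1r; case: (inner mu f g) => c d /=; lra.
Qed.

(** pi z f - pi w f = xi (T_x - T_x0) f + (xi - xi0) T_x0 f for z = (x, xi)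
    and w = (x0, xi0). *)
Lemma near_tf_shift f w (e : R) : L2 mu f -> 0 < e ->
  \forall z \near w, sqnorm mu (fun y => tf_shift z f y + (-1) * tf_shift w f y) < e.
Proof.
case: w => x0 xi0 f2 e0; have [mf _] := (L2P mu f).1 f2.
have e40 : 0 < e / 4 by rewrite divr_gt0.
have n1 : \forall x \near x0,
    (sqint mu (fun y => translation (x - x0) f y - f y)%R < (e / 4)%:E)%E.
  by have := near_translation hA hmu f2 e40 => /(@nbhs_shift A x0).
have n2 := near_modulation xi0 (L2_translation hmu x0 f2) e40.
near=> z.
have h1 : (sqint mu (fun y => translation (z.1 - x0) f y - f y)%R < (e / 4)%:E)%E.
  by near: z; exact: (cvg_fst n1).
have h2 : (sqint mu (fun y => (z.2 y - xi0 y) * translation x0 f y)%R < (e / 4)%:E)%E.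
  by near: z; exact: (cvg_snd n2).
pose F1 y := z.2 y * translation x0 (fun y => translation (z.1 - x0) f y - f y) y.
pose F2 y := (z.2 y - xi0 y) * translation x0 f y.
have -> : (fun y => tf_shift z f y + (-1) * tf_shift (x0, xi0) f y) = (fun y => F1 y + F2 y).
  apply/funext => y; rewrite /F1 /F2 /translation !tf_shiftE /=.
  have -> : y - x0 - (z.1 - x0) = y - z.1 by rewrite opprB addrA subrK.
  ring.
have D2 : L2 mu (fun y => translation (z.1 - x0) f y - f y).
  rewrite (_ : (fun _ => _) = (fun y => translation (z.1 - x0) f y + (-1) * f y)).
    by apply: L2D; [exact: L2_translation|exact: L2Z].
  by apply/funext => y; rewrite mulN1r.
have [mD _] := (L2P mu _).1 D2.
have F12 : L2 mu F1 by apply: L2_modulation; exact: L2_translation.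
have F22 : L2 mu F2.
  rewrite (_ : F2 = (fun y => z.2 y * translation x0 f y +
      (-1) * (xi0 y * translation x0 f y))).
    by apply: L2D; [|apply: L2Z]; apply: L2_modulation; exact: L2_translation.
  by apply/funext => y; rewrite /F2 mulN1r mulrBl.
have -> : e = 2 * (e / 4 + e / 4) by lra.
apply: sqint_addr_le => //.
rewrite sqint_unimodular; last by move=> y; exact: normc_char.
by rewrite sqint_translation.
Unshelve. all: by end_near. Qed.

Lemma stft_continuous f : L2 mu f -> sqnorm mu f = 1 ->
  continuous (stft mu f f : (A * dual R A)%type -> R[i]^o).
Proof.
move=> f2 f1 w; apply: continuous_normcP => e e0.
have e20 : 0 < e ^+ 2 by rewrite exprn_gt0.
apply: filterS (near_tf_shift w f2 e20) => z hz.
have z2 := L2_tf_shift hmu z f2; have w2 := L2_tf_shift hmu w f2.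
have D2 : L2 mu (fun y => tf_shift z f y + (-1) * tf_shift w f y).
  by apply: L2D => //; exact: L2Z.
have E : stft mu f f z - stft mu f f w =
    inner mu f (fun y => tf_shift z f y + (-1) * tf_shift w f y).
  by rewrite innerDr//; [rewrite innerZr// rmorphN1 mulN1r|exact: L2Z].
have := cauchy_schwarz_unit D2 f2 f1.
rewrite innerJ// -E => h.
have {}h : normc (stft mu f f w - stft mu f f z) ^+ 2 < e ^+ 2.
  apply: le_lt_trans hz; apply: le_trans h.
  by rewrite normc_conj -normcN opprB.
by move: h; rewrite ltr_pXn2r// nnegrE ?normc_ge0// ltW.
Qed.

Lemma open_stft_support f : L2 mu f -> sqnorm mu f = 1 ->
  open (stft_support mu f).
Proof.
move=> f2 f1; rewrite /stft_support openE => z /= Vz.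
have n0 : 0 < normc (stft mu f f z).
  by rewrite lt0r normc_ge0 normc_eq0 Vz.
have := near_normc n0 (@stft_continuous f f2 f1 z).
apply: filterS => w; apply: contraTneq => ->.
by rewrite subr0 ltxx.
Qed.
End stft_continuity.

(** * Tonelli for open sets *)

Section levels.
Variable R : realType.
Implicit Types (c r : R) (g : \bar R) (M : nat).

(** Staircase approximation of g from below, with M steps of height c. The
    strict inequality makes the level sets of a lower semicontinuous function
    open. *)
Definition level_sum c M g : R :=
  \sum_(k < M) c * ((k.+1%:R * c)%:E < g)%E%:R.

Lemma level_sumS c M g : level_sum c M.+1 g =
  level_sum c M g + c * ((M.+1%:R * c)%:E < g)%E%:R.
Proof. by rewrite /level_sum big_ord_recr. Qed.

Lemma level_sum_ge0 c M g : 0 <= c -> 0 <= level_sum c M g.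
Proof. by move=> c0; apply: sumr_ge0 => k _; rewrite mulr_ge0. Qed.

Lemma level_sum_le c M g : 0 <= c -> level_sum c M g <= M%:R * c.
Proof.
move=> c0; elim: M => [|M ih]; first by rewrite /level_sum big_ord0 mul0r.
rewrite level_sumS -natr1 mulrDl mul1r lerD//.
by case: (_ < _)%E; rewrite ?mulr1 ?mulr0.
Qed.

Lemma level_sum_lt c M g : 0 <= c -> (0 < g)%E -> ((level_sum c M g)%:E < g)%E.
Proof.
move=> c0 g0; elim: M => [|M ih]; first by rewrite /level_sum big_ord0.
rewrite level_sumS; have [h|h] := boolP ((M.+1%:R * c)%:E < g)%E; last by rewrite mulr0 addr0.
apply: le_lt_trans h; rewrite lee_fin mulr1 -natr1 mulrDl mul1r lerD2r.
exact: level_sum_le.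
Qed.

Lemma level_sum_ge c M r : 0 <= c ->
  Num.min (r - c) (M%:R * c) <= level_sum c M r%:E.
Proof.
move=> c0; elim: M => [|M ih].
  by rewrite /level_sum big_ord0 mul0r ge_min lexx orbT.
rewrite level_sumS lte_fin -natr1 mulrDl mul1r.
have [h|h] := ltP (M%:R * c + c) r.
  by rewrite mulr1; move: ih; rewrite !ge_min => /orP[?|?]; apply/orP; [left|right]; lra.
by rewrite mulr0 addr0; move: ih; rewrite !ge_min => /orP[?|?]; apply/orP; left; lra.
Qed.

Lemma level_sumy c M : level_sum c M +oo%E = M%:R * c.
Proof.
elim: M => [|M ih]; first by rewrite /level_sum big_ord0 mul0r.
by rewrite level_sumS ih ltry mulr1 -natr1 mulrDl mul1r.
Qed.

Lemma level_sum_cvg g : (0 <= g)%E ->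
  (level_sum n.+1%:R^-1 (n.+1 * n.+1) g)%:E @[n --> \oo] --> g.
Proof.
have Mc n : (n.+1 * n.+1)%:R * n.+1%:R^-1 = n.+1%:R :> R.
  by rewrite natrM -mulrA mulfV ?mulr1// pnatr_eq0.
case: g => [r| |//] g0; last first.
  under eq_fun do rewrite level_sumy Mc.
  apply/cvgeryP; have := @cvgr_idn R; rewrite -(cvg_shiftS) .
  done.
apply: cvg_EFin; first exact: nearW.
apply/cvgrPdist_lt => e e0; near=> n.
have c0 : 0 <= n.+1%:R^-1 :> R by rewrite invr_ge0.
have h1 := level_sum_ge (n.+1 * n.+1) r c0; rewrite Mc in h1.
have rn : r <= n.+1%:R.
  rewrite (le_trans (ltW (truncnS_gt r)))// ler_nat ltnS.
  by near: n; exact: nbhs_infty_ge.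
have en : n.+1%:R^-1 < e.
  rewrite invf_plt ?posrE// (lt_le_trans (truncnS_gt _))// ler_nat ltnS.
  by near: n; exact: nbhs_infty_ge.
have hm : r - n.+1%:R^-1 <= level_sum n.+1%:R^-1 (n.+1 * n.+1) r%:E.
  move: h1; rewrite ge_min => /orP[//|]; apply: le_trans.
  by rewrite lerBlDr (le_trans rn)// lerDl.
have hu : level_sum n.+1%:R^-1 (n.+1 * n.+1) r%:E <= r.
  move: g0; rewrite lee_fin le_eqVlt => /predU1P[r0|r0].
    rewrite -r0 /level_sum big1// => k _.
    by rewrite ltNge lee_fin mulr_ge0//= mulr0.
  by apply/ltW; rewrite -lte_fin; apply: level_sum_lt.
rewrite ger0_norm ?subr_ge0//; apply: le_lt_trans en.
by rewrite lerBlDr addrC -lerBlDr.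
Unshelve. all: by end_near. Qed.
End levels.

Section tonelli_open.
Variables (R : realType) (X Y : topologicalZmodType).
Variables (al : {measure set (borel X) -> \bar R}) (be : {measure set (borel Y) -> \bar R}).
Hypothesis hX : hausdorff_space X.
Hypothesis hY : hausdorff_space Y.
Hypothesis hal : haar_measure al.
Hypothesis hbe : haar_measure be.
Variable O : set (X * Y).
Hypothesis oO : open O.

Lemma near_section (x : X) (L : set Y) : compact L -> (forall y, L y -> O (x, y)) ->
  \forall x' \near x, forall y, L y -> O (x', y).
Proof.
move=> /compact_near_coveringP cL LO.
apply: (cL X (nbhs x) (fun x' y => O (x', y))) => y Ly.
have : nbhs (x, y) O by apply: open_nbhs_nbhs; split=> //; exact: LO.
move=> [[U V] /= [nU nV] UV]; exists (V, U) => //= -[a b] /= [Va Ub].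
exact: UV.
Qed.

Lemma open_section (x : X) : open [set y | O (x, y)].
Proof.
rewrite openE => y /= Oxy.
have : nbhs (x, y) O by exact: open_nbhs_nbhs.
move=> [[U V] /= [nU nV] UV]; apply: filterS nV => b Vb; apply: UV => /=.
by split=> //; exact: nbhs_singleton.
Qed.

Definition section_measure (x : X) : \bar R := be [set y | O (x, y)].

Lemma near_section_measure (x : X) (t : \bar R) : (t < section_measure x)%E ->
  exists L : set Y, [/\ compact L, (t < be L)%E &
    \forall x' \near x, forall y, L y -> O (x', y)].
Proof.
move=> /(haar_inner_open hbe (open_section x))[L [cL LO tL]].
by exists L; split=> //; exact: near_section.
Qed.

Lemma le_section_measure (x : X) (L : set Y) : compact L ->
  (forall y, L y -> O (x, y)) -> (be L <= section_measure x)%E.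
Proof.
move=> cL LO; apply: le_measure => //; rewrite inE.
  exact: compact_borel.
by apply: open_borel; exact: open_section.
Qed.

Lemma open_section_level (t : \bar R) : open [set x | (t < section_measure x)%E].
Proof.
rewrite openE => x /= /near_section_measure[L [cL tL nL]].
apply: filterS nL => x' LO; apply: (lt_le_trans tL).
exact: le_section_measure.
Qed.

Lemma measurable_section_measure :
  measurable_fun [set: borel X] (section_measure : borel X -> \bar R).
Proof.
apply: (measurability _ (ErealGenOInfty.measurableE R)).
move=> _ [_ [t ->] <-]; rewrite setTI preimage_itvoy.
by apply: open_borel; exact: open_section_level.
Qed.

(** La bounds the lower Darboux sums of O over rectangles whose first sides
    are disjoint. This property is shared by the measure of O for a product
    measure and by the integral of the sections taken in the other order, so
    that one inequality serves both. *)
Definition rectangle_bound (La : \bar R) := forall (n : nat) (D : nat -> set X)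
    (L : nat -> set Y),
  (forall j, measurable (D j : set (borel X))) -> (forall j, al (D j) < +oo)%E ->
  trivIset setT D -> (forall j, compact (L j)) ->
  (forall j x y, D j x -> L j y -> O (x, y)) ->
  (\sum_(j < n) al (D j) * be (L j) <= La)%E.

Variable La : \bar R.
Hypothesis hLa : rectangle_bound La.

Lemma near_indic_sum (n : nat) (K : nat -> set X) (c : R) (x : X) : 0 <= c ->
  (forall k, compact (K k)) -> \forall x' \near x,
    \sum_(k < n) c * \1_(K k) x' <= \sum_(k < n) c * \1_(K k) x.
Proof.
move=> c0 cK; elim: n => [|n ih]; first by apply: nearW => x'; rewrite !big_ord0.
have : \forall x' \near x, \1_(K n) x' <= \1_(K n) x :> R.
  have [Kx|nKx] := pselect (K n x).
    by apply: nearW => x'; rewrite !indicE (mem_set Kx); case: (_ \in _).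
  have : nbhs x (~` K n).
    by apply: open_nbhs_nbhs; split=> //; apply: closed_openC; exact: compact_closed.
  by apply: filterS => x' nKx'; rewrite !indicE (memNset nKx').
apply: filterS2 ih => x' h1 h2; rewrite !big_ord_recr/= lerD//.
by rewrite ler_wpM2l.
Qed.

(** Around a point x choose a compact L inside the section at x with measure
    above the step function at x; by the tube lemma L stays inside nearby
    sections, and the step function only decreases near x. Finitely many of
    these neighbourhoods, made disjoint, give the rectangles. *)
Lemma rectangle_bound_compact (n : nat) (K : nat -> set X) (c : R) : 0 <= c ->
  (forall k, compact (K k)) ->
  (forall x k, (k < n)%N -> K k x ->
    ((\sum_(k < n) c * \1_(K k) x)%:E < section_measure x)%E) ->
  (\sum_(k < n) c%:E * al (K k) <= La)%E.
Proof.
move=> c0 cK hK.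
pose T x := \sum_(k < n) c * \1_(K k) x.
pose U := \bigcup_(k < n) K k.
have cU : compact U by rewrite /U bigcup_mkord; apply: bigsetU_compact.
pose W (L : set Y) := [set x' | (forall y, L y -> O (x', y)) /\ ((T x')%:E < be L)%E].
have /choice[L hL] : forall x, exists L : set Y, compact L /\ (U x -> nbhs x (W L)).
  move=> x; have [[k kn Kx]|nUx] := pselect (U x); last first.
    by exists set0; split=> //; exact: compact0.
  have /near_section_measure[L [cL TL nL]] := hK x k kn Kx.
  exists L; split=> // _; apply: filterS2 nL (near_indic_sum n x c0 cK) => x' h1 h2.
  by split=> //; apply: le_lt_trans TL; rewrite lee_fin.
have cL x : compact (L x) by case: (hL x).
have nW x : U x -> nbhs x (W (L x))^°.
  by move=> Ux; apply: nbhs_interior; apply: (hL x).2.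
have [s [_ sU]] := compact_finite_subcover cU nW.
pose F j := if (j < size s)%N then U `&` (W (L (nth 0 s j)))^° else set0.
pose L' j := if (j < size s)%N then L (nth 0 s j) else set0.
have mF j : measurable (F j : set (borel X)).
  rewrite /F; case: ifP => // _; apply: measurableI; first exact: compact_borel.
  by apply: open_borel; exact: open_interior.
pose D := seqDU F.
have mD j : measurable (D j : set (borel X)).
  by apply: measurableD => //; apply: bigsetU_measurable.
have DF j : D j `<=` F j by exact: subset_seqDU.
have FU j : F j `<=` U by rewrite /F; case: ifP => // _ x [].
have FW j x : F j x -> W (L' j) x.
  by rewrite /F /L'; case: ifP => // _ [_] /interior_subset.
have cL' j : compact (L' j) by rewrite /L'; case: ifP => // _; exact: compact0.
have mU := compact_borel hX cU.
have finD j : (al (D j) < +oo)%E.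
  apply: (@le_lt_trans _ _ (al U)); last exact: haar_compact_lty.
  by apply: le_measure; rewrite ?inE//; exact: subset_trans (DF j) (FU j).
have rect j x y : D j x -> L' j y -> O (x, y) by move=> /DF/FW[+ _]; apply.
have := hLa (size s) mD finD (@trivIset_seqDU _ F) cL' rect.
apply: le_trans.
have mK k : measurable (K k : set (borel X)) by exact: compact_borel.
have mi (E : set (borel X)) : measurable E ->
    measurable_fun [set: borel X] (fun x => (\1_E x)%:E : \bar R).
  by move=> mE; apply/measurable_EFinP; exact: measurable_indic.
have -> : (\sum_(k < n) c%:E * al (K k) =
    \int[al]_x (\sum_(k < n) (c%:E * (\1_(K k) x)%:E)))%E.
  rewrite ge0_integral_sum//=.
  - apply: eq_bigr => k _; rewrite ge0_integralZl//=.
    + by rewrite integral_indic// setIT.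
    + exact: mi.
  - by move=> k; apply: measurable_funeM; exact: mi.
  - by move=> k x _; rewrite mule_ge0.
have -> : (\sum_(j < size s) al (D j) * be (L' j) =
    \int[al]_x (\sum_(j < size s) (be (L' j) * (\1_(D j) x)%:E)))%E.
  rewrite ge0_integral_sum//=.
  - apply: eq_bigr => k _; rewrite ge0_integralZl//=.
    + by rewrite integral_indic// setIT muleC.
    + exact: mi.
  - by move=> k; apply: measurable_funeM; exact: mi.
apply: ge0_le_integral => //=.
- by move=> x _; apply: sume_ge0 => k _; rewrite mule_ge0.
- by apply: emeasurable_sum => k; apply: measurable_funeM; exact: mi.
- by apply: emeasurable_sum => k; apply: measurable_funeM; exact: mi.
- move=> x _; have -> : (\sum_(k < n) c%:E * (\1_(K k) x)%:E = (T x)%:E)%E.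
    by rewrite /T -sumEFin; apply: eq_bigr => k _; rewrite EFinM.
  have [Ux|nUx] := pselect (U x); last first.
    rewrite /T big1; first by apply: sume_ge0 => k _; rewrite mule_ge0.
    move=> k _; rewrite indicE memNset ?mulr0// => Kx; apply: nUx.
    by exists k => //=.
  have [j jn Djx] : exists2 j, (j < size s)%N & D j x.
    have [z zs Wx] := sU x Ux.
    have : (\bigcup_(j < size s) F j) x.
      exists (index z s) => /=; first by rewrite index_mem.
      by rewrite /F index_mem zs nth_index.
    rewrite bigcup_mkord bigsetU_seqDU -bigcup_mkord => -[j jn Djx].
    by exists j.
  rewrite (bigD1 (Ordinal jn))//= indicE mem_set// mule1.
  apply: (@le_trans _ _ (be (L' j))).
    by have [_ /ltW] := FW j x (DF j x Djx).
  by rewrite leeDl// sume_ge0// => k _; rewrite mule_ge0.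
Qed.

(** Inner regularity of al on the open sets U k, and monotone approximation. *)
Lemma rectangle_bound_open (n : nat) (U : nat -> set X) (c : R) : 0 <= c ->
  (forall k, open (U k)) ->
  (forall x k, (k < n)%N -> U k x ->
    ((\sum_(k < n) c * \1_(U k) x)%:E < section_measure x)%E) ->
  (\sum_(k < n) c%:E * al (U k) <= La)%E.
Proof.
move=> c0 oU hU.
have [S hS] : exists S : nat -> nat -> set X, forall k,
    [/\ forall i, compact (S k i), forall i, S k i `<=` U k &
        al (S k i) @[i --> \oo] --> al (U k)].
  suff /choice[S hS] : forall k, exists S : nat -> set X,
    [/\ forall i, compact (S i), forall i, S i `<=` U k &
        al (S i) @[i --> \oo] --> al (U k)] by exists S.
  move=> k; have [_ _ _ _ /(_ _ (oU k)) Uk] := hal.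
  have ne : [set al K | K in [set K : set X | compact K /\ K `<=` U k]] != set0.
    apply/set0P; exists (al set0); exists set0 => //; split; last by [].
    exact: compact0.
  have [u uS ucv] := ereal_sup_seq ne.
  have /choice[S hS] : forall i, exists K : set X, [/\ compact K, K `<=` U k & al K = u i].
    by move=> i; have [K [cK KU] e] := uS i; exists K.
  exists S; split; [by move=> i; case: (hS i)|by move=> i; case: (hS i)|].
  by rewrite Uk; under eq_fun => i do (have [_ _ ->] := hS i).
have cv : (\sum_(k < n) c%:E * al (S k i) @[i --> \oo] -->
    \sum_(k < n) c%:E * al (U k))%E.
  apply: (@cvg_nnesum _ _ _ _ _ _ (fun (k : 'I_n) i => c%:E * al (S k i))%E).
    by move=> k _; apply: nearW => i; rewrite mule_ge0.
  by move=> k _; apply: cvgeZl => //; case: (hS k).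
apply: (cvge_to_le cv).
apply: nearW => i; apply: (rectangle_bound_compact (K := fun k => S k i)) => //.
  by move=> k; case: (hS k) => cS _ _; exact: cS.
move=> x k kn Skx.
have Ukx : U k x by have [_ SU _] := hS k; exact: SU Skx.
apply: le_lt_trans (hU x k kn Ukx); rewrite lee_fin; apply: ler_sum => j _.
rewrite ler_wpM2l// !indicE; have [|//] := boolP (x \in S j i).
rewrite inE => Sx; rewrite mem_set//; have [_ SU _] := hS j; exact: SU Sx.
Qed.

(** The staircases of the lower semicontinuous function section_measure are
    sums of indicators of open sets and converge to it; Fatou's lemma
    concludes. *)
Lemma integral_section_le : (\int[al]_x section_measure x <= La)%E.
Proof.
pose h n (x : X) := (level_sum n.+1%:R^-1 (n.+1 * n.+1) (section_measure x))%:E.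
have g0 x : (0 <= section_measure x)%E by exact: measure_ge0.
have c0 n : 0 <= n.+1%:R^-1 :> R by rewrite invr_ge0.
pose U n k := [set x | ((k.+1%:R * n.+1%:R^-1)%:E < section_measure x)%E].
have oU n k : open (U n k) by exact: open_section_level.
have hE n x : h n x = (\sum_(k < n.+1 * n.+1) (n.+1%:R^-1)%:E * (\1_(U n k) x)%:E)%E.
  rewrite /h /level_sum -sumEFin; apply: eq_bigr => k _; rewrite EFinM indicE.
  congr (_ * (nat_of_bool _)%:R%:E)%E; rewrite /U.
  by apply/idP/idP => [h1|]; [rewrite mem_set|rewrite inE].
have mh n : measurable_fun [set: borel X] (h n : borel X -> \bar R).
  rewrite (_ : h n = (fun x => \sum_(k < n.+1 * n.+1) (n.+1%:R^-1)%:E * (\1_(U n k) x)%:E)%E).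
    apply: emeasurable_sum => k; apply: measurable_funeM.
    by apply/measurable_EFinP; apply: measurable_indic; exact: open_borel.
  by apply/funext => x; rewrite hE.
have h0 n x : (0 <= h n x)%E by rewrite lee_fin level_sum_ge0.
have hLan n : (\int[al]_x h n x <= La)%E.
  under eq_integral do rewrite hE.
  rewrite ge0_integral_sum//=; first last.
  - by move=> k; apply: measurable_funeM; apply/measurable_EFinP;
      apply: measurable_indic; exact: open_borel.
  under eq_bigr => k _.
    rewrite ge0_integralZl//=; last first.
      by apply/measurable_EFinP; apply: measurable_indic; exact: open_borel.
    rewrite integral_indic ?setIT//; last exact: open_borel.
    over.
  apply: (@rectangle_bound_open (n.+1 * n.+1) (U n) n.+1%:R^-1) => // x k kn Ukx.
  have gx : (0 < section_measure x)%E.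
    by apply: le_lt_trans Ukx; rewrite lee_fin mulr_ge0.
  have := level_sum_lt (n.+1 * n.+1) (c0 n) gx; rewrite -/(h n x) hE.
  by rewrite -sumEFin; under eq_bigr do rewrite -EFinM.
have -> : (\int[al]_x section_measure x = \int[al]_x limn_einf (h ^~ x))%E.
  apply: eq_integral => x _; have cv := level_sum_cvg (g0 x).
  rewrite is_cvg_limn_einfE; first by apply/esym/cvg_lim.
  by apply/cvg_ex; eexists; exact: cv.
apply: le_trans (fatou _ _ _ _) _ => //.
rewrite limn_einf_lim; apply: lime_le; first exact: is_cvg_einfs.
apply: nearW => n; apply: le_trans (hLan n).
by apply: ereal_inf_lbound; exists n => //=.
Qed.
End tonelli_open.

Lemma measurable_rectangle (X Y : PreTopologicalZmodule.type) (E : set X) (F : set Y) :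
  measurable (E : set (borel X)) -> measurable (F : set (borel Y)) ->
  measurable (E `*` F : set (borel (X * Y)%type)).
Proof.
move=> mE mF.
have -> : E `*` F = (fst @^-1` E) `&` (snd @^-1` F) :> set (X * Y) by [].
apply: measurableI.
  rewrite -[X in measurable X]setTI.
  apply: (@continuous_borel_borel (X * Y)%type X fst) => //.
  by move=> z; exact: cvg_fst.
rewrite -[X in measurable X]setTI.
apply: (@continuous_borel_borel (X * Y)%type Y snd) => //.
by move=> z; exact: cvg_snd.
Qed.

Section tonelli_swap.
Variables (R : realType) (X Y : topologicalZmodType).
Variables (al : {measure set (borel X) -> \bar R}) (be : {measure set (borel Y) -> \bar R}).
Hypothesis hX : hausdorff_space X.
Hypothesis hY : hausdorff_space Y.
Hypothesis hal : haar_measure al.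
Hypothesis hbe : haar_measure be.
Variable O : set (X * Y).
Hypothesis oO : open O.

Definition swap_set : set (Y * X) := [set z | O (z.2, z.1)].

Lemma open_swap : open swap_set.
Proof.
rewrite openE => -[y x] /= Oxy.
have : nbhs (x, y) O by exact: open_nbhs_nbhs.
move=> [[U V] /= [nU nV] UV]; exists (V, U) => //= -[b a] /= [Vb Ua].
exact: UV.
Qed.

Lemma rectangle_bound_swap :
  rectangle_bound al be O (\int[be]_y section_measure al swap_set y)%E.
Proof.
move=> n D L mD finD tD cL DL.
have mL j : measurable (L j : set (borel Y)) by exact: compact_borel.
have -> : (\sum_(j < n) al (D j) * be (L j) =
    \int[be]_y (\sum_(j < n) (al (D j) * (\1_(L j) y)%:E)))%E.
  rewrite ge0_integral_sum//=.
  - apply: eq_bigr => k _; rewrite ge0_integralZl//=.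
    + by rewrite integral_indic// setIT.
    + by apply/measurable_EFinP; exact: measurable_indic.
  - by move=> k; apply: measurable_funeM; apply/measurable_EFinP; exact: measurable_indic.
apply: ge0_le_integral => //=.
- by move=> y _; apply: sume_ge0 => k _; rewrite mule_ge0.
- by apply: emeasurable_sum => k; apply: measurable_funeM;
    apply/measurable_EFinP; exact: measurable_indic.
- exact: (measurable_section_measure hX hal open_swap).
- move=> y _.
  pose D' j := if y \in L j then D j else set0.
  have mD' j : measurable (D' j : set (borel X)) by rewrite /D'; case: ifP.
  have tD' : trivIset setT D'.
    apply/trivIsetP => i j _ _ ij; rewrite /D'.
    by case: ifP => _; case: ifP => _; rewrite ?set0I ?setI0//;
      move/trivIsetP : tD => ->.
  have -> : (\sum_(j < n) al (D j) * (\1_(L j) y)%:E = \sum_(j < n) al (D' j))%E.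
    apply: eq_bigr => j _; rewrite indicE /D'.
    by case: ifP => _; rewrite ?mule1 ?mule0 ?measure0.
  rewrite -measure_bigsetU//; apply: le_measure; rewrite ?inE.
  + by apply: bigsetU_measurable.
  + by apply: open_borel; exact: (open_section open_swap).
  + rewrite -bigcup_mkord => x [j /= jn]; rewrite /D'; case: ifPn => // + Dx.
    by rewrite inE => Ly; rewrite /swap_set /=; exact: DL Dx Ly.
Qed.
End tonelli_swap.

(** Each iterated integral bounds the rectangle sums, hence the iterated
    integral in the other order. *)
Lemma tonelli_open (R : realType) (X Y : topologicalZmodType)
    (al : {measure set (borel X) -> \bar R}) (be : {measure set (borel Y) -> \bar R})
    (O : set (X * Y)) : hausdorff_space X -> hausdorff_space Y ->
  haar_measure al -> haar_measure be -> open O ->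
  (\int[al]_x section_measure be O x =
   \int[be]_y section_measure al (swap_set O) y)%E.
Proof.
move=> hX hY hal hbe oO; apply/eqP; rewrite eq_le; apply/andP; split.
  by apply: integral_section_le => //; exact: rectangle_bound_swap.
have : rectangle_bound be al (swap_set O)
    (\int[al]_x section_measure be (swap_set (swap_set O)) x)%E.
  by apply: rectangle_bound_swap => //; exact: open_swap.
rewrite (_ : swap_set (swap_set O) = O); last by apply/seteqP; split => -[].
by apply: integral_section_le => //; exact: open_swap.
Qed.

Section product_haar.
Variables (R : realType) (A : topologicalZmodType).
Variable mu : {measure set (borel A) -> \bar R}.
Variable nu : {measure set (borel (dual R A)) -> \bar R}.
Variable lam : {measure set (borel (A * dual R A)%type) -> \bar R}.
Hypothesis hA : hausdorff_space A.
Hypothesis hmu : haar_measure mu.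
Hypothesis hnu : haar_measure nu.
Hypothesis lam_product : product_measure_of mu nu lam.

Lemma integral_section_le_product (O : set (A * dual R A)) : open O ->
  (\int[mu]_x section_measure nu O x <= lam O)%E.
Proof.
move=> oO; apply: integral_section_le => //; first exact: dual_hausdorff.
move=> n D L mD finD tD cL DL.
have mL j : measurable (L j : set (borel (dual R A))).
  by apply: compact_borel => //; exact: dual_hausdorff.
have mDL j : measurable (D j `*` L j : set (borel (A * dual R A)%type)).
  exact: measurable_rectangle.
rewrite (eq_bigr (fun j : 'I_n => lam (D j `*` L j))); last first.
  by move=> j _; rewrite lam_product//; exact: (haar_compact_lty hnu).
rewrite -(measure_bigsetU lam (F := fun j => D j `*` L j))//; last first.
  apply/trivIsetP => i j _ _ ij; move/trivIsetP : tD => /(_ i j I I ij) Dij.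
  apply/seteqP; split=> // -[x y] [[/= Di _] [/= Dj _]].
  have : (D i `&` D j) x by split.
  by rewrite Dij.
apply: le_measure; rewrite ?inE.
- by apply: bigsetU_measurable.
- exact: open_borel.
- move=> [x y]; have <- := bigcup_mkord n (fun j => D j `*` L j).
  by move=> [j _ [/= Dx Ly]]; exact: DL Dx Ly.
Qed.
End product_haar.

(** * Open majorants and their correlations *)

Lemma nneseries_mulel (R : realType) (f : nat -> \bar R) (x : \bar R) :
  (0 <= x)%E -> (forall i, 0 <= f i)%E ->
  (x * \sum_(0 <= i <oo) f i = \sum_(0 <= i <oo) (x * f i))%E.
Proof.
case: x => [x| |//] x0 f0; first by rewrite nneseriesZl.
have [f00|/existsNP[k /eqP fk]] := pselect (forall i, f i = 0%E).
  by rewrite !eseries0 ?mule0// => i _ _; rewrite f00 ?mule0.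
have {}fk : (0 < f k)%E by rewrite lt0e fk f0.
have le_k (g : nat -> \bar R) : (forall i, 0 <= g i)%E -> (g k <= \sum_(0 <= i <oo) g i)%E.
  move=> g0; apply: le_trans (nneseries_lim_ge k.+1 _) => //.
  by rewrite big_nat_recr//= leeDr// sume_ge0.
have g0 i : (0 <= +oo * f i)%E by rewrite mule_ge0// leey.
rewrite gt0_mulye; last by apply: lt_le_trans fk _; exact: le_k.
apply/esym/eqP; rewrite -leye_eq; apply: le_trans (le_k _ g0).
by rewrite gt0_mulye.
Qed.

Section open_series.
Variables (R : realType) (A : topologicalZmodType).
Variable mu : {measure set (borel A) -> \bar R}.
Hypothesis hA : hausdorff_space A.
Hypothesis hmu : haar_measure mu.

(** An open stand-in for a nonnegative function: when all U k are open,
    integrals of such series over a product reduce to the measures of open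
    sets. *)
Definition hseries (U : nat -> set A) (y : A) : \bar R :=
  (\sum_(0 <= k <oo) (k.+1%:R^-1 * \1_(U k) y)%:E)%E.

Lemma hseries_ge0 U y : (0 <= hseries U y)%E.
Proof. by apply: nneseries_ge0 => k _ _; rewrite lee_fin mulr_ge0. Qed.

Lemma measurable_harmonic_indic (k : nat) (E : set (borel A)) : measurable E ->
  measurable_fun [set: borel A] (fun y => (k.+1%:R^-1 * \1_E y)%:E : \bar R).
Proof.
by move=> mE; apply/measurable_EFinP; apply: measurable_funM.
Qed.

Lemma measurable_hseries U : (forall k, measurable (U k : set (borel A))) ->
  measurable_fun [set: borel A] (hseries U : borel A -> \bar R).
Proof.
move=> mU; apply: ge0_emeasurable_sum => [k y _ _|k _].
  by rewrite lee_fin mulr_ge0.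
exact: measurable_harmonic_indic.
Qed.

Lemma integral_hseries U : (forall k, measurable (U k : set (borel A))) ->
  (\int[mu]_y hseries U y = \sum_(0 <= k <oo) (k.+1%:R^-1%:E * mu (U k)))%E.
Proof.
move=> mU; rewrite integral_nneseries//=.
- apply: eq_eseriesr => k _; under eq_integral do rewrite EFinM.
  rewrite ge0_integralZl//=; last by apply/measurable_EFinP; exact: measurable_indic.
  by rewrite integral_indic// setIT.
- by move=> k; exact: measurable_harmonic_indic.
Qed.

(** Outer regularity turns the level sets of the harmonic expansion of p into
    open sets, at the cost of e/2^(k+1) at the level k. *)
Lemma open_majorant (p : A -> \bar R) (e : R) :
  measurable_fun [set: borel A] (p : borel A -> \bar R) ->
  (forall y, 0 <= p y)%E -> 0 < e ->
  exists U : nat -> set A, [/\ forall k, open (U k), forall y, (p y <= hseries U y)%E &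
    (\int[mu]_y hseries U y <= \int[mu]_y p y + e%:E)%E].
Proof.
move=> mp p0 e0; pose E k : set A := @harmonic_level _ (borel A) R p k.
have mE k : measurable (E k : set (borel A)) by exact: measurable_harmonic_level.
have ek k : 0 < e / (2 ^ k.+1)%:R by rewrite divr_gt0// ltr0n expn_gt0.
have /choice[U hU] : forall k, exists U : set A, [/\ open U, E k `<=` U &
    (mu U <= mu (E k) + (e / (2 ^ k.+1)%:R)%:E)%E].
  by move=> k; exact: haar_outer.
have oU k : open (U k) by case: (hU k).
have pE y : p y = hseries E y by exact: harmonic_levelE.
have mU k : measurable (U k : set (borel A)) by exact: open_borel.
exists U; split=> //.
  move=> y; rewrite pE; apply: lee_nneseries => [k _ _|k _].
    by rewrite lee_fin mulr_ge0.
  rewrite lee_fin ler_wpM2l// !indicE; have [|//] := boolP (y \in E k).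
  by rewrite inE => Ey; rewrite mem_set//; have [_ + _] := hU k; apply.
have -> : (\int[mu]_y p y = \int[mu]_y hseries E y)%E.
  by apply: eq_integral => y _; exact: pE.
rewrite !integral_hseries//.
have c0 k : (0 <= k.+1%:R^-1%:E * mu (E k))%E by rewrite mule_ge0// lee_fin.
apply: le_trans (epsilon_trick xpredT c0 (ltW e0)).
apply: lee_nneseries => [k _ _|k _]; first by rewrite mule_ge0// lee_fin.
apply: (@le_trans _ _ (k.+1%:R^-1%:E * (mu (E k) + (e / (2 ^ k.+1)%:R)%:E))%E).
  by rewrite lee_wpmul2l// ?lee_fin//; case: (hU k).
rewrite ge0_muleDr//; last by rewrite lee_fin ltW.
rewrite leeD2l// -EFinM lee_fin ger_pMl//.
by rewrite invf_le1 ?ltr0n// ler1n.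
Qed.

Definition shifted_pair (U V : set A) : set (A * A) :=
  [set z | U z.2 /\ V (z.2 + z.1)].

Lemma open_shifted_pair (U V : set A) : open U -> open V -> open (shifted_pair U V).
Proof.
move=> oU oV; rewrite (_ : shifted_pair U V =
    (snd @^-1` U) `&` ((fun z => z.2 + z.1) @^-1` V)) //.
apply: openI; apply: open_comp => // -[x y] _; first exact: cvg_snd.
apply: (@continuous_comp _ _ _ (fun z : A * A => (z.2, z.1)) (fun z : A * A => z.1 + z.2)).
  by apply: cvg_pair; [exact: cvg_snd|exact: cvg_fst].
exact: add_continuous.
Qed.

(** Tonelli for the open set of the pairs (x, y) with y in U and y + x in V,
    whose sections in the other direction are translates of V or empty. *)
Lemma integral_shifted_pair (U V : set A) : open U -> open V ->
  (\int[mu]_x mu [set y | U y /\ V (y + x)%R] = mu U * mu V)%E.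
Proof.
move=> oU oV; have oP := open_shifted_pair oU oV.
have := tonelli_open hA hA hmu hmu oP; rewrite /section_measure /= => ->.
rewrite (eq_integral (fun y : borel A => mu V * (\1_U y)%:E)%E); last first.
  move=> y _; rewrite indicE; have [Uy|nUy] := boolP (y \in U).
    rewrite mule1 -(haar_shift hmu y (open_borel oV)); congr (mu _).
    by apply/seteqP; split=> x /=; [case|move=> ?; split => //; rewrite inE in Uy].
  rewrite mule0 -[RHS](@measure0 _ _ _ mu); congr (mu _).
  by apply/seteqP; split=> x //= -[Uy _]; move: nUy; rewrite mem_set.
rewrite ge0_integralZl//=.
- have mUb := open_borel oU; by rewrite integral_indic// setIT muleC.
- by apply/measurable_EFinP; apply: measurable_indic; exact: open_borel.
Qed.

Definition correlation (P Q : A -> \bar R) (x : A) : \bar R :=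
  (\int[mu]_y (P y * Q (y + x)%R))%E.

Lemma correlation_hseries U V x : (forall k, open (U k)) -> (forall k, open (V k)) ->
  correlation (hseries U) (hseries V) x =
  (\sum_(0 <= k <oo) \sum_(0 <= l <oo)
    (k.+1%:R^-1 * l.+1%:R^-1)%:E * mu [set y | U k y /\ V l (y + x)%R])%E.
Proof.
move=> oU oV.
have mUV k l : measurable ([set y | U k y /\ V l (y + x)] : set (borel A)).
  rewrite (_ : [set _ | _] = U k `&` [set y | V l (x + y)]); last first.
    by apply/seteqP; split => y /= []; rewrite addrC.
  by apply: measurableI; [|apply: measurable_shift]; exact: open_borel.
have mi k l : measurable_fun [set: borel A] (fun y : A => ((k.+1%:R^-1 * l.+1%:R^-1)
    * \1_[set y | U k y /\ V l (y + x)%R] y)%:E : \bar R).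
  by apply/measurable_EFinP; apply: measurable_funM => //; exact: measurable_indic.
have i0 k l (y : A) : (0 <= ((k.+1%:R^-1 * l.+1%:R^-1)
    * \1_[set y | U k y /\ V l (y + x)%R] y)%:E :> \bar R)%E.
  by rewrite lee_fin !mulr_ge0.
have E y : (hseries U y * hseries V (y + x)%R = \sum_(0 <= k <oo) \sum_(0 <= l <oo)
    ((k.+1%:R^-1 * l.+1%:R^-1) * \1_[set y | U k y /\ V l (y + x)%R] y)%:E)%E.
  rewrite muleC nneseries_mulel ?hseries_ge0//.
  apply: eq_eseriesr => k _; rewrite muleC nneseries_mulel//.
  apply: eq_eseriesr => l _; rewrite -EFinM mulrACA; congr (_ * _)%:E.
  rewrite !indicE; have [Uy|nUy] := pselect (U k y); last first.
    by rewrite (memNset nUy) mul0r memNset// => -[].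
  rewrite (mem_set Uy) mul1r; congr (nat_of_bool _)%:R.
  by apply/idP/idP; rewrite !inE => //= -[].
have -> : (correlation (hseries U) (hseries V) x = \int[mu]_y
    \sum_(0 <= k <oo) \sum_(0 <= l <oo)
    ((k.+1%:R^-1 * l.+1%:R^-1) * \1_[set y | U k y /\ V l (y + x)%R] y)%:E)%E.
  by apply: eq_integral => y _; exact: E.
rewrite integral_nneseries//=.
- apply: eq_eseriesr => k _; rewrite integral_nneseries//=.
  apply: eq_eseriesr => l _; under eq_integral do rewrite EFinM.
  rewrite ge0_integralZl//=.
  + by rewrite integral_indic// setIT.
  + by apply/measurable_EFinP; exact: measurable_indic.
- by move=> k; apply: ge0_emeasurable_sum.
- by move=> k y _; exact: nneseries_ge0.
Qed.

Lemma measurable_correlation U V : (forall k, open (U k)) -> (forall k, open (V k)) ->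
  measurable_fun [set: borel A] (correlation (hseries U) (hseries V) : borel A -> \bar R).
Proof.
move=> oU oV; rewrite (_ : correlation _ _ = (fun x => \sum_(0 <= k <oo) \sum_(0 <= l <oo)
    (k.+1%:R^-1 * l.+1%:R^-1)%:E * mu [set y | U k y /\ V l (y + x)%R])%E); last first.
  by apply/funext => x; exact: correlation_hseries.
have g0 k l x : (0 <= (k.+1%:R^-1 * l.+1%:R^-1)%:E * mu [set y | U k y /\ V l (y + x)%R])%E.
  by rewrite mule_ge0// lee_fin mulr_ge0.
apply: ge0_emeasurable_sum => [k x _ _|k _]; first exact: nneseries_ge0.
apply: ge0_emeasurable_sum => [l x _ _|l _]; first exact: g0.
apply: measurable_funeM.
exact: (measurable_section_measure hA hmu (open_shifted_pair (oU k) (oV l))).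
Qed.

Lemma integral_correlation U V : (forall k, open (U k)) -> (forall k, open (V k)) ->
  (\int[mu]_x correlation (hseries U) (hseries V) x =
   (\int[mu]_y hseries U y) * (\int[mu]_y hseries V y))%E.
Proof.
move=> oU oV.
have g0 k l x : (0 <= (k.+1%:R^-1 * l.+1%:R^-1)%:E * mu [set y | U k y /\ V l (y + x)%R])%E.
  by rewrite mule_ge0// lee_fin mulr_ge0.
have mg k l : measurable_fun [set: borel A] (fun x : A =>
    (k.+1%:R^-1 * l.+1%:R^-1)%:E * mu [set y | U k y /\ V l (y + x)%R])%E.
  apply: measurable_funeM.
  exact: (measurable_section_measure hA hmu (open_shifted_pair (oU k) (oV l))).
have -> : (\int[mu]_x correlation (hseries U) (hseries V) x =
    \int[mu]_x \sum_(0 <= k <oo) \sum_(0 <= l <oo)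
    (k.+1%:R^-1 * l.+1%:R^-1)%:E * mu [set y | U k y /\ V l (y + x)%R])%E.
  by apply: eq_integral => x _; exact: correlation_hseries.
rewrite integral_nneseries//=; first last.
- by move=> k x _; exact: nneseries_ge0.
- by move=> k; apply: ge0_emeasurable_sum.
have mU k : measurable (U k : set (borel A)) by exact: open_borel.
have mV k : measurable (V k : set (borel A)) by exact: open_borel.
have c0 (E : nat -> set A) k : (0 <= k.+1%:R^-1%:E * mu (E k))%E.
  by rewrite mule_ge0// lee_fin.
rewrite !integral_hseries// muleC nneseries_mulel//; last exact: nneseries_ge0.
apply: eq_eseriesr => k _; rewrite integral_nneseries//= muleC nneseries_mulel//.
apply: eq_eseriesr => l _; rewrite ge0_integralZl//=.
- by rewrite integral_shifted_pair// EFinM muleACA.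
- exact: (measurable_section_measure hA hmu (open_shifted_pair (oU k) (oV l))).
Qed.
End open_series.

(** * A support of measure one forces modulus one *)

Lemma sqint_defect (R : realType) (B : PreTopologicalZmodule.type)
    (m : {measure set (borel B) -> \bar R}) (v : B -> R[i]) (d : R) (F E : set B) :
  cmeasurable v -> measurable (F : set (borel B)) -> measurable (E : set (borel B)) ->
  0 <= d -> F `<=` E -> (forall y, ~ E y -> v y = 0) ->
  (forall y, F y -> normc (v y) ^+ 2 <= 1 - d) -> (forall y, normc (v y) <= 1) ->
  (sqint m v + d%:E * m F <= m E)%E.
Proof.
move=> mv mF mE d0 FE vE vF v1.
have mv2 : measurable_fun [set: borel B] (fun y => (normc (v y) ^+ 2)%:E : \bar R).
  by apply/measurable_EFinP; exact: measurable_sqr_normc.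
have intI (S : set (borel B)) : measurable S -> (\int[m]_y (\1_S y)%:E = m S)%E.
  by move=> mS; rewrite integral_indic// setIT.
have mI (S : set (borel B)) : measurable S ->
    measurable_fun [set: borel B] (fun y => (\1_S y)%:E : \bar R).
  by move=> mS; apply/measurable_EFinP; exact: measurable_indic.
rewrite -(intI _ mF) -(intI _ mE) -ge0_integralZl//=; last exact: mI.
rewrite -ge0_integralD//=; first last.
- by apply: measurable_funeM; exact: mI.
- by move=> y _; rewrite mule_ge0.
- by move=> y _; rewrite lee_fin sqr_ge0.
apply: ge0_le_integral => //=.
- by move=> y _; rewrite adde_ge0 ?mule_ge0// lee_fin sqr_ge0.
- by apply: emeasurable_funD => //; apply: measurable_funeM; exact: mI.
- exact: mI.
- move=> y _; rewrite -EFinM -EFinD lee_fin !indicE.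
  have [Ey|nEy] := pselect (E y); last first.
    rewrite (memNset nEy) memNset; last by move=> /FE.
    by rewrite vE// normcr0 expr0n mulr0 addr0.
  rewrite (mem_set Ey); have [Fy|nFy] := pselect (F y).
    by rewrite (mem_set Fy) mulr1 -lerBrDr; exact: vF.
  by rewrite (memNset nFy) mulr0 addr0 expr_le1 ?normc_ge0.
Qed.

Section moyal.
Variables (R : realType) (A : topologicalZmodType).
Variable mu : {measure set (borel A) -> \bar R}.
Variable nu : {measure set (borel (dual R A)) -> \bar R}.
Hypothesis hA : hausdorff_space A.
Hypothesis hmu : haar_measure mu.
Hypothesis hnu : haar_measure nu.
Hypothesis pl : plancherel mu nu.
Implicit Type f : A -> R[i].

Lemma fourier_sqint f : cintegrable mu f -> L2 mu f ->
  sqint nu (fourier mu f) = sqint mu f.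
Proof.
move=> [mf f1] f2; rewrite -!cnorm_L2E pl//; split=> //.
rewrite /cnorm_L Lnorm1; rewrite (eq_integral (fun y : borel A => (normc (f y))%:E))// => y _.
by rewrite gee0_abs// lee_fin normc_ge0.
Qed.

Lemma fourier_stft f x xi :
  fourier mu (fun y => f y * (f (y - x))^*) xi = stft mu f f (x, xi).
Proof.
congr cintegral; apply/funext => y; rewrite /tf_shift /modulation /translation /=.
by rewrite rmorphM mulrAC mulrA.
Qed.

Definition autocorrelation f (x : A) : \bar R :=
  (\int[mu]_y (normc (f y) ^+ 2 * normc (f (y + x)%R) ^+ 2)%:E)%E.

(** V_f f(x, .) is the Fourier transform of y |-> f(y) conj f(y - x). *)
Lemma sqint_stft_section f x : L2 mu f -> (autocorrelation f x < +oo)%E ->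
  sqint nu (fun xi => stft mu f f (x, xi)) = autocorrelation f x.
Proof.
move=> f2 Ff; have [mf _] := (L2P mu f).1 f2.
have Tf2 := L2_translation hmu x f2.
have qi := cintegrable_mulJ f2 Tf2.
have E : sqint mu (fun y => f y * (translation x f y)^*) = autocorrelation f x.
  rewrite /sqint /autocorrelation.
  pose g (y : borel A) := normc (f y) ^+ 2 * normc (f (y + x)) ^+ 2.
  have mg : measurable_fun setT g.
    apply: measurable_funM; first exact: measurable_sqr_normc.
    apply: measurable_sqr_normc.
    apply: (cmeasurable_comp (g := fun y : A => y + x)) => //.
    rewrite (_ : (fun y => y + x) = (fun y => x + y)); first exact: shift_continuous.
    by apply/funext => z; rewrite addrC.
  rewrite -(ge0_integral_shiftN hmu x mg); last by move=> y; rewrite mulr_ge0 ?sqr_ge0.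
  apply: eq_integral => y _; rewrite /g subrK normcM normc_conj exprMn mulrC //.
have q2 : L2 mu (fun y => f y * (translation x f y)^*).
  by apply/L2P; split; [case: qi|rewrite E].
rewrite -E -(fourier_sqint qi q2).
by apply: eq_integral => xi _; rewrite -fourier_stft.
Qed.

Section positive_defect.
Variable lam : {measure set (borel (A * dual R A)%type) -> \bar R}.
Hypothesis lam_product : product_measure_of mu nu lam.
Variable f : A -> R[i].
Hypothesis f2 : L2 mu f.
Hypothesis f1 : sqint mu f = 1%E.
Local Notation V := (stft mu f f).
Local Notation G := (stft_support mu f).

Let mf : cmeasurable f. Proof. by have [] := (L2P mu f).1 f2. Qed.
Let fn1 : sqnorm mu f = 1. Proof. by rewrite /sqnorm f1. Qed.
Let oG : open G. Proof. exact: open_stft_support. Qed.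
Let hD := @dual_hausdorff R A.

Lemma continuous_stft_section x : continuous ((fun xi => V (x, xi)) : dual R A -> R[i]^o).
Proof.
move=> xi; apply: continuous_normcP => e e0.
have : \forall z \near (x, xi), normc (V (x, xi) - V z) < e.
  by apply: near_normc => //; exact: stft_continuous.
move=> [[P Q] /= [nP nQ] PQ]; apply: filterS nQ => xi' Qxi'.
by apply: (PQ (x, xi')); split=> //; exact: nbhs_singleton.
Qed.

(** |V_f f|^2 is at most the indicator of its support, and is smaller by d on
    O. *)
Lemma section_defect (d : R) (O : set (A * dual R A)) x : 0 <= d -> open O ->
  O `<=` G -> (forall z, O z -> normc (V z) ^+ 2 <= 1 - d) ->
  (sqint nu (fun xi => V (x, xi)) + d%:E * section_measure nu O x <=
   section_measure nu G x)%E.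
Proof.
move=> d0 oO OG Od.
apply: (@sqint_defect _ _ nu (fun xi => V (x, xi))) => //.
- by apply: cmeasurable_continuous; exact: continuous_stft_section.
- by apply: open_borel; exact: open_section.
- by apply: open_borel; exact: open_section.
- by move=> xi /OG.
- by move=> xi /negP; rewrite negbK => /eqP.
- by move=> xi /Od.
- by move=> xi; exact: normc_stft_le1.
Qed.

(** With p = |f|^2: P(y) P(y + x) <= p(y) P(y + x) + Q(y) P(y + x), and p(y)
    P(y + x) <= p(y) p(y + x) + P(y) Q(y + x). *)
Lemma autocorrelation_lower (P Q : A -> \bar R) x : (forall y, 0 <= P y)%E ->
  (forall y, 0 <= Q y)%E ->
  measurable_fun [set: borel A] (P : borel A -> \bar R) ->
  measurable_fun [set: borel A] (Q : borel A -> \bar R) ->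
  (forall y, (normc (f y) ^+ 2)%:E <= P y)%E ->
  (forall y, P y <= (normc (f y) ^+ 2)%:E + Q y)%E ->
  (correlation mu P P x <=
    autocorrelation f x + (correlation mu P Q x + correlation mu Q P x))%E.
Proof.
move=> P0 Q0 mP mQ pP PQ.
have msh (S : borel A -> \bar R) : measurable_fun setT S ->
    measurable_fun [set: borel A] (fun y : A => S (y + x)).
  move=> mS; rewrite (_ : (fun _ => _) = S \o ((fun y : A => x + y) : borel A -> borel A)).
    by apply: measurableT_comp => //; apply: continuous_borel_borel; exact: shift_continuous.
  by apply/funext => y /=; rewrite addrC.
have mc (S S' : borel A -> \bar R) : measurable_fun setT S -> measurable_fun setT S' ->
    measurable_fun [set: borel A] (fun y : A => S y * S' (y + x)%R)%E.
  by move=> mS mS'; apply: emeasurable_funM => //; exact: msh.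
pose p (y : A) : \bar R := (normc (f y) ^+ 2)%:E.
have mp : measurable_fun [set: borel A] (p : borel A -> \bar R).
  by apply/measurable_EFinP; exact: measurable_sqr_normc.
have p0 y : (0 <= p y)%E by rewrite lee_fin sqr_ge0.
have -> : autocorrelation f x = correlation mu p p x by [].
rewrite -ge0_integralD//=; first last.
- exact: mc.
- by move=> y _; rewrite mule_ge0.
- exact: mc.
- by move=> y _; rewrite mule_ge0.
rewrite -ge0_integralD//=; first last.
- by apply: emeasurable_funD; exact: mc.
- by move=> y _; rewrite adde_ge0 ?mule_ge0.
- exact: mc.
- by move=> y _; rewrite mule_ge0.
apply: ge0_le_integral => //=.
- by move=> y _; rewrite mule_ge0.
- exact: mc.
- by apply: emeasurable_funD; [exact: mc|apply: emeasurable_funD; exact: mc].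
- move=> y _; apply: (@le_trans _ _ ((p y + Q y) * P (y + x)%R)%E).
    by rewrite lee_wpmul2r.
  rewrite ge0_muleDl// addeA leeD2r//.
  apply: (@le_trans _ _ (p y * (p (y + x)%R + Q (y + x)%R))%E).
    by rewrite lee_wpmul2l.
  by rewrite ge0_muleDr// leeD2l// lee_wpmul2r//; exact: pP.
Qed.

(** Heuristically, by Plancherel in the second variable and Tonelli, the
    integral of |V_f f|^2 over A x dual A is ||f||^4 = 1 = lam G; as |V_f f|
    <= 1, it is 1 on G. Without sigma-finiteness Tonelli may fail for Borel
    functions; it holds for open sets, so |f|^2 is replaced by a majorant P
    made of open sets, and P - |f|^2 by such a majorant Q of small integral.
    If |V_f f|^2 < 1 - d on an open rectangle of measure at least k,
    integrating the inequality of each section gives 1 + d k <= lam G + 8 e. *)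
Lemma stft_unimodular z : lam G = 1%E -> G z -> normc (V z) = 1.
Proof.
move=> lamG Gz; apply/eqP; apply: contrapT => /negP v1.
have {}v1 : normc (V z) < 1 by rewrite lt_neqAle v1 normc_stft_le1.
pose d := (1 - normc (V z) ^+ 2) / 2.
have vz2 : normc (V z) ^+ 2 < 1 by rewrite expr_lt1 ?normc_ge0.
have d0 : 0 < d by rewrite divr_gt0// subr_gt0.
pose O := G `&` [set w | normc (V w) ^+ 2 < 1 - d].
have oO : open O.
  apply: openI => //.
  apply: (@open_comp _ _ (fun w => normc (V w) ^+ 2) [set r | r < 1 - d]); last exact: open_lt.
  move=> w _.
  apply: (@continuous_comp _ _ _ (fun w => normc (V w)) (fun r : R => r ^+ 2)).
    by apply: normc_continuous; exact: stft_continuous.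
  exact: exprn_continuous.
have Oz : O z by split=> //; change (normc (V z) ^+ 2 < 1 - d); rewrite /d; lra.
have [[U W] /= [nU nW] UW] : nbhs z O by exact: open_nbhs_nbhs.
have oU' := open_interior U; have oW' := open_interior W.
have U'z : (U^°)%classic z.1 by [].
have W'z : (W^°)%classic z.2 by [].
have mU0 : (0 < mu U^°)%E by apply: haar_open_gt0 => //; exists z.1.
have mW0 : (0 < nu W^°)%E by apply: (haar_open_gt0 hD hnu) => //; exists z.2.
have mU' := open_borel oU'; have mW' := open_borel oW'.
have secO : (mu U^° * nu W^° <= \int[mu]_x section_measure nu O x)%E.
  apply: (@le_trans _ _ (\int[mu]_x (nu W^° * (\1_(U^°) x)%:E))%E).
    rewrite ge0_integralZl//=.
    - by rewrite integral_indic// setIT muleC.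
    - by apply/measurable_EFinP; exact: measurable_indic.
  apply: ge0_le_integral => //=.
  - by apply: measurable_funeM; apply/measurable_EFinP; exact: measurable_indic.
  - exact: (measurable_section_measure hD hnu oO).
  - move=> x _; rewrite indicE; have [U'x|nU'x] := pselect ((U^°)%classic x); last first.
      by rewrite memNset// mule0.
    rewrite mem_set// mule1; apply: le_measure; rewrite ?inE//.
      by apply: open_borel; exact: open_section.
    by move=> xi W'xi; apply: UW; split=> /=; exact: interior_subset.
have [k k0 kUW] : exists2 k : R, 0 < k & (k%:E <= mu U^° * nu W^°)%E.
  have := mule_gt0 mU0 mW0; case: (mu U^° * nu W^°)%E => [r| |//] r0.
    by exists r; rewrite // -lte_fin.
  by exists 1; rewrite ?leey.
(* The error terms are at most 2 (1 + e) 2 e <= 8 e <= d k / 2. *)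
pose e := Num.min 1 (d * k / 16).
have e0 : 0 < e by rewrite lt_min ltr01 divr_gt0// mulr_gt0.
have e1 : e <= 1 by rewrite ge_min lexx.
have edk : e <= d * k / 16 by rewrite ge_min lexx orbT.
pose p (y : A) : \bar R := (normc (f y) ^+ 2)%:E.
have mp : measurable_fun [set: borel A] (p : borel A -> \bar R).
  by apply/measurable_EFinP; exact: measurable_sqr_normc.
have p0 y : (0 <= p y)%E by rewrite lee_fin sqr_ge0.
have ip : (\int[mu]_y p y = 1)%E by exact: f1.
have [S [oS pS iS]] := open_majorant hmu mp p0 e0.
have mS := fun k => open_borel (oS k).
set P := hseries R S in pS iS; rewrite ip in iS.
have mP : measurable_fun [set: borel A] (P : borel A -> \bar R) by exact: measurable_hseries.
have P0 y : (0 <= P y)%E by exact: hseries_ge0.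
have iP1 : (1 <= \int[mu]_y P y)%E.
  by rewrite -ip; apply: ge0_le_integral.
pose Df y := (P y - p y)%E.
have mDf : measurable_fun [set: borel A] (Df : borel A -> \bar R).
  exact: emeasurable_funB.
have Df0 y : (0 <= Df y)%E by rewrite sube_ge0.
have PE y : P y = (p y + Df y)%E by rewrite /Df addeC subeK.
have iDf : (\int[mu]_y Df y <= e%:E)%E.
  have : (\int[mu]_y P y = 1 + \int[mu]_y Df y)%E.
    rewrite -ip -ge0_integralD//=; first by apply: eq_integral => y _; exact: PE.
  by move=> Pe; move: iS; rewrite Pe leeD2lE.
have [S' [oS' DS' iS']] := open_majorant hmu mDf Df0 e0.
set Q := hseries R S' in DS' iS'.
have mS' := fun k => open_borel (oS' k).
have mQ : measurable_fun [set: borel A] (Q : borel A -> \bar R) by exact: measurable_hseries.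
have Q0 y : (0 <= Q y)%E by exact: hseries_ge0.
have iQ : (\int[mu]_y Q y <= (2 * e)%:E)%E.
  apply: le_trans iS' _; apply: le_trans (leeD iDf (lexx _)) _.
  by rewrite -EFinD lee_fin; lra.
have PQ y : (P y <= (normc (f y) ^+ 2)%:E + Q y)%E by rewrite PE leeD2l.
have mPP := measurable_correlation hA hmu oS oS; rewrite -/P in mPP.
have mPQ := measurable_correlation hA hmu oS oS'; rewrite -/P -/Q in mPQ.
have mQP := measurable_correlation hA hmu oS' oS; rewrite -/P -/Q in mQP.
have PP := integral_correlation hA hmu oS oS; rewrite -/P in PP.
have iPQ := integral_correlation hA hmu oS oS'; rewrite -/P -/Q in iPQ.
have iQP := integral_correlation hA hmu oS' oS; rewrite -/P -/Q in iQP.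
have [iP [iPE iPl iPu]] : exists r : R, [/\ (\int[mu]_y P y = r%:E)%E, 1 <= r & r <= 1 + e].
  move: iP1 iS; case: (\int[mu]_y P y)%E => [r||]//.
  by rewrite -EFinD !lee_fin => h1 h2; exists r.
have [q [qE ql qu]] : exists r : R, [/\ (\int[mu]_y Q y = r%:E)%E, 0 <= r & r <= 2 * e].
  have : (0 <= \int[mu]_y Q y)%E by apply: integral_ge0.
  move: iQ; case: (\int[mu]_y Q y)%E => [r||]//.
  by rewrite !lee_fin => h1 h2; exists r.
have c0 (P1 P2 : A -> \bar R) x : (forall y, 0 <= P1 y)%E -> (forall y, 0 <= P2 y)%E ->
    (0 <= correlation mu P1 P2 x)%E.
  by move=> P10 P20; apply: integral_ge0 => y _; rewrite mule_ge0.
have cPP x := c0 P P x P0 P0; have cPQ x := c0 P Q x P0 Q0; have cQP x := c0 Q P x Q0 P0.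
clearbody P Q.
have mG := measurable_section_measure hD hnu oG.
have mO := measurable_section_measure hD hnu oO.
(* Plancherel applies to the sections x for which the autocorrelation is finite. *)
have PPfin : {ae mu, forall x : A, (correlation mu P P x < +oo)%E}.
  have : mu.-integrable setT (correlation mu P P : borel A -> \bar R).
    apply/integrableP; split; first exact: mPP.
    have -> : (\int[mu]_x `|correlation mu P P x| = \int[mu]_x correlation mu P P x)%E.
      by apply: eq_integral => x _; rewrite gee0_abs//; exact: cPP.
    by rewrite PP iPE -EFinM ltry.
  move=> /integrable_ae -/(_ measurableT); apply: aeS => x /(_ I).
  by rewrite ge0_fin_numE//; exact: cPP.
have : (\int[mu]_x (correlation mu P P x + d%:E * section_measure nu O x) <=
    \int[mu]_x (section_measure nu G x +
      (correlation mu P Q x + correlation mu Q P x)))%E.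
  apply: ae_ge0_le_integral => //.
  - by move=> x _; apply: adde_ge0; [exact: cPP|rewrite mule_ge0// lee_fin ltW].
  - by apply: emeasurable_funD => //; exact: measurable_funeM.
  - by move=> x _; apply: adde_ge0 => //; apply: adde_ge0.
  - by apply: emeasurable_funD => //; exact: emeasurable_funD.
  - apply: aeS PPfin => x fPP _.
    have autofin : (autocorrelation f x < +oo)%E.
      apply: le_lt_trans fPP; apply: ge0_le_integral => //=.
      + by move=> y _; rewrite lee_fin mulr_ge0// sqr_ge0.
      + apply/measurable_EFinP; apply: measurable_funM.
          exact: measurable_sqr_normc.
        apply: measurable_sqr_normc.
        apply: (cmeasurable_comp (g := fun y : A => y + x)) => //.
        rewrite (_ : (fun y => y + x) = (fun y => x + y)).
          exact: shift_continuous.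
        by apply/funext => w; rewrite addrC.
      + apply: emeasurable_funM => //.
        rewrite (_ : (fun _ => _) = (P : borel A -> \bar R) \o
          ((fun y : A => x + y) : borel A -> borel A)).
          by apply: measurableT_comp => //; apply: continuous_borel_borel; exact: shift_continuous.
        by apply/funext => y /=; rewrite addrC.
      + by move=> y _; rewrite EFinM; apply: lee_pmul; [exact: p0|exact: (p0 (y + x))|exact: pS|exact: pS].
    have lower := autocorrelation_lower x P0 Q0 mP mQ pS PQ.
    have := @section_defect d O x (ltW d0) oO (@subIsetl _ _ _).
    have Od w : O w -> normc (V w) ^+ 2 <= 1 - d by move=> [_ /ltW].
    move=> /(_ Od); rewrite sqint_stft_section// => h; apply: le_trans (leeD lower (lexx _)) _.
    by rewrite addeAC leeD2r.
move: mPP mPQ mQP PP iPQ iQP cPP cPQ cQP {PPfin}.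
move: (correlation mu P P) (correlation mu P Q) (correlation mu Q P) => a b c.
move=> ma mb mc ia ib ic a0 b0 c0'.
rewrite ge0_integralD//=; first last.
- exact: measurable_funeM.
- by move=> x _; rewrite mule_ge0// lee_fin ltW.
rewrite ge0_integralZl//=; last by rewrite lee_fin ltW.
rewrite ge0_integralD//=; first last.
- exact: emeasurable_funD.
- by move=> x _; apply: adde_ge0.
rewrite ge0_integralD//= ia ib ic iPE qE.
have := integral_section_le_product hA hmu hnu lam_product oG; rewrite lamG => hG.
move=> hh; have : (iP%:E * iP%:E + d%:E * k%:E <= 1 + (iP%:E * q%:E + q%:E * iP%:E))%E.
  apply: (@le_trans _ _ (iP%:E * iP%:E + d%:E * \int[mu]_x section_measure nu O x)%E).
    rewrite leeD2l// lee_wpmul2l//; first by rewrite lee_fin ltW.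
    exact: le_trans secO.
  by apply: le_trans hh _; rewrite leeD2r.
rewrite -!EFinM -!EFinD lee_fin => {}hh.
have dk0 : 0 < d * k by rewrite mulr_gt0.
move: (d * k) dk0 edk hh => dk dk0 edk hh.
by clear -iPl iPu ql qu e0 e1 edk dk0 hh; nra.
Qed.
End positive_defect.
End moyal.

(** * Subgroups, cosets and annihilators *)

Definition subgroup_set (A : zmodType) (H : set A) : Prop :=
  H 0 /\ forall x y, H x -> H y -> H (x - y).

Section subgroup_set_theory.
Variables (A : zmodType) (H : set A).
Hypothesis sH : subgroup_set H.

Lemma subgroup_set0 : H 0. Proof. exact: sH.1. Qed.
Lemma subgroup_setB x y : H x -> H y -> H (x - y). Proof. exact: sH.2. Qed.
Lemma subgroup_setN x : H x -> H (- x).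
Proof. by move=> Hx; rewrite -sub0r; apply: subgroup_setB => //; exact: subgroup_set0. Qed.
Lemma subgroup_setD x y : H x -> H y -> H (x + y).
Proof. by move=> Hx Hy; rewrite -[y]opprK; apply: subgroup_setB => //; exact: subgroup_setN. Qed.
Lemma subgroup_setDr x y : H y -> H (x + y) <-> H x.
Proof.
by move=> Hy; split=> [Hxy|Hx]; [rewrite -[x](addrK y); exact: subgroup_setB|exact: subgroup_setD].
Qed.
Fixpoint distinct_cosets (s : seq A) : Prop :=
  if s is x :: s' then (forall y, y \in s' -> ~ H (x - y)) /\ distinct_cosets s'
  else True.

Lemma distinct_coset_representatives (s : seq A) :
  exists s' : seq A, [/\ {subset s' <= s}, distinct_cosets s' &
    forall x, x \in s -> exists2 y, y \in s' & H (x - y)].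
Proof.
elim: s => [|x s [s' [ss ds hs]]]; first by exists [::].
have [[y ys hy]|nex] := pselect (exists2 y, y \in s' & H (x - y)).
  exists s'; split=> //; first by move=> z /ss zs; rewrite in_cons zs orbT.
  move=> z; rewrite in_cons => /orP[/eqP->|/hs//].
  by exists y.
exists (x :: s'); split.
- move=> z; rewrite !in_cons => /orP[->//|/ss ->]; exact: orbT.
- by split=> // y ys hy; apply: nex; exists y.
- move=> z; rewrite in_cons => /orP[/eqP->|/hs[y ys hy]].
    by exists x; [exact: mem_head|rewrite subrr; exact: subgroup_set0].
  by exists y; rewrite // in_cons ys orbT.
Qed.
End subgroup_set_theory.

Section unit_circle.
Variable R : realType.

(** If z <> 1 is on the unit circle, |z^2 - 1| = |z - 1| |z + 1| > 3/2 |z - 1|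
    as long as |z - 1| < 1, so the powers z^(2^n) leave that disk. *)
Lemma unit_circle_no_small_powers (z : R[i]) : normc z = 1 ->
  (forall n, normc (1 - z ^+ n) < 1) -> z = 1.
Proof.
move=> z1 hz; apply/eqP; apply: contrapT => /negP zn1.
have d0 : 0 < normc (1 - z) by rewrite lt0r normc_ge0 normc_eq0 subr_eq0 eq_sym zn1.
have key (w : R[i]) : normc w = 1 -> normc (1 - w) < 1 ->
    (3 / 2) * normc (1 - w) <= normc (1 - w ^+ 2).
  move=> w1 hw.
  have -> : 1 - w ^+ 2 = (1 - w) * (1 + w) by ring.
  rewrite normcM mulrC ler_wpM2l ?normc_ge0//.
  have : (3 / 2) ^+ 2 <= normc (1 + w) ^+ 2.
    have e1 := normc_sqrE w; have e2 := normc_sqrE (1 - w); have e3 := normc_sqrE (1 + w).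
    rewrite w1 in e1; have : normc (1 - w) ^+ 2 < 1 by rewrite expr_lt1 ?normc_ge0.
    by rewrite e2 e3; clear hw e2 e3; move: e1; case: w {w1} => a b /=; nra.
  by rewrite ler_pXn2r// nnegrE ?normc_ge0// divr_ge0.
have zn n : normc (z ^+ n) = 1.
  elim: n => [|n ih]; first by rewrite expr0 normcr1.
  by rewrite exprS normcM z1 ih mulr1.
have pow n : (1 + n%:R / 2) * normc (1 - z) <= normc (1 - z ^+ (2 ^ n)).
  elim: n => [|n ih]; first by rewrite mul0r addr0 mul1r expn0 expr1.
  rewrite expnSr exprM; apply: le_trans (key _ (zn _) (hz _)).
  apply: (@le_trans _ _ ((3 / 2) * ((1 + n%:R / 2) * normc (1 - z)))).
    rewrite mulrA ler_wpM2r ?normc_ge0// -natr1.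
    have : 0 <= n%:R :> R by []; lra.
  by rewrite ler_wpM2l// divr_ge0.
pose N := (Num.truncn (2 / normc (1 - z))).+1.
have := pow N; have := hz (2 ^ N)%N.
have : 2 / normc (1 - z) < N%:R by exact: truncnS_gt.
rewrite ltr_pdivrMr//.
move: (normc (1 - z ^+ (2 ^ N))) (normc (1 - z)) d0 (N%:R) => w d d0' x h1 h2 h3.
nra.
Qed.
End unit_circle.

Section annihilator.
Variables (R : realType) (A : topologicalZmodType).
Variable H : set A.
Hypothesis sH : subgroup_set H.

Definition annihilator : set (dual R A) := [set xi | forall y, H y -> xi y = 1].

Lemma subgroup_annihilator : subgroup_set annihilator.
Proof.
split=> [y Hy|xi eta hx he y Hy]; first exact: dual0E.
by rewrite dualDE dualNE hx// he// mul1r conjC1.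
Qed.

Lemma char_trivial_on_subgroup (xi : dual R A) :
  (forall y, H y -> normc (1 - xi y) < 1) -> annihilator xi.
Proof.
move=> h y Hy; apply: unit_circle_no_small_powers; first exact: normc_char.
move=> n; have -> : xi y ^+ n = xi (y *+ n).
  elim: n => [|n ih]; first by rewrite expr0 mulr0n char0.
  by rewrite exprS ih mulrS char_add.
apply: h; elim: n => [|n ih]; first by rewrite mulr0n; exact: subgroup_set0.
by rewrite mulrS; exact: subgroup_setD.
Qed.

(** A character close to 1 on the subgroup H is equal to 1 there, as the unit
    circle has no small subgroups. *)
Lemma nbhs_annihilator : compact H -> nbhs (0 : dual R A) annihilator.
Proof.
move=> cH; have := dual_near (0 : dual R A) cH (@ltr01 R[i]).
apply: filterS => xi /= hxi; apply: char_trivial_on_subgroup => y Hy.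
by have : `|1 - xi y| < 1 := hxi y Hy; rewrite normcrE ltcR.
Qed.
End annihilator.

Lemma open_subgroup (A : topologicalZmodType) (H : set A) : subgroup_set H ->
  nbhs 0 H -> open H.
Proof.
move=> sH nH; rewrite openE => x Hx; apply: filterS (@nbhs_shift A x H nH) => y /= Hyx.
by rewrite -[y](subrK x); exact: subgroup_setD.
Qed.

Lemma open_subgroup_closed (A : topologicalZmodType) (H : set A) : subgroup_set H ->
  open H -> closed H.
Proof.
move=> sH oH; rewrite -[H]setCK; apply: open_closedC; rewrite openE => x nHx.
have nH : nbhs 0 H by apply: open_nbhs_nbhs; split=> //; exact: subgroup_set0.
apply: filterS (@nbhs_shift A x H nH) => y /= Hyx Hy; apply: nHx.
by rewrite -[x](subKr y); exact: subgroup_setB.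
Qed.

(** * Fourier analysis on a compact open subgroup *)

Section cintegrable_ops.
Variables (R : realType) (A : topologicalZmodType).
Variable mu : {measure set (borel A) -> \bar R}.
Hypothesis hmu : haar_measure mu.
Implicit Types (u v : A -> R[i]) (xi : dual R A).

Lemma cintegrableD u v : cintegrable mu u -> cintegrable mu v ->
  cintegrable mu (fun y => u y + v y).
Proof.
move=> [mu1 ui] [mv vi]; split; first exact: cmeasurableD.
apply: (@le_lt_trans _ _ (\int[mu]_y ((normc (u y))%:E + (normc (v y))%:E))%E).
  apply: ge0_le_integral => //=.
  - by move=> y _; rewrite lee_fin normc_ge0.
  - by apply/measurable_EFinP; apply: measurable_normc; exact: cmeasurableD.
  - by apply: emeasurable_funD; apply/measurable_EFinP; exact: measurable_normc.
  - by move=> y _; rewrite -EFinD lee_fin le_normcD.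
rewrite ge0_integralD//=.
- exact: lte_add_pinfty.
- by move=> y _; rewrite lee_fin normc_ge0.
- by apply/measurable_EFinP; exact: measurable_normc.
- by move=> y _; rewrite lee_fin normc_ge0.
- by apply/measurable_EFinP; exact: measurable_normc.
Qed.

Lemma cintegrableZ (c : R[i]) u : cintegrable mu u -> cintegrable mu (fun y => c * u y).
Proof.
move=> [mu1 ui]; split; first by apply: cmeasurableM => //; exact: cmeasurable_cst.
have -> : (\int[mu]_y (normc (c * u y)%R)%:E = \int[mu]_y ((normc c)%:E * (normc (u y))%:E))%E.
  by apply: eq_integral => y _; rewrite normcM EFinM.
rewrite ge0_integralZl//=.
- by rewrite lte_mul_pinfty// lee_fin normc_ge0.
- by apply/measurable_EFinP; exact: measurable_normc.
- by move=> y _; rewrite lee_fin normc_ge0.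
- by rewrite lee_fin normc_ge0.
Qed.

Lemma cintegrable_mulchar u xi : cintegrable mu u ->
  cintegrable mu (fun y => u y * (xi y)^*).
Proof.
move=> [mu1 ui]; split.
  by apply: cmeasurableM => //; apply: cmeasurableJ; exact: cmeasurable_char.
rewrite (eq_integral (fun y : borel A => (normc (u y))%:E))// => y _.
by rewrite normcM normc_conj normc_char mulr1.
Qed.

Lemma cintegrable_translation x u : cintegrable mu u -> cintegrable mu (translation x u).
Proof.
move=> [mu1 ui]; split; first exact: cmeasurable_translation.
rewrite /translation (ge0_integral_shiftN hmu x (p := fun y => normc (u y)))//.
  exact: measurable_normc.
by move=> y; exact: normc_ge0.
Qed.

Lemma fourierD u v xi : cintegrable mu u -> cintegrable mu v ->
  fourier mu (fun y => u y + v y) xi = fourier mu u xi + fourier mu v xi.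
Proof.
move=> ui vi; rewrite /fourier -cintegralD; do ?exact: cintegrable_mulchar.
by congr cintegral; apply/funext => y; rewrite mulrDl.
Qed.

Lemma fourierZ (c : R[i]) u xi : cintegrable mu u ->
  fourier mu (fun y => c * u y) xi = c * fourier mu u xi.
Proof.
move=> ui; rewrite /fourier -cintegralZ; do ?exact: cintegrable_mulchar.
by congr cintegral; apply/funext => y; rewrite mulrA.
Qed.

Lemma fourier_translation x u xi : cintegrable mu u ->
  fourier mu (translation x u) xi = (xi x)^* * fourier mu u xi.
Proof.
move=> ui; have [mc _] := cintegrable_mulchar xi ui.
rewrite /fourier -(cintegral_shiftN hmu x mc) -cintegralZ; last first.
  exact: (cintegrable_translation x (cintegrable_mulchar xi ui)).
congr cintegral; apply/funext => y; rewrite char_add charN rmorphM /= conjCK /translation.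
have -> (a b c d : R[i]) : a * (b * (c * d)) = b * c * (d * a) by ring.
by rewrite char_mulJ mulr1.
Qed.
End cintegrable_ops.

Section compact_open_subgroup.
Variables (R : realType) (A : topologicalZmodType).
Variable mu : {measure set (borel A) -> \bar R}.
Variable nu : {measure set (borel (dual R A)) -> \bar R}.
Hypothesis hA : hausdorff_space A.
Hypothesis hmu : haar_measure mu.
Hypothesis pl : plancherel mu nu.
Variable H : set A.
Hypothesis sH : subgroup_set H.
Hypothesis cH : compact H.
Hypothesis oH : open H.

Let H0 : H 0. Proof. exact: subgroup_set0. Qed.
Let mH : measurable (H : set (borel A)). Proof. exact: open_borel. Qed.

Definition haar_subgroup : R := fine (mu H).
Local Notation h := haar_subgroup.

Lemma haar_subgroupE : mu H = h%:E.
Proof. by rewrite fineK// ge0_fin_numE//; exact: haar_compact_lty. Qed.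

Lemma haar_subgroup_gt0 : 0 < h.
Proof.
by rewrite -lte_fin -haar_subgroupE; apply: haar_open_gt0 => //; exists 0.
Qed.

Definition cindic (y : A) : R[i] := (\1_H y : R)%:C.
Local Notation ind := cindic.

Lemma cindic1 y : H y -> ind y = 1. Proof. by move=> Hy; rewrite /cindic indicE mem_set. Qed.
Lemma cindic0 y : ~ H y -> ind y = 0. Proof. by move=> nHy; rewrite /cindic indicE memNset. Qed.

Lemma cmeasurable_cindic : cmeasurable ind.
Proof. exact: cmeasurable_indic. Qed.

Lemma L2_cindic_bounded (g : A -> R[i]) (c : R) : cmeasurable g ->
  (forall y, ~ H y -> g y = 0) -> (forall y, H y -> normc (g y) <= c) -> L2 mu g.
Proof.
move=> mg g0 gc; apply/L2P; split=> //.
apply: (@le_lt_trans _ _ (\int[mu]_y ((c ^+ 2)%:E * (\1_H y)%:E))%E).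
  apply: ge0_le_integral => //=.
  - by move=> y _; rewrite lee_fin sqr_ge0.
  - by apply/measurable_EFinP; exact: measurable_sqr_normc.
  - by apply: measurable_funeM; apply/measurable_EFinP; exact: measurable_indic.
  - move=> y _; rewrite -EFinM lee_fin indicE; have [Hy|nHy] := pselect (H y).
      have n0 := normc_ge0 (g y); have := gc y Hy.
      by rewrite mem_set// mulr1 => h1; rewrite lerXn2r// nnegrE// (le_trans n0).
    by rewrite memNset// mulr0 g0// normcr0 expr0n.
rewrite ge0_integralZl//=.
- by rewrite integral_indic// setIT haar_subgroupE -EFinM ltry.
- by apply/measurable_EFinP; exact: measurable_indic.
- by rewrite lee_fin sqr_ge0.
Qed.

Lemma L2_cindic : L2 mu ind.
Proof.
apply: (@L2_cindic_bounded _ 1); first exact: cmeasurable_cindic.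
- by move=> y; exact: cindic0.
- by move=> y /cindic1 ->; rewrite normcr1.
Qed.

Lemma cintegrable_supported (g : A -> R[i]) : L2 mu g ->
  (forall y, ~ H y -> g y = 0) -> cintegrable mu g.
Proof.
move=> g2 g0; have := cintegrable_mulJ g2 L2_cindic.
rewrite (_ : (fun x => _) = g)//; apply/funext => y.
have [Hy|nHy] := pselect (H y); first by rewrite cindic1// conjC1 mulr1.
by rewrite g0// mul0r.
Qed.

Lemma fourier_eq0 (g : A -> R[i]) : L2 mu g -> cintegrable mu g ->
  (forall xi, fourier mu g xi = 0) -> {ae mu, forall y : A, g y = 0}.
Proof.
move=> g2 gi g0; apply: sqnorm_eq0 => //; rewrite /sqnorm -(fourier_sqint pl gi g2).
rewrite /sqint (eq_integral (fun _ : borel (dual R A) => 0%E)).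
  by rewrite integral0.
by move=> xi _; rewrite g0 normcr0 expr0n.
Qed.

Lemma not_ae_zero_on_subgroup (g : A -> R[i]) : (forall y, H y -> g y != 0) ->
  ~ {ae mu, forall y : A, g y = 0}.
Proof.
move=> g1 [N [mN N0 sN]].
have : (mu H <= mu N)%E.
  apply: le_measure; rewrite ?inE// => y Hy; apply: sN => /= gy.
  by have := g1 y Hy; rewrite gy eqxx.
by rewrite haar_subgroupE N0 lee_fin leNgt haar_subgroup_gt0.
Qed.

Definition multiplicative_on_subgroup (chi : A -> R[i]) : Prop :=
  [/\ cmeasurable (fun y => ind y * chi y),
      forall y, H y -> normc (chi y) = 1 &
      forall x y, H x -> H y -> chi (x + y) = chi x * chi y].

Lemma multiplicative_char (chi : A -> R[i]) (xi : dual R A) :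
  multiplicative_on_subgroup chi ->
  multiplicative_on_subgroup (fun y => chi y * (xi y)^*).
Proof.
move=> [m1 u1 a1]; split.
- rewrite (_ : (fun _ => _) = (fun y => (ind y * chi y) * (xi y)^*)).
    by apply: cmeasurableM => //; apply: cmeasurableJ; exact: cmeasurable_char.
  by apply/funext => y; rewrite mulrA.
- by move=> y Hy; rewrite normcM normc_conj u1// normc_char mulr1.
- by move=> x y Hx Hy; rewrite a1// char_add rmorphM mulrACA.
Qed.

(** Translating by - y0 multiplies the integral by chi y0. *)
Lemma cintegral_multiplicative (chi : A -> R[i]) (y0 : A) :
  multiplicative_on_subgroup chi -> H y0 -> chi y0 != 1 ->
  cintegral mu (fun y => ind y * chi y) = 0.
Proof.
move=> [m1 u1 a1] Hy0 c1; set g := fun y => _.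
have g2 : L2 mu g.
  apply: (@L2_cindic_bounded _ 1) => // y.
    by move=> nHy; rewrite /g cindic0// mul0r.
  by move=> Hy; rewrite /g cindic1// mul1r u1.
have gi : cintegrable mu g.
  by apply: cintegrable_supported => // y nHy; rewrite /g cindic0// mul0r.
have := cintegral_shiftN hmu (- y0) m1.
have -> : (fun y => g (y - - y0)) = (fun y => chi y0 * g y).
  apply/funext => y; rewrite opprK /g.
  have [Hy|nHy] := pselect (H y).
    rewrite (cindic1 Hy) cindic1; last exact: subgroup_setD.
    by rewrite !mul1r a1// mulrC.
  by rewrite (cindic0 nHy) cindic0 ?mul0r ?mulr0// => /(subgroup_setDr sH _ Hy0).
rewrite cintegralZ// => /eqP; rewrite -subr_eq0 -{2}[cintegral _ _]mul1r -mulrBl.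
by rewrite mulf_eq0 subr_eq0 (negbTE c1) /= => /eqP.
Qed.

Lemma cintegral_cindic : cintegral mu ind = h%:C.
Proof.
rewrite /cintegral /Rintegral /=; congr (_ +i* _); last first.
  by rewrite integral0.
by rewrite integral_indic// setIT.
Qed.

Lemma multiplicative_one : multiplicative_on_subgroup (fun _ => 1).
Proof.
split=> [|y _|x y _ _]; last by rewrite mulr1.
- by under eq_fun do rewrite mulr1; exact: cmeasurable_cindic.
- by rewrite normcr1.
Qed.

Lemma fourier_cindic_ann (xi : dual R A) : annihilator H xi ->
  fourier mu ind xi = h%:C.
Proof.
move=> hxi; rewrite -cintegral_cindic; congr cintegral; apply/funext => y.
have [Hy|nHy] := pselect (H y); first by rewrite hxi// conjC1 mulr1.
by rewrite cindic0// mul0r.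
Qed.

Lemma fourier_multiplicative (chi : A -> R[i]) (xi : dual R A) y :
  multiplicative_on_subgroup chi -> H y -> xi y != chi y ->
  fourier mu (fun y => ind y * chi y) xi = 0.
Proof.
move=> mchi Hy ne; have mc := multiplicative_char xi mchi.
rewrite -(cintegral_multiplicative mc Hy).
  by congr cintegral; apply/funext => z; rewrite mulrA.
apply: contra ne => /eqP E; rewrite -[xi y]mul1r -E -mulrA [_^* * _]mulrC.
by rewrite char_mulJ mulr1.
Qed.

Lemma fourier_cindic_notann (xi : dual R A) : ~ annihilator H xi ->
  fourier mu ind xi = 0.
Proof.
move=> /existsNP[y /not_implyP[Hy /eqP ne]].
rewrite -(fourier_multiplicative multiplicative_one Hy ne).
by congr (fourier _ _ _); apply/funext => z; rewrite mulr1.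
Qed.

Lemma open_annihilator : open (annihilator H : set (dual R A)).
Proof.
apply: open_subgroup; first exact: subgroup_annihilator.
exact: nbhs_annihilator.
Qed.

Let mann : measurable (annihilator H : set (borel (dual R A))).
Proof. by apply: open_borel; exact: open_annihilator. Qed.

(** Plancherel for the indicator of H, whose Fourier transform is mu H times
    the indicator of the annihilator. *)
Lemma nu_annihilator : nu (annihilator H) = h^-1%:E.
Proof.
have h0 := haar_subgroup_gt0.
have i2 := L2_cindic.
have ii : cintegrable mu ind by apply: cintegrable_supported => // y; exact: cindic0.
have := fourier_sqint pl ii i2.
have -> : sqint mu ind = h%:E.
  rewrite -haar_subgroupE -[H in RHS]setIT -integral_indic//.
  apply: eq_integral => y _; congr (_%:E).
  have [Hy|nHy] := pselect (H y).
    by rewrite cindic1// normcr1 expr1n indicE mem_set.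
  by rewrite cindic0// normcr0 expr0n indicE memNset.
have -> : sqint nu (fourier mu ind) = ((h ^+ 2)%:E * nu (annihilator H))%E.
  rewrite -[in RHS](setIT (annihilator H)) -integral_indic// -ge0_integralZl//=.
  - apply: eq_integral => xi _; rewrite -EFinM; congr (_%:E).
    have [Hy|nHy] := pselect (annihilator H xi).
      rewrite fourier_cindic_ann// indicE mem_set// mulr1 normc_sqrE /=.
      by rewrite expr0n addr0.
    by rewrite fourier_cindic_notann// normcr0 expr0n indicE memNset// mulr0.
  - by apply/measurable_EFinP; exact: measurable_indic.
  - by rewrite lee_fin sqr_ge0.
move=> E; have h20 : h ^+ 2 != 0 by rewrite expf_neq0// gt_eqF.
rewrite -[LHS]mul1e -[1%E](_ : ((h ^+ 2)^-1 * h ^+ 2)%:E = _); last by rewrite mulVf.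
rewrite EFinM -muleA E -EFinM; congr (_%:E).
by rewrite expr2 invfM -mulrA mulVf ?mulr1// gt_eqF.
Qed.

(** The indicators of H and x + H have Fourier transforms supported on the
    annihilator of H, where they differ by the factor conj (xi x); they would
    coincide if this factor were always 1. *)
Lemma annihilator_separates x : ~ H x ->
  exists2 eta : dual R A, annihilator H eta & eta x != 1.
Proof.
move=> nHx; apply: contrapT => nex.
have all1 (eta : dual R A) : annihilator H eta -> eta x = 1.
  by move=> ae; apply/eqP; apply: contrapT => /negP e1; apply: nex; exists eta.
have T2 := L2_translation hmu x L2_cindic.
pose g y := ind y + (-1) * translation x ind y.
have ii : cintegrable mu ind.
  by apply: cintegrable_supported; [exact: L2_cindic|move=> y; exact: cindic0].
have Ti := cintegrable_translation hmu x ii.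
have g2 : L2 mu g by apply: L2D; [exact: L2_cindic|exact: L2Z].
have gi : cintegrable mu g by apply: cintegrableD => //; exact: cintegrableZ.
have : {ae mu, forall y : A, g y = 0}.
  apply: fourier_eq0 => // xi.
  have -> : fourier mu g xi = (1 - (xi x)^*) * fourier mu ind xi.
    rewrite fourierD//; last exact: cintegrableZ.
    rewrite fourierZ// fourier_translation//.
    by rewrite mulN1r mulrBl mul1r.
  have [axi|naxi] := pselect (annihilator H xi).
    by rewrite all1// conjC1 subrr mul0r.
  by rewrite fourier_cindic_notann// mulr0.
apply: not_ae_zero_on_subgroup => y Hy; rewrite /g /translation cindic1//.
rewrite cindic0 ?mulr0 ?addr0 ?oner_neq0// => Hyx; apply: nHx.
by rewrite -[x](subKr y); exact: subgroup_setB.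
Qed.

(** Otherwise chi, cut off outside H, would be orthogonal to all characters
    and vanish almost everywhere by Plancherel. *)
Lemma multiplicative_extends (chi : A -> R[i]) :
  multiplicative_on_subgroup chi ->
  exists xi : dual R A, forall y, H y -> xi y = chi y.
Proof.
move=> mchi; have [m1 u1 a1] := mchi; apply: contrapT => nex.
pose g y := ind y * chi y.
have g0 y : ~ H y -> g y = 0 by move=> nHy; rewrite /g cindic0// mul0r.
have g2 : L2 mu g.
  apply: (@L2_cindic_bounded _ 1) => // y.
  by move=> Hy; rewrite /g cindic1// mul1r u1.
have gi : cintegrable mu g by exact: cintegrable_supported.
have : {ae mu, forall y : A, g y = 0}.
  apply: fourier_eq0 => // xi.
  have /existsNP[y /not_implyP[Hy /eqP ne]] : ~ forall y, H y -> xi y = chi y.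
    by move=> e; apply: nex; exists xi.
  exact: fourier_multiplicative ne.
apply: not_ae_zero_on_subgroup => y Hy; rewrite /g cindic1// mul1r.
by rewrite -normc_eq0 u1// oner_neq0.
Qed.

(** The Fourier transform of an H-invariant function vanishes off the
    annihilator of H, and is constant on it when the function lives on H. *)
Lemma invariant_ae_constant (g : A -> R[i]) : L2 mu g ->
  (forall y, ~ H y -> g y = 0) ->
  (forall x, H x -> {ae mu, forall y : A, g (y - x) = g y}) ->
  exists c : R[i], {ae mu, forall y : A, g y = c * ind y}.
Proof.
move=> g2 g0 ginv; have h0 := haar_subgroup_gt0.
have gi : cintegrable mu g by exact: cintegrable_supported.
pose c := cintegral mu g / h%:C; exists c.
have ii : cintegrable mu ind.
  by apply: cintegrable_supported; [exact: L2_cindic|move=> y; exact: cindic0].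
pose u y := g y + (- c) * ind y.
have u2 : L2 mu u by apply: L2D => //; apply: L2Z; exact: L2_cindic.
have ui : cintegrable mu u by apply: cintegrableD => //; exact: cintegrableZ.
have : {ae mu, forall y : A, u y = 0}.
  apply: fourier_eq0 => // xi; rewrite fourierD//; last exact: cintegrableZ.
  rewrite fourierZ//; have [axi|naxi] := pselect (annihilator H xi).
    rewrite fourier_cindic_ann// mulNr mulfVK; last first.
      by rewrite -normc_eq0 /= expr0n addr0 sqrtr_sqr normr_eq0 gt_eqF.
    apply/eqP; rewrite subr_eq0; apply/eqP; congr cintegral; apply/funext => y.
    have [Hy|nHy] := pselect (H y); first by rewrite axi// conjC1 mulr1.
    by rewrite g0// mul0r.
  rewrite fourier_cindic_notann// mulr0 addr0.
  have /existsNP[x /not_implyP[Hx /eqP ne]] := naxi.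
  have E : fourier mu g xi = (xi x)^* * fourier mu g xi.
    rewrite -fourier_translation//; apply: cintegral_ae.
    - by case: (cintegrable_mulchar xi gi).
    - by case: (cintegrable_mulchar xi (cintegrable_translation hmu x gi)).
    - by apply: aeS (ginv x Hx) => y; rewrite /translation => ->.
  apply/eqP; move/eqP : E; rewrite -subr_eq0 -{1}[fourier _ _ _]mul1r -mulrBl mulf_eq0.
  case/orP => //; rewrite subr_eq0 eq_sym => /eqP e.
  by move: ne; rewrite -(conjCK (xi x)) e conjC1 eqxx.
by apply: aeS => y /eqP; rewrite /u mulNr subr_eq0 => /eqP.
Qed.
End compact_open_subgroup.

(** * Density of the characters of a compact open subgroup *)

Section character_approximation.
Variables (R : realType) (A : topologicalZmodType).
Variable mu : {measure set (borel A) -> \bar R}.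
Variable nu : {measure set (borel (dual R A)) -> \bar R}.
Hypothesis hA : hausdorff_space A.
Hypothesis hmu : haar_measure mu.
Hypothesis hnu : haar_measure nu.
Hypothesis pl : plancherel mu nu.
Variable H : set A.
Hypothesis sH : subgroup_set H.
Hypothesis cH : compact H.
Hypothesis oH : open H.
Local Notation h := (haar_subgroup mu H).
Local Notation ind := (cindic R H).
Local Notation ann := (annihilator H : set (dual R A)).

Let h0 : 0 < h. Proof. exact: haar_subgroup_gt0. Qed.

Variable v : A -> R[i].
Hypothesis v2 : L2 mu v.
Hypothesis v0 : forall y, ~ H y -> v y = 0.
Local Notation vh := (fourier mu v).

Let vi : cintegrable mu v. Proof. by apply: (@cintegrable_supported _ _ _ hmu H). Qed.

Lemma fourier_coset (xi eta : dual R A) : ann (xi - eta) -> vh xi = vh eta.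
Proof.
move=> hxe; congr cintegral; apply/funext => y.
have [Hy|nHy] := pselect (H y); last by rewrite v0// !mul0r.
have := hxe y Hy; rewrite dualDE dualNE => e; congr (_ * _^*).
by rewrite -[LHS]mulr1 -(char_mulJ eta y) mulrCA e mulr1.
Qed.

Lemma continuous_fourier_supported : continuous (vh : dual R A -> R[i]^o).
Proof.
move=> xi; apply: continuous_normcP => e e0.
have := nbhs_annihilator R sH cH => /(@nbhs_shift (dual R A) xi).
by apply: filterS => eta hxe; rewrite (fourier_coset hxe) subrr normcr0.
Qed.

Definition char_on (xi : dual R A) (y : A) : R[i] := xi y * ind y.

Lemma L2_char_on xi : L2 mu (char_on xi).
Proof. by apply: L2_modulation; exact: L2_cindic. Qed.

Lemma inner_char_on xi : inner mu v (char_on xi) = vh xi.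
Proof.
congr cintegral; apply/funext => y; rewrite /char_on.
have [Hy|nHy] := pselect (H y); first by rewrite cindic1// mulr1.
by rewrite v0// !mul0r.
Qed.

Lemma inner_char_on2 xi eta :
  inner mu (char_on eta) (char_on xi) = fourier mu ind (xi - eta).
Proof.
congr cintegral; apply/funext => y; rewrite /char_on dualDE dualNE !rmorphM /= conjCK.
have [Hy|nHy] := pselect (H y); first by rewrite cindic1// conjC1; ring.
by rewrite cindic0// mulr0 !mul0r.
Qed.

(** The remainder of v after its Fourier terms along s; these terms are
    orthogonal when the elements of s are in distinct cosets of the
    annihilator of H. *)
Fixpoint char_residual (s : seq (dual R A)) (y : A) : R[i] :=
  if s is xi :: s' then char_residual s' y + (- (vh xi / h%:C)) * char_on xi y
  else v y.

Lemma L2_char_residual s : L2 mu (char_residual s).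
Proof. by elim: s => //= xi s ih; apply: L2D => //; apply: L2Z; exact: L2_char_on. Qed.

Lemma inner_char_residual s xi : (forall eta, eta \in s -> ~ ann (xi - eta)) ->
  inner mu (char_residual s) (char_on xi) = vh xi.
Proof.
elim: s => [|eta s ih] hs /=; first exact: inner_char_on.
have r2 := L2_char_residual s; have b2 := L2_char_on.
rewrite innerDl//; last exact: L2Z.
rewrite innerZl// inner_char_on2 fourier_cindic_notann//; last first.
  by apply: hs; exact: mem_head.
by rewrite mulr0 addr0 ih// => z zs; apply: hs; rewrite in_cons zs orbT.
Qed.

Lemma sqnorm_char_on xi : sqnorm mu (char_on xi) = h.
Proof.
apply: (@complexI R); rewrite -inner_self inner_char_on2 subrr.
by apply: fourier_cindic_ann => // y _; exact: dual0E.
Qed.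

Lemma sqnorm_char_residual s : distinct_cosets ann s ->
  sqnorm mu (char_residual s) =
  sqnorm mu v - \sum_(xi <- s) normc (vh xi) ^+ 2 / h.
Proof.
elim: s => [_|xi s ih [hxi /ih {}ih]]; first by rewrite big_nil subr0.
have r2 := L2_char_residual s; have b2 := L2_char_on.
rewrite /= sqnormD//; last exact: L2Z.
rewrite sqnormZ// innerZr// inner_char_residual// sqnorm_char_on ih big_cons.
have hn : h != 0 by rewrite gt_eqF.
have -> : (- (vh xi / h%:C))^* * vh xi = (- (normc (vh xi) ^+ 2 / h))%:C.
  rewrite rmorphN rmorphM /= fmorphV /= mulNr [X in - X]mulrAC [_^* * _]mulrC mulJc.
  have -> : (h%:C)^* = h%:C by exact: conjc_real.
  by apply/esym; rewrite rmorphN rmorphM (fmorphV (real_complex R)).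
have -> : normc (- (vh xi / h%:C)) ^+ 2 = normc (vh xi) ^+ 2 / h ^+ 2.
  rewrite normcN normcM normcV exprMn exprVn; congr (_ / _).
  by rewrite normc_sqrE /= expr0n addr0.
have ReC (x : R) : complex.Re x%:C = x by [].
rewrite ReC; move: (normc (vh xi) ^+ 2) (\sum_(_ <- s) _) => a S.
by field.
Qed.

Lemma char_residualE s y : char_residual s y =
  v y - \sum_(xi <- s) (vh xi / h%:C) * char_on xi y.
Proof.
elim: s => [|xi s ih] /=; first by rewrite big_nil subr0.
by rewrite ih big_cons mulNr opprD addrA addrAC.
Qed.

(** By Plancherel's formula and tightness, finitely many cosets of the
    annihilator of H carry almost all of the squared norm of v, so Bessel's
    inequality for the corresponding characters is almost an equality. *)
Lemma character_approximation (e : R) : 0 < e ->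
  exists s : seq (dual R A), sqnorm mu (char_residual s) < e.
Proof.
move=> e0; have sann := subgroup_annihilator R H.
have hD := @dual_hausdorff R A.
pose p (xi : dual R A) := normc (vh xi) ^+ 2.
have mvh : cmeasurable vh by apply: cmeasurable_continuous; exact: continuous_fourier_supported.
have mp : measurable_fun [set: borel (dual R A)] (p : borel (dual R A) -> R).
  exact: measurable_sqr_normc.
have p0 xi : 0 <= p xi by exact: sqr_ge0.
have ip : (\int[nu]_xi (p xi)%:E = (sqnorm mu v)%:E)%E.
  by rewrite -sqint_fin// -(fourier_sqint pl vi v2).
have [K [cK hK]] : exists K : set (dual R A), compact K /\
    (\int[nu]_(xi in ~` K) (p xi)%:E < e%:E)%E.
  by apply: (haar_tight hD hnu) => //; rewrite ip ltry.
have nW xi : K xi -> nbhs xi [set eta | ann (eta - xi)].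
  by move=> _; apply: (@nbhs_shift (dual R A) xi); exact: nbhs_annihilator.
have [s [_ Ks]] := compact_finite_subcover cK nW.
have [s' [_ ds hs]] := distinct_coset_representatives sann s.
exists s'; rewrite sqnorm_char_residual//.
have mK := compact_borel hD cK.
have mcos (xi : dual R A) : measurable ([set eta | ann (eta - xi)] : set (borel (dual R A))).
  apply: measurable_shiftN; apply: open_borel; exact: open_annihilator.
have mi (E : set (borel (dual R A))) : measurable E ->
    measurable_fun [set: borel (dual R A)] (fun xi => (\1_E xi)%:E : \bar R).
  by move=> mE; apply/measurable_EFinP; exact: measurable_indic.
have iK : (\int[nu]_(xi in K) (p xi)%:E <= (\sum_(xi <- s') p xi / h)%:E)%E.
  have -> : ((\sum_(xi <- s') p xi / h)%:E = \int[nu]_eta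
      \sum_(xi <- s') ((p xi)%:E * (\1_[set eta | ann (eta - xi)] eta)%:E))%E.
    rewrite ge0_integral_sum//=.
    - rewrite -sumEFin; apply: eq_bigr => xi _; rewrite ge0_integralZl//=.
      + rewrite integral_indic// setIT EFinM; congr (_ * _)%E.
        rewrite -(nu_annihilator hA hmu pl sH cH oH).
        by rewrite -(haar_shiftN hnu xi)//; apply: open_borel; exact: open_annihilator.
      + exact: mi.
      + by rewrite lee_fin.
    - by move=> xi; apply: measurable_funeM; exact: mi.
    - by move=> xi eta _; rewrite mule_ge0// lee_fin.
  rewrite integral_mkcond; apply: ge0_le_integral => //=.
  - by move=> xi _; rewrite patchE; case: ifP => // _; rewrite lee_fin.
  - apply/(measurable_restrictT _ _).1 => //.
    by apply/measurable_EFinP; apply: measurable_funS mp.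
  - by apply: emeasurable_sum => xi; apply: measurable_funeM; exact: mi.
  - move=> eta _; rewrite patchE; case: ifPn => [|_]; last first.
      by apply: sume_ge0 => xi _; rewrite mule_ge0// lee_fin.
    rewrite inE => Keta; have [xi xs he] := Ks eta Keta.
    have [z zs hz] := hs xi xs.
    have hez : ann (eta - z).
      by rewrite -[eta](subrK xi) -addrA; exact: (subgroup_setD sann).
    rewrite (big_rem z)//= indicE mem_set// mule1 /p (fourier_coset hez) leeDl//.
    by apply: sume_ge0 => w _; rewrite mule_ge0// lee_fin sqr_ge0.
have : ((sqnorm mu v)%:E < e%:E + (\sum_(xi <- s') p xi / h)%:E)%E.
  have -> : (sqnorm mu v)%:E = (\int[nu]_(xi in ~` K) (p xi)%:E + \int[nu]_(xi in K) (p xi)%:E)%E.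
    rewrite -ip -ge0_integral_setU//.
    - by rewrite setvU.
    - exact: measurableC.
    - by rewrite setvU; exact/measurable_EFinP.
    - by move=> xi _; rewrite lee_fin.
    - by apply/eqP; rewrite setICl.
  by apply: (le_lt_trans (leeD (lexx _) iK)); rewrite lteD2rE.
by rewrite -EFinD lte_fin -ltrBlDr.
Qed.
End character_approximation.

(** * The measure of a subgroup of the time-frequency group *)

Section subgroup_of_product.
Variables (R : realType) (A : topologicalZmodType).
Variable mu : {measure set (borel A) -> \bar R}.
Variable nu : {measure set (borel (dual R A)) -> \bar R}.
Variable lam : {measure set (borel (A * dual R A)%type) -> \bar R}.
Hypothesis hmu : haar_measure mu.
Hypothesis hnu : haar_measure nu.
Hypothesis lam_product : product_measure_of mu nu lam.
Variables (G : set (A * dual R A)) (H : set A).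
Hypothesis sG : subgroup_set G.
Hypothesis HG : forall x, H x <-> exists xi, G (x, xi).
Hypothesis cH : compact H.
Hypothesis nK : nbhs (0 : A) [set x | G (x, 0)].

Definition vertical_fibre : set (dual R A) := [set eta | G (0, eta)].
Hypothesis oN : open vertical_fibre.
Hypothesis finN : (nu vertical_fibre < +oo)%E.
Local Notation K := [set x | G (x, 0)].
Local Notation N := vertical_fibre.

Let sK : subgroup_set K.
Proof.
split; first exact: (subgroup_set0 sG).
by move=> x y /= Gx Gy; have := subgroup_setB sG Gx Gy; rewrite [(_ - _)](_ : _ = (x - y, 0 - 0))// subr0.
Qed.

(** K = {x | G (x, 0)} has finitely many cosets in the compact set H, and G
    is the disjoint union of the rectangles (x + K) x (xi_x + N), for x
    running over representatives of these cosets and G (x, xi_x). *)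
Lemma subgroup_product_measure : lam G = (mu H * nu N)%E.
Proof.
have oK : open K by exact: open_subgroup.
have KH x : K x -> H x by move=> Kx; apply/HG; exists 0.
have sH : subgroup_set H.
  split; first by apply: KH; exact: subgroup_set0.
  move=> x y /HG[xi Gx] /HG[eta Gy]; apply/HG; exists (xi - eta).
  exact: (subgroup_setB sG Gx Gy).
have /choice[xi_ hxi] : forall x, exists xi, H x -> G (x, xi).
  move=> x; have [/HG[xi Gx]|nHx] := pselect (H x); first by exists xi.
  by exists 0.
have nW x : H x -> nbhs x [set y | K (y - x)] by move=> _; exact: nbhs_shift.
have [s0 [s0H s0K]] := compact_finite_subcover cH nW.
have [s [ss ds hs]] := distinct_coset_representatives sK s0.
have sHs x : x \in s -> H x by move=> /ss/s0H.
have mKx x : measurable ([set y | K (y - x)] : set (borel A)).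
  by apply: measurable_shiftN; exact: open_borel.
have mNx (xi : dual R A) : measurable ([set eta | N (eta - xi)] : set (borel (dual R A))).
  by apply: measurable_shiftN; exact: open_borel.
pose Q x : set (A * dual R A) := [set y | K (y - x)] `*` [set eta | N (eta - xi_ x)].
have mQ x : measurable (Q x : set (borel (A * dual R A)%type)).
  exact: measurable_rectangle.
have finK x : (mu [set y | K (y - x)%R] < +oo)%E.
  rewrite (haar_shiftN hmu x); last exact: open_borel.
  apply: (@le_lt_trans _ _ (mu H)); last exact: haar_compact_lty.
  apply: le_measure; rewrite ?inE; [exact: open_borel| |exact: KH].
  apply: open_borel; apply: open_subgroup => //.
  by apply: filterS nK => x'; exact: KH.
pose D (t : seq A) : set A := \big[setU/set0]_(x <- t) [set y | K (y - x)].
pose E (t : seq A) : set (A * dual R A) := \big[setU/set0]_(x <- t) Q x.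
have DP t y : D t y <-> exists2 x, x \in t & K (y - x).
  by rewrite /D -bigcup_seq; split=> -[x xt Kx]; exists x.
have EP t z : E t z <-> exists2 x, x \in t & Q x z.
  by rewrite /E -bigcup_seq; split=> -[x xt Kx]; exists x.
have mD t : measurable (D t : set (borel A)) by exact: bigsetU_measurable.
have mE t : measurable (E t : set (borel (A * dual R A)%type)).
  exact: bigsetU_measurable.
have key t : distinct_cosets K t -> lam (E t) = (mu (D t) * nu N)%E.
  elim: t => [_|x t ih [hx /ih {}ih]].
    by rewrite /E /D !big_nil !measure0 mul0e.
  have disj y : K (y - x) -> ~ D t y.
    move=> Kyx /DP[z zt Kyz]; apply: (hx z zt).
    have := subgroup_setB sK Kyz Kyx.
    by rewrite opprB addrC addrA subrK.
  have -> : E (x :: t) = Q x `|` E t by rewrite /E big_cons.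
  have -> : D (x :: t) = [set y | K (y - x)] `|` D t by rewrite /D big_cons.
  rewrite measureU//; last first.
    apply/seteqP; split=> // -[y eta] [[/= Kyx _] /EP[z zt [/= Kyz _]]].
    by apply: (disj y Kyx); apply/DP; exists z.
  rewrite measureU//; last first.
    by apply/seteqP; split=> // y [Kyx Dy]; exact: (disj y Kyx).
  rewrite ge0_muleDl//; congr (_ + _)%E; last exact: ih.
  have fN : (nu [set eta | N (eta - xi_ x)%R] = nu N)%E.
    by apply: (haar_shiftN hnu); exact: open_borel.
  transitivity (mu [set y | K (y - x)%R] * nu [set eta | N (eta - xi_ x)%R])%E.
    by apply: lam_product => //; rewrite fN.
  by rewrite fN.
have -> : G = E s.
  apply/seteqP; split=> [[y eta] Gy|[y eta] /EP[x xs [/= Kyx Neta]]].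
    have Hy : H y by apply/HG; exists eta.
    have [x0 x0s Kx0] := s0K y Hy; have [x xs Kx] := hs x0 x0s.
    have Kyx : K (y - x).
      have := subgroup_setD sK Kx0 Kx; rewrite /= addrA subrK; exact.
    apply/EP; exists x => //; split=> //=.
    have := subgroup_setB sG (subgroup_setB sG Gy Kyx) (hxi x (sHs x xs)).
    rewrite [X in G X](_ : _ = (y - (y - x) - x, eta - 0 - xi_ x))//.
    by rewrite subKr subrr subr0.
  have := subgroup_setD sG (subgroup_setD sG Kyx (hxi x (sHs x xs))) Neta.
  rewrite [X in G X](_ : _ = (y - x + x + 0, 0 + xi_ x + (eta - xi_ x)))//.
  by rewrite addr0 subrK add0r addrC subrK.
have -> : H = D s; last exact: key.
apply/seteqP; split=> [y Hy|y /DP[x xs Kyx]].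
  have [x0 x0s Kx0] := s0K y Hy; have [x xs Kx] := hs x0 x0s.
  apply/DP; exists x => //.
  by have := subgroup_setD sK Kx0 Kx; rewrite /= addrA subrK; exact.
by rewrite -[y](subrK x); apply: (subgroup_setD sH); [exact: KH|exact: sHs].
Qed.
End subgroup_of_product.

(** * Windows with modulus one on the support *)

Section unimodular_support.
Variables (R : realType) (A : topologicalZmodType).
Variable mu : {measure set (borel A) -> \bar R}.
Hypothesis hmu : haar_measure mu.
Variable f : A -> R[i].
Hypothesis f2 : L2 mu f.
Hypothesis f1 : sqnorm mu f = 1.
Local Notation V := (stft mu f f).
Local Notation G := (stft_support mu f).

Let mf : cmeasurable f. Proof. by have [] := (L2P mu f).1 f2. Qed.
Let mtf z : cmeasurable (tf_shift z f).
Proof. by have [] := (L2P mu (tf_shift z f)).1 (L2_tf_shift hmu z f2). Qed.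

(** Equality in the inequality of Cauchy and Schwarz for f and pi z f. *)
Lemma stft_eigen z : normc (V z) = 1 ->
  {ae mu, forall y : A, f y = V z * tf_shift z f y}.
Proof.
move=> V1; have t2 := L2_tf_shift hmu z f2.
have t1 : sqnorm mu (tf_shift z f) = 1 by rewrite (sqnorm_tf_shift hmu).
have := sqnorm_sub_proj f2 t2 t1.
rewrite f1 -/(V z) V1 expr1n subrr => /sqnorm_eq0 h.
have /h : L2 mu (fun x => f x + - V z * tf_shift z f x).
  by apply: L2D => //; exact: L2Z.
by apply: aeS => y; rewrite mulNr => /eqP; rewrite subr_eq0 => /eqP.
Qed.

Lemma stft_eigenvalue z (a : R[i]) :
  {ae mu, forall y : A, f y = a * tf_shift z f y} -> V z = a.
Proof.
move=> fa; have t2 := L2_tf_shift hmu z f2.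
have mat : cmeasurable (fun y => a * tf_shift z f y).
  by apply: cmeasurableM; first exact: cmeasurable_cst.
rewrite /stft (inner_ae mf mat (mtf z) (mtf z) fa (aeT mu (fun=> erefl _))).
by rewrite innerZl// inner_self (sqnorm_tf_shift hmu)// f1 mulr1.
Qed.

(** Time-frequency shifts commute up to a phase, so an eigenvector f of pi z
    satisfies <f, pi (z + w) f> = phase * <pi z f, pi (z + w) f> = phase *
    <f, pi w f>. *)
Lemma stft_addl z w : normc (V z) = 1 ->
  V (z + w) = V z * V w * (w.2 z.1)^*.
Proof.
move=> V1; have := inner_tf_shift2 hmu z (z + w) f2.
have -> : z + w - z = w by rewrite addrC addKr.
have -> : (z + w).2 - z.2 = w.2 by rewrite /= addrC addKr.
have fz : {ae mu, forall y : A, tf_shift z f y = (V z)^* * f y}.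
  apply: aeS (stft_eigen V1) => y ->.
  by rewrite mulrA [_^* * _]mulrC mulJc V1 expr1n mul1r.
have mz : cmeasurable (fun y => (V z)^* * f y).
  by apply: cmeasurableM; first exact: cmeasurable_cst.
rewrite (inner_ae (mtf z) mz (mtf (z + w)) (mtf (z + w)) fz (aeT mu (fun=> erefl _))).
rewrite innerZl//; last exact: L2_tf_shift.
rewrite -/(V (z + w)) => e.
rewrite -[LHS]mul1r -[1](_ : V z * (V z)^* = 1); last by rewrite mulJc V1 expr1n.
by rewrite -mulrA e mulrA mulrAC.
Qed.

Hypothesis uni : forall z, G z -> normc (V z) = 1.

Lemma normc_inner_tf_shift z w :
  inner mu (tf_shift z f) (tf_shift w f) != 0 <-> G (w - z).
Proof.
rewrite (inner_tf_shift2 hmu)// mulf_eq0 negb_or.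
by rewrite -[_^* == 0]normc_eq0 normc_conj normc_char oner_eq0.
Qed.

Lemma subgroup_stft_support : subgroup_set G.
Proof.
have G0 : G 0 by rewrite /stft_support /= stft_self0 f1 oner_eq0.
split=> // x y Gx Gy.
have Gadd z w : G z -> (G (z + w) <-> G w).
  move=> /uni V1; rewrite /stft_support /= stft_addl// mulf_eq0 negb_or.
  rewrite -[_^* == 0]normc_eq0 normc_conj normc_char oner_eq0 andbT.
  by rewrite mulf_eq0 negb_or -[V z == 0]normc_eq0 V1 oner_eq0.
by apply/(Gadd y (x - y) Gy); rewrite subrKC.
Qed.

(** V (z + w) = V (w + z), computed with both orders of the factors. *)
Lemma stft_support_isotropic z w : G z -> G w -> w.2 z.1 = z.2 w.1.
Proof.
move=> Gz Gw; have := stft_addl z (uni Gw).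
rewrite addrC (stft_addl w (uni Gz)) [V w * V z]mulrC => /mulfI h.
have /h /(congr1 Num.conj) : V z * V w != 0 by rewrite mulf_neq0.
by rewrite !conjCK.
Qed.

(** pi (z + g) f is a multiple of pi z (pi g f), and pi g f is a multiple of
    f. *)
Lemma tf_shift_proportional z g : G g ->
  exists a : R[i], {ae mu, forall y : A, tf_shift z f y = a * tf_shift (z + g) f y}.
Proof.
move=> Gg; exists (V g * (g.2 z.1)^*).
have := ae_shift hmu (- z.1) (stft_eigen (uni Gg)).
apply: aeS => y h; rewrite tf_shiftE addrC h -mulrA -tf_shift_comp.
by rewrite /tf_shift /modulation /translation /= addrC; ring.
Qed.
End unimodular_support.

Section bases.
Variables (R : realType) (A : topologicalZmodType).
Variable mu : {measure set (borel A) -> \bar R}.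

Lemma inner_sub_sum (I : eqType) (s : seq I) (c : I -> R[i]) (e : I -> A -> R[i])
    (u v : A -> R[i]) : (forall i, i \in s -> L2 mu (e i)) -> L2 mu u -> L2 mu v ->
  L2 mu (fun y => u y - \sum_(i <- s) c i * e i y) /\
  inner mu (fun y => u y - \sum_(i <- s) c i * e i y) v =
  inner mu u v - \sum_(i <- s) c i * inner mu (e i) v.
Proof.
move=> + u2 v2; elim: s => [_|i s ih es].
  rewrite big_nil subr0; have -> : (fun y => u y - \sum_(i <- [::]) c i * e i y) = u.
    by apply/funext => y; rewrite big_nil subr0.
  by split.
have [r2 rE] := ih (fun j js => es j (mem_behead (s := i :: s) js)).
have ei : L2 mu (e i) by apply: es; rewrite mem_head.
have -> : (fun y => u y - \sum_(j <- i :: s) c j * e j y) =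
    (fun y => (u y - \sum_(j <- s) c j * e j y) + (- c i) * e i y).
  by apply/funext => y; rewrite big_cons; ring.
split; first by apply: L2D => //; exact: L2Z.
rewrite innerDl//; last exact: L2Z.
by rewrite rE innerZl// big_cons; ring.
Qed.

(** If u were orthogonal to all e i, then 1 = |<u - s, u>| <= ||u - s|| for
    all linear combinations s of the e i. *)
Lemma orthonormal_basis_complete (I : eqType) (J : set I) (e : I -> A -> R[i]) u :
  orthonormal_basis mu J e -> L2 mu u -> sqnorm mu u = 1 ->
  exists2 i, J i & inner mu u (e i) != 0.
Proof.
move=> [e2 _ dense] u2 u1; apply: contrapT => nex.
have orth i : J i -> inner mu (e i) u = 0.
  move=> Ji; rewrite (innerJ u2 (e2 _ Ji)); apply/eqP; rewrite conjC_eq0.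
  by apply: contrapT => /negP ne; apply: nex; exists i.
have [s [c [sJ]]] := dense u u2 1 ltr01.
rewrite cnorm_L2_lt// expr1n => lt1.
have [r2 rE] := inner_sub_sum c (fun i si => e2 _ (sJ i si)) u2 u2.
have := cauchy_schwarz_unit r2 u2 u1.
rewrite rE inner_self u1 big_seq big1 => [|i si]; last by rewrite orth ?mulr0//; exact: sJ.
rewrite subr0 normcr1 expr1n leNgt.
by move: lt1; rewrite sqint_fin// lte_fin => ->.
Qed.
End bases.

Section gabor_index_set.
Variables (R : realType) (A : topologicalZmodType).
Variable mu : {measure set (borel A) -> \bar R}.
Hypothesis hmu : haar_measure mu.
Variable f : A -> R[i].
Hypothesis f2 : L2 mu f.
Hypothesis f1 : sqnorm mu f = 1.
Local Notation V := (stft mu f f).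
Local Notation G := (stft_support mu f).
Hypothesis uni : forall z, G z -> normc (V z) = 1.
Variable Gamma : set (A * dual R A).

(** Completeness gives a point of Gamma in the coset of w, because pi w f is
    orthogonal to pi z f when z is in another coset; orthogonality gives its
    uniqueness. *)
Lemma basis_coset_representatives :
  orthonormal_basis mu Gamma (fun z => tf_shift z f) ->
  coset_representatives G Gamma.
Proof.
move=> onb w; have [_ orth _] := onb.
have w1 : sqnorm mu (tf_shift w f) = 1.
  by rewrite (sqnorm_tf_shift hmu)//; have [] := (L2P mu f).1 f2.
have [g Jg /(normc_inner_tf_shift hmu f2) Gg] :=
  orthonormal_basis_complete onb (L2_tf_shift hmu w f2) w1.
exists g; split; first by split; [|exists (g - w); [exact: Gg|exact: subrKC]].
move=> g' [Jg' [k Gk kg']].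
have Gd : G (g' - g).
  have := subgroup_setB (subgroup_stft_support hmu f2 f1 uni) Gk Gg.
  have coset (M : zmodType) (a b c : M) : b - (c - a) = a + b - c.
    by rewrite opprB addrCA addrA.
  by rewrite coset kg'.
have := (normc_inner_tf_shift hmu f2 g g').2 Gd.
by rewrite orth// pnatr_eq0 eqb0 negbK => /eqP.
Qed.

Lemma coset_representatives_orthonormal : coset_representatives G Gamma ->
  forall z w, Gamma z -> Gamma w ->
  inner mu (tf_shift z f) (tf_shift w f) = (z == w)%:R.
Proof.
move=> rep z w Jz Jw; have sG := subgroup_stft_support hmu f2 f1 uni.
case: eqVneq => [->|zw].
  rewrite inner_self (sqnorm_tf_shift hmu) ?f1//.
  by have [] := (L2P mu f).1 f2.
apply/eqP; apply: contrapT => /negP /(normc_inner_tf_shift hmu f2) Gwz.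
have [g [_ ug]] := rep z.
move/eqP: zw; apply; transitivity g; [symmetry|].
  by apply: ug; split; [|exists 0; [exact: subgroup_set0|exact: addr0]].
by apply: ug; split; [|exists (w - z); [exact: Gwz|exact: subrKC]].
Qed.
End gabor_index_set.

(** * Finitely many cosets and compactness of stabilizers *)

Section finitely_many_cosets.
Variables (R : realType) (A : topologicalZmodType).
Variable mu : {measure set (borel A) -> \bar R}.
Hypothesis hA : hausdorff_space A.
Hypothesis hmu : haar_measure mu.

(** With an uncountable number of cosets this is not a countable union of
    null sets; by tightness finitely many cosets carry all of the mass up to
    an arbitrarily small error. *)
Lemma ae_zero_on_cosets (H : set A) (u : A -> R[i]) : subgroup_set H ->
  nbhs 0 H -> L2 mu u ->
  (forall x, {ae mu, forall y : A, H (y - x) -> u y = 0}) ->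
  {ae mu, forall y : A, u y = 0}.
Proof.
move=> sH nH u2 uH; have [mu_ ufin] := (L2P mu u).1 u2.
have mp := measurable_sqr_normc mu_.
apply: sqnorm_eq0 => //; apply/eqP; rewrite eq_le sqnorm_ge0 andbT leNgt.
apply/negP => u0.
have [K [cK]] := haar_tight hA hmu mp (fun y => sqr_ge0 _) ufin u0.
have [s [_ sK]] := compact_finite_subcover cK (fun x _ => @nbhs_shift A x H nH).
have mKc : measurable (~` K : set (borel A)).
  by apply: measurableC; exact: compact_borel.
have zK : {ae mu, forall y : A, K y -> u y = 0}.
  have : {ae mu, forall y : A, forall x, x \in s -> H (y - x) -> u y = 0}.
    elim: s {sK} => [|x s ih]; first exact: aeT.
    apply: aeS2 (uH x) ih => y hx ih z; rewrite inE => /predU1P[->//|]; exact: ih.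
  by apply: aeS => y hy Ky; have [x xs Hx] := sK y Ky; exact: hy Hx.
rewrite integral_mkcond; have -> : (\int[mu]_x
    ((fun y : borel A => (normc (u y) ^+ 2)%:E) \_ (~` K)) x = sqint mu u)%E.
  apply: ge0_ae_eq_integral => //.
  - apply: (measurable_restrictT _ mKc).1; apply: measurable_funTS.
    exact/measurable_EFinP.
  - exact/measurable_EFinP.
  - by move=> y _; rewrite patchE; case: ifP => _ //; rewrite lee_fin sqr_ge0.
  - by move=> y _; rewrite lee_fin sqr_ge0.
  - apply: aeS zK => y hy _; rewrite patchE; case: ifPn => //.
    by rewrite notin_setE /= => /contrapT/hy ->; rewrite normcr0 expr0n.
by rewrite sqint_fin// ltxx.
Qed.

(** If K and x + K were disjoint, the complements of K and of x + K would
    cover everything, while each carries less than half of the mass. *)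
Lemma invariant_translations_meet (u : A -> R[i]) (K : set A) (x : A) :
  L2 mu u -> sqint mu u = 1%E -> compact K ->
  (\int[mu]_(y in ~` K) ((normc (u y) ^+ 2)%:E) < (2^-1)%:E)%E ->
  {ae mu, forall y : A, normc (u (y - x)) = normc (u y)} ->
  exists y, K y /\ K (y - x).
Proof.
move=> u2 u1 cK ltK inv; apply: contrapT => nex.
have [mu_ _] := (L2P mu u).1 u2; have mp := measurable_sqr_normc mu_.
have mKc : measurable (~` K : set (borel A)).
  by apply: measurableC; exact: compact_borel.
pose q (y : borel A) : R := \1_(~` K) y * normc (u y) ^+ 2.
have mq : measurable_fun setT q by exact: measurable_funM.
have q0 y : 0 <= q y by rewrite mulr_ge0// ?sqr_ge0// indicE.
have qK : (\int[mu]_y (q y)%:E < (2^-1)%:E)%E.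
  move: ltK; rewrite integral_mkcond; congr (_ < _)%E; apply: eq_integral => y _.
  by rewrite patchE /q indicE; case: ifP => _; rewrite ?mul1r// mul0r.
have : (sqint mu u <= \int[mu]_y ((q y)%:E + (q (y - x)%R)%:E))%E.
  apply: (@ae_ge0_le_integral _ _ _ mu setT) => //.
  - by move=> y _; rewrite lee_fin sqr_ge0.
  - exact/measurable_EFinP.
  - by move=> y _; rewrite adde_ge0// lee_fin.
  - apply: emeasurable_funD; apply/measurable_EFinP => //.
    exact: (measurable_fun_shiftN x mq).
  - apply: aeS inv => y hy _; rewrite -EFinD lee_fin /q -/(y - x) hy !indicE.
    rewrite -mulrDl ler_peMl ?sqr_ge0//.
    case: (boolP (y \in ~` K)) => [_|]; first by rewrite lerDl.
    rewrite notin_setE /= => /contrapT Ky; rewrite add0r.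
    by rewrite mem_set//= => Kyx; apply: nex; exists y.
rewrite u1 ge0_integralD//; last 4 first.
- by move=> y _; rewrite lee_fin.
- exact/measurable_EFinP.
- by move=> y _; rewrite lee_fin.
- by apply/measurable_EFinP; exact: (measurable_fun_shiftN x mq).
rewrite (ge0_integral_shiftN hmu x mq q0) leNgt => /negP; apply.
have -> : (1 = (2^-1)%:E + (2^-1)%:E :> \bar R)%E by rewrite -EFinD [1 in LHS]splitr div1r.
by rewrite lteD.
Qed.
End finitely_many_cosets.

(** * From the basis to the subcharacter *)

Section subgroup_restriction.
Variables (R : realType) (A : topologicalZmodType) (K : subgroup A).

Lemma subgroup_val_continuous : continuous (val : subgroup_type K -> A).
Proof. exact: initial_continuous. Qed.

Lemma subgroup_valP (x : subgroup_type K) : (K : set A) (val x).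
Proof. exact: set_mem (valP x). Qed.

Definition char_restrict (xi : dual R A) : dual R (subgroup_type K).
Proof.
apply: (@Character _ _ (fun x : subgroup_type K => xi (val x))) => [x|x|x y].
- apply: (@continuous_comp _ _ _ (val : subgroup_type K -> A) (xi : A -> R[i]^o)).
    exact: subgroup_val_continuous.
  exact: char_continuous.
- exact: char_norm1.
- exact: char_add.
Defined.
End subgroup_restriction.

Section structure_of_window.
Variables (R : realType) (A : topologicalZmodType).
Variable mu : {measure set (borel A) -> \bar R}.
Variable nu : {measure set (borel (dual R A)) -> \bar R}.
Variable lam : {measure set (borel (A * dual R A)%type) -> \bar R}.
Hypothesis hA : hausdorff_space A.
Hypothesis hmu : haar_measure mu.
Hypothesis hnu : haar_measure nu.
Hypothesis pl : plancherel mu nu.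
Hypothesis lam_product : product_measure_of mu nu lam.
Variable f : A -> R[i].
Hypothesis f2 : L2 mu f.
Hypothesis f1 : sqint mu f = 1%E.
Local Notation V := (stft mu f f).
Local Notation G := (stft_support mu f).
Hypothesis lam1 : lam G = 1%E.

Let mf : cmeasurable f. Proof. by have [] := (L2P mu f).1 f2. Qed.
Let fn1 : sqnorm mu f = 1. Proof. by rewrite /sqnorm f1. Qed.
Let uni z : G z -> normc (V z) = 1.
Proof. exact: (stft_unimodular hA hmu hnu pl lam_product). Qed.
Let sG : subgroup_set G. Proof. exact: subgroup_stft_support. Qed.
Let oG : open G. Proof. exact: open_stft_support. Qed.
Let G0 : G (0, 0). Proof. exact: (subgroup_set0 sG). Qed.
Let Geig x xi : G (x, xi) -> {ae mu, forall y : A, f y = V (x, xi) * (xi y * f (y - x))}.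
Proof. by move=> Gx; exact: stft_eigen (uni Gx). Qed.
Let Giso x xi y eta : G (x, xi) -> G (y, eta) -> eta x = xi y.
Proof. by move=> Gx Gy; have := stft_support_isotropic hmu f2 fn1 uni Gx Gy. Qed.
Let GD x xi y eta : G (x, xi) -> G (y, eta) -> G (x + y, xi + eta).
Proof. by move=> Gx Gy; exact: (subgroup_setD sG Gx Gy). Qed.
Let GB x xi y eta : G (x, xi) -> G (y, eta) -> G (x - y, xi - eta).
Proof. by move=> Gx Gy; exact: (subgroup_setB sG Gx Gy). Qed.
Let VD x xi y eta : G (x, xi) -> V (x + y, xi + eta) = V (x, xi) * V (y, eta) * (eta x)^*.
Proof. by move=> Gx; have := stft_addl hmu f2 fn1 (y, eta) (uni Gx). Qed.

Definition translation_part : set A := [set x | exists xi, G (x, xi)].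
Local Notation H := translation_part.
Local Notation N := (vertical_fibre G).

Lemma horizontal_fibre_nbhs : nbhs (0 : A) [set x | G (x, 0)].
Proof.
have : nbhs ((0 : A), (0 : dual R A)) G by exact: open_nbhs_nbhs.
move=> [[P Q] /= [nP nQ] PQ]; apply: filterS nP => x Px.
by apply: (PQ (x, 0)); split=> //; exact: nbhs_singleton.
Qed.

Lemma vertical_fibre_open : open N.
Proof.
rewrite openE => eta Neta; have : nbhs ((0 : A), eta) G by exact: open_nbhs_nbhs.
move=> [[P Q] /= [nP nQ] PQ]; apply: filterS nQ => eta' Qeta'.
by apply: (PQ (0, eta')); split=> //; exact: nbhs_singleton.
Qed.

Lemma subgroup_translation_part : subgroup_set H.
Proof.
split=> [|x y [xi Gx] [eta Gy]]; first by exists 0.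
by exists (xi - eta); exact: GB.
Qed.
Local Notation sH := subgroup_translation_part.

Lemma open_translation_part : open H.
Proof.
apply: (open_subgroup sH); apply: filterS horizontal_fibre_nbhs => x /= Gx.
by exists 0.
Qed.
Local Notation oH := open_translation_part.

(** |f| is H-invariant and of norm 1, so a compact K that carries more than
    half of its mass meets all its translates by H: H is in the compact set K
    - K. *)
Lemma compact_translation_part : compact H.
Proof.
have [_ ufin] := (L2P mu f).1 f2.
have [|K [cK ltK]] := haar_tight hA hmu (measurable_sqr_normc mf) (fun y => sqr_ge0 _) ufin (e := 2^-1).
  by rewrite invr_gt0.
have cKK : compact ((fun z : A * A => z.1 - z.2) @` (K `*` K)).
  apply: continuous_compact; last exact: compact_setX.
  by apply: continuous_subspaceT; exact: sub_continuous.
apply: (subclosed_compact _ cKK).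
  exact: open_subgroup_closed sH oH.
move=> x [xi Gx].
have [|y [Ky Kyx]] := @invariant_translations_meet _ _ _ hA hmu f K x f2 f1 cK ltK.
  apply: aeS (Geig Gx) => y ->.
  by rewrite !normcrM (uni Gx) normc_char !mul1r.
by exists (y, y - x) => //=; rewrite subKr.
Qed.
Local Notation cH := compact_translation_part.
Local Notation ann := (annihilator H : set (dual R A)).

(** Isotropy for (0, eta) and (y, xi). *)
Lemma vertical_fibre_annihilates : N `<=` ann.
Proof. by move=> eta Neta y [xi Gy]; rewrite (Giso Gy Neta) char0. Qed.

(** lam G = mu H * nu N = 1 and mu H * nu ann = 1; if N were smaller than
    ann, then ann would contain two disjoint translates of N. *)
Lemma vertical_fibre_annihilator : N = ann.
Proof.
have h0 := haar_subgroup_gt0 hA hmu sH cH oH.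
have nua := nu_annihilator hA hmu pl sH cH oH.
have oa : open ann by exact: (open_annihilator R sH cH).
have mN : measurable (N : set (borel (dual R A))) by apply: open_borel; exact: vertical_fibre_open.
have ma : measurable (ann : set (borel (dual R A))) by exact: open_borel.
have Nle : (nu N <= nu ann)%E.
  by apply: le_measure; [exact/mem_set|exact/mem_set|exact: vertical_fibre_annihilates].
have finN : (nu N < +oo)%E by rewrite (le_lt_trans Nle)// nua ltry.
have := subgroup_product_measure hmu hnu lam_product sG (fun=> iff_refl _) cH
  horizontal_fibre_nbhs vertical_fibre_open finN.
rewrite lam1 (haar_subgroupE hmu cH).
rewrite -(fineK (_ : nu N \is a fin_num)) ?ge0_fin_numE// -EFinM => -[hN].
have {}hN : nu N = (haar_subgroup mu H)^-1%:E.
  rewrite -[nu N]fineK ?ge0_fin_numE//; congr EFin.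
  by apply: (mulfI (lt0r_neq0 h0)); rewrite -hN mulfV ?lt0r_neq0.
apply/seteqP; split; first exact: vertical_fibre_annihilates.
move=> eta aeta; apply: contrapT => nNeta.
have sa : subgroup_set ann by exact: subgroup_annihilator.
have mNs := measurable_shiftN eta mN.
have sN (z : dual R A) : N z -> N (z - eta) -> False.
  move=> Nz Nze; apply: nNeta; have := GB Nz Nze.
  by rewrite subrr subKr.
have : (nu (N `|` [set z | N (z - eta)%R]) <= nu ann)%E.
  apply: le_measure; [exact/mem_set/measurableU|exact/mem_set|].
  move=> z [/vertical_fibre_annihilates//|/vertical_fibre_annihilates az].
  by have := subgroup_setD sa az aeta; rewrite (subrK eta (z : dual R A)).
have -> : (nu (N `|` [set z | N (z - eta)%R]) = nu N + nu [set z | N (z - eta)%R])%E.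
  by apply: measureU => //; apply/seteqP; split=> // z [Nz Nze]; exact: (sN z).
have -> : nu [set z | N (z - eta)%R] = nu N.
  by apply: (haar_shiftN hnu); apply: open_borel; exact: vertical_fibre_open.
by rewrite nua hN -EFinD lee_fin gerDl leNgt invr_gt0 h0.
Qed.

Lemma charged_coset : exists x0, ~ {ae mu, forall y : A, H (y - x0) -> f y = 0}.
Proof.
apply: contrapT => nex.
have : {ae mu, forall y : A, f y = 0}.
  apply: (ae_zero_on_cosets hA hmu sH) => //.
    by apply: open_nbhs_nbhs; split; [exact: oH|exact: (subgroup_set0 sH)].
  by move=> x; apply: contrapT => hx; apply: nex; exists x.
move=> /(sqint_ae mf (cmeasurable_cst A 0)); rewrite f1 /sqint integral0_eq.
  by move=> /eqP; rewrite onee_eq0.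
by move=> y _; rewrite normcr0 expr0n.
Qed.

Section phase.
Variable x0 : A.
Hypothesis hx0 : ~ {ae mu, forall y : A, H (y - x0) -> f y = 0}.

(** On x0 + H the equation f = V (0, eta) eta f reads f = V (0, eta) eta(x0)
    f, as eta is trivial on H. *)
Lemma stft_vertical eta : N eta -> V (0, eta) * eta x0 = 1.
Proof.
move=> Neta; apply/eqP; apply: contrapT => /negP ne; apply: hx0.
apply: aeS (Geig Neta) => y + Hy; rewrite subr0.
rewrite -{1}[y](subrK x0) => fy.
have ey : eta y = eta x0.
  rewrite -[y](subrK x0) char_add.
  by rewrite (vertical_fibre_annihilates Neta Hy) mul1r.
move: fy; rewrite subrK ey mulrA => /eqP.
rewrite -{1}[f y]mul1r -subr_eq0 -mulrBl mulf_eq0 subr_eq0 eq_sym.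
by rewrite (negbTE ne) => /eqP.
Qed.

(** The equation f = V (x, xi) pi (x, xi) f gives, formally, f (x0 + x) = V
    (x, xi) xi (x0 + x) f (x0); so this is f (x0 + x) / f (x0). *)
Definition phase x (xi : dual R A) : R[i] := V (x, xi) * xi x0 * xi x.

(** Two frequencies at x differ by an element of N, which changes the phase
    by the factor of stft_vertical. *)
Lemma phase_unique x xi xi' : G (x, xi) -> G (x, xi') -> phase x xi = phase x xi'.
Proof.
move=> Gx Gx'; have : N (xi' - xi) by have := GB Gx' Gx; rewrite subrr.
have -> : xi' = (xi' - xi) + xi by rewrite subrK.
rewrite addrK; move: (xi' - xi) => eta Neta.
have := VD x xi Neta; rewrite add0r char0 rmorph1 mulr1 => VE.
have etax : eta x = 1 by apply: (vertical_fibre_annihilates Neta); exists xi.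
rewrite /phase VE !dualDE etax.
transitivity (V (0, eta) * eta x0 * (V (x, xi) * xi x0 * xi x)); last by ring.
by rewrite (stft_vertical Neta) mul1r.
Qed.

Lemma phaseD x xi y eta : G (x, xi) -> G (y, eta) ->
  phase (x + y) (xi + eta) = phase x xi * phase y eta * xi y.
Proof.
move=> Gx Gy; rewrite /phase VD// !dualDE !char_add.
rewrite -(Giso Gx Gy).
transitivity (V (x, xi) * V (y, eta) * (xi x0 * eta x0) * (xi x * eta y * eta x) *
    (eta x * (eta x)^*)); last by rewrite char_mulJ; ring.
by rewrite (Giso Gx Gy); ring.
Qed.

Lemma normc_phase x xi : G (x, xi) -> normc (phase x xi) = 1.
Proof. by move=> Gx; rewrite /phase !normcrM !normc_char (uni Gx) !mul1r. Qed.

(** An arbitrary choice: only the restriction to H matters, which is the same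
    for all xi with G (x, xi). *)
Definition frequency x : dual R A :=
  xget 0 [set xi | G (x, xi)].

Lemma frequencyP x : H x -> G (x, frequency x).
Proof. by move=> [xi Gx]; exact: (@xgetPex _ 0 [set xi | G (x, xi)]) (ex_intro _ xi Gx). Qed.

Definition window (x : A) : R[i] := if `[< H x >] then phase x (frequency x) else 0.

Lemma windowE x xi : G (x, xi) -> window x = phase x xi.
Proof.
move=> Gx; have Hx : H x by exists xi.
by rewrite /window asboolT//; apply: phase_unique => //; exact: frequencyP.
Qed.

Lemma window0 x : ~ H x -> window x = 0.
Proof. by move=> nHx; rewrite /window asboolF. Qed.

Lemma normc_window x : H x -> normc (window x) = 1.
Proof. by move=> [xi Gx]; rewrite (windowE Gx) normc_phase. Qed.

Lemma windowD x y xi : G (x, xi) -> H y -> window (x + y) = window x * window y * xi y.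
Proof.
by move=> Gx [eta Gy]; rewrite (windowE (GD Gx Gy)) phaseD// -(windowE Gx) -(windowE Gy).
Qed.

(** Near x the window is window x * V (y - x, 0) * xi (y - x), because (y -
    x, 0) is in G. *)
Lemma window_continuous : continuous (window : A -> R[i]^o).
Proof.
move=> x; have [Hx|nHx] := pselect (H x); last first.
  apply: continuous_normcP => e e0.
  have : nbhs x (~` H).
    apply: open_nbhs_nbhs; split=> //; apply: closed_openC.
    exact: open_subgroup_closed sH oH.
  by apply: filterS => y nHy; rewrite !window0// subrr normcr0.
have [xi Gx] := Hx; apply: continuous_normcP => e e0.
have cV : {for (0 : A), continuous ((fun t => V (t, 0)) : A -> R[i]^o)}.
  apply: continuous_normcP => e' e'0.
  have : \forall z \near ((0 : A), (0 : dual R A)), normc (V (0, 0) - V z) < e'.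
    by apply: near_normc => //; exact: stft_continuous.
  move=> [[P Q] /= [nP nQ] PQ]; apply: filterS nP => t Pt.
  by apply: (PQ (t, 0)); split=> //; exact: nbhs_singleton.
have cF : {for (0 : A), continuous ((fun t => V (t, 0) * xi t) : A -> R[i]^o)}.
  by apply: cvgM; [exact: cV|exact: char_continuous].
have F0 : V (0, 0) * xi 0 = 1 by rewrite char0 mulr1 stft_self0 fn1.
have := near_normc e0 cF; rewrite F0 => nF.
apply: filterS2 (@nbhs_shift A x _ nF) (@nbhs_shift A x _ horizontal_fibre_nbhs).
move=> y /= Fy Gy.
have -> : window y = window x * (V (y - x, 0) * xi (y - x)).
  rewrite -{1}(subrKC x y) (windowD Gx); last by exists 0.
  by rewrite -mulrA (windowE Gy) /phase !dual0E !mulr1.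
by rewrite -{1}[window x]mulr1 -mulrBr normcrM normc_window// mul1r.
Qed.

Lemma frequencyE x xi z : G (x, xi) -> H z -> frequency x z = xi z.
Proof.
move=> Gx Hz; have Gf : G (x, frequency x) by apply: frequencyP; exists xi.
have Gz : N (frequency x - xi) by have := GB Gf Gx; rewrite subrr.
rewrite -[frequency x](subrK xi) dualDE.
by rewrite (vertical_fibre_annihilates Gz Hz) mul1r.
Qed.

Lemma zmod_closed_translation_part : zmod_closed (mem H).
Proof.
split; first by apply: mem_set; exact: (subgroup_set0 sH).
by move=> x y /set_mem Hx /set_mem Hy; apply: mem_set; exact: (subgroup_setB sH).
Qed.

Lemma subchar_window : subchar_second_degree window.
Proof.
pose K := Subgroup zmod_closed_translation_part.
exists K, (fun x => char_restrict K (frequency (val x))).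
have KH (x : subgroup_type K) : H (val x) by exact: (subgroup_valP x).
have KG (x : subgroup_type K) : G (val x, frequency (val x)) by exact: frequencyP.
split; [exact: compact_translation_part|exact: open_translation_part| | |exact: window0].
- split=> [x U nU|x y|x y].
  + have nW := @nbhs_shift A (val x) _ horizontal_fibre_nbhs.
    have nV : nbhs x [set y : subgroup_type K | G (val y - val x, 0)].
      exact: (@subgroup_val_continuous A K x _ nW).
    suff : nbhs x [set y | U (char_restrict K (frequency (val y)))] by [].
    apply: filterS nV => y /= Gyx.
    suff -> : char_restrict K (frequency (val y)) = char_restrict K (frequency (val x)).
      exact: nbhs_singleton.
    apply: dual_ext => z /=; apply: frequencyE; last exact: KH.
    by have := GD Gyx (KG x); rewrite subrK add0r.
  + by apply: dual_ext => z /=; exact: (frequencyE (GD (KG x) (KG y)) (KH z)).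
  + exact: (Giso (KG x) (KG y)).
- split=> [x|x|x y].
  + apply: (@continuous_comp _ _ _ (val : subgroup_type K -> A) (window : A -> R[i]^o)).
      exact: subgroup_val_continuous.
    exact: window_continuous.
  + by apply/normr1_normc; exact: normc_window.
  + apply: etrans (windowD (KG x) (KH y)) _.
    by congr (_ * _); exact: esym (Giso (KG x) (KG y)).
Qed.

Let mw : cmeasurable window.
Proof. apply: cmeasurable_continuous; exact: window_continuous. Qed.

(** Both f (x0 + .) and the window are multiplied by the same factors under
    translation by x in H, so their quotient is H-invariant. *)
Lemma proportional_on_coset : exists c : R[i],
  {ae mu, forall y : A, H (y - x0) -> f y = c * window (y - x0)}.
Proof.
pose g (t : A) : R[i] := (cindic R H t * (window t)^*) * f (x0 + t).
have fx0 : (fun t => f (x0 + t)) = translation (- x0) f.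
  by apply/funext => t; rewrite /translation opprK addrC.
have g2 : L2 mu g.
  apply: (@L2_mul_bounded _ _ _ _ _ 1).
  - apply: cmeasurableM; first by apply: cmeasurable_cindic; exact: oH.
    exact: cmeasurableJ.
  - move=> t; rewrite normcrM normc_conj; have [Ht|nHt] := pselect (H t).
      by rewrite cindic1// normcr1 mul1r normc_window.
    by rewrite cindic0// normcr0 mul0r ler01.
  - by rewrite fx0; exact: L2_translation.
have g0 t : ~ H t -> g t = 0 by move=> nHt; rewrite /g cindic0// !mul0r.
have [|c gc] := invariant_ae_constant hA hmu pl sH cH oH g2 g0.
  move=> x [xi Gx]; have Hx : H x by exists xi.
  apply: aeS (ae_shift hmu x0 (Geig Gx)) => t fe.
  have [Ht|nHt] := pselect (H t); last first.
    by rewrite !g0// => /(subgroup_setD sH Hx); rewrite subrKC.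
  have Htx : H (t - x) by exact: (subgroup_setB sH).
  rewrite /g !cindic1// !mul1r fe.
  have we : window t = phase x xi * window (t - x) * xi (t - x).
    by rewrite -{1}(subrKC x t) (windowD Gx Htx) (windowE Gx).
  have xit : xi (x0 + t) = xi x0 * (xi x * xi (t - x)).
    by rewrite -!char_add subrKC.
  rewrite we xit /phase !rmorphM -[x0 + t - x]addrA.
  set v := V _; set w := window (t - x); set F := f _.
  transitivity (w^* * F * (v * v^*) * (xi x0 * (xi x0)^*) * (xi x * (xi x)^*) *
    (xi (t - x) * (xi (t - x))^*)); last by ring.
  by rewrite !char_mulJ mulJc (uni Gx) expr1n !mulr1.
exists c; apply: aeS (ae_shift hmu (- x0) gc) => y + Hy.
rewrite [- x0 + y]addrC /g cindic1// mul1r mulr1 subrKC => e.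
by rewrite -e mulrAC [_^* * _]mulrC mulJc normc_window// expr1n mul1r.
Qed.

(** A coset x1 + H other than x0 + H carries no mass: a character eta of the
    annihilator with eta (x1 - x0) <> 1 is constant on both cosets, and f would
    be an eigenvector of the multiplication by eta. *)
Lemma window_equation : exists c : R[i],
  {ae mu, forall y : A, f y = c * translation x0 window y}.
Proof.
have [c fc] := proportional_on_coset; exists c.
have w2 : L2 mu window.
  apply: (@L2_cindic_bounded _ _ _ hmu H cH oH _ 1) => //; first exact: window0.
  by move=> y Hy; rewrite normc_window.
have u2 : L2 mu (fun y => f y + - c * translation x0 window y).
  by apply: L2D => //; apply: L2Z; exact: L2_translation.
have : {ae mu, forall y : A, f y + - c * translation x0 window y = 0}.
  apply: (ae_zero_on_cosets hA hmu sH) => //.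
    by apply: open_nbhs_nbhs; split; [exact: oH|exact: (subgroup_set0 sH)].
  move=> x1; have [Hx1|nHx1] := pselect (H (x1 - x0)).
    apply: aeS fc => y fy Hy; rewrite fy ?mulNr ?subrr//.
    by have := subgroup_setD sH Hy Hx1; rewrite addrA subrK.
  have [eta aeta etane] := annihilator_separates hA hmu pl sH cH oH nHx1.
  have Neta : N eta by rewrite vertical_fibre_annihilator.
  apply: aeS (Geig Neta) => y + Hy; rewrite subr0 => fy.
  have -> : translation x0 window y = 0.
    rewrite /translation; apply: window0 => Hyx0; apply: nHx1.
    have := subgroup_setB sH Hyx0 Hy.
    by rewrite opprB [X in H X]addrC addrA subrK.
  rewrite mulr0 addr0; have ye : eta y = eta (x1 - x0) * eta x0.
    by rewrite -char_add subrK -[y in LHS](subrK x1) char_add (aeta _ Hy) mul1r.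
  move: fy; rewrite ye mulrA mulrCA stft_vertical// mulr1 => /eqP.
  rewrite -{1}[f y]mul1r -subr_eq0 -mulrBl mulf_eq0 subr_eq0 eq_sym.
  by rewrite (negbTE etane) => /eqP.
by apply: aeS => y; rewrite mulNr => /eqP; rewrite subr_eq0 => /eqP.
Qed.
End phase.

Lemma subcharacter_structure : exists (c : R[i]) (x0 : A) (h : A -> R[i]),
  [/\ c != 0, subchar_second_degree h &
    {ae mu, forall y : A, f y = c * translation x0 h y}].
Proof.
have [x0 hx0] := charged_coset; have [c fc] := window_equation hx0.
exists c, x0, (window x0); split=> //; last exact: subchar_window.
apply: contra_notN hx0 => /eqP c0.
by apply: aeS fc => y ->; rewrite c0 mul0r.
Qed.
End structure_of_window.

(** * The support for a subcharacter *)

Section subgroup_topology.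
Variables (R : realType) (A : topologicalZmodType) (K : subgroup A).

Lemma subgroup_set_subgroup : subgroup_set (K : set A).
Proof.
have [K0 KB] := subgroup_closed K; split; first exact: set_mem K0.
by move=> x y Kx Ky; apply: set_mem; apply: KB; exact: mem_set.
Qed.

Definition subgroup_elt x (Kx : (K : set A) x) : subgroup_type K :=
  exist _ x (mem_set Kx).

Lemma nbhs_subgroup_val (t : subgroup_type K) (U : set (subgroup_type K)) :
  open (K : set A) -> nbhs t U -> nbhs (val t) [set y | exists2 s, U s & val s = y].
Proof.
move=> oK; rewrite nbhsE => -[_ [[W oW <-] Wt] OU].
have : nbhs (val t) (W `&` K).
  by apply: open_nbhs_nbhs; split; [exact: openI|split=> //; exact: subgroup_valP].
by apply: filterS => y [Wy Ky]; exists (subgroup_elt Ky) => //; apply: OU.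
Qed.

Lemma compact_subgroup_type : compact (K : set A) -> compact [set: subgroup_type K].
Proof.
move=> cK F FF _; have FK : (val @ F) K.
  apply: (@filterS _ F _ setT); last exact: filterT.
  by move=> t _; exact: subgroup_valP.
have [p [Kp clp]] := cK (val @ F) _ FK.
exists (subgroup_elt Kp); split=> // P U FP; rewrite nbhsE => -[_ [[W oW <-] Wp] OU].
have [|_ [[t Pt <-] Wt]] := clp (val @` P) W _ (open_nbhs_nbhs (conj oW Wp)).
  suff : F [set t | (val @` P) (val t)] by [].
  by apply: filterS FP => t Pt; exists t.
by exists t; split=> //; apply: OU.
Qed.

Lemma continuous_extension (u : A -> R[i]) : open (K : set A) ->
  continuous ((fun t : subgroup_type K => u (val t)) : subgroup_type K -> R[i]^o) ->
  (forall y, ~ (K : set A) y -> u y = 0) -> continuous (u : A -> R[i]^o).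
Proof.
move=> oK cu u0 x; apply: continuous_normcP => e e0.
have [Kx|nKx] := pselect ((K : set A) x); last first.
  have : nbhs x (~` (K : set A)).
    apply: open_nbhs_nbhs; split=> //; apply: closed_openC.
    exact: open_subgroup_closed subgroup_set_subgroup oK.
  by apply: filterS => y nKy; rewrite !u0// subrr normcr0.
have := nbhs_subgroup_val oK (near_normc e0 (cu (subgroup_elt Kx))).
by apply: filterS => y [s us <-].
Qed.
End subgroup_topology.

Section subcharacter_window.
Variables (R : realType) (A : topologicalZmodType).
Variable mu : {measure set (borel A) -> \bar R}.
Variable nu : {measure set (borel (dual R A)) -> \bar R}.
Variable lam : {measure set (borel (A * dual R A)%type) -> \bar R}.
Hypothesis hA : hausdorff_space A.
Hypothesis hmu : haar_measure mu.
Hypothesis hnu : haar_measure nu.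
Hypothesis pl : plancherel mu nu.
Hypothesis lam_product : product_measure_of mu nu lam.
Variables (K : subgroup A) (phi : subgroup_type K -> dual R (subgroup_type K)).
Variable h : A -> R[i].
Hypothesis cK : compact (K : set A).
Hypothesis oK : open (K : set A).
Hypothesis hphi : symmetric_hom phi.
Hypothesis hh : char_second_degree phi (fun x => h (val x)).
Hypothesis h0 : forall x, ~ (K : set A) x -> h x = 0.

Local Notation sK := (subgroup_set_subgroup K).
Local Notation ind := (cindic R (K : set A)).
Local Notation ann := (annihilator (K : set A) : set (dual R A)).
Local Notation elt := (@subgroup_elt A K _).

Lemma subchar_continuous : continuous (h : A -> R[i]^o).
Proof. by apply: (@continuous_extension R A K) => //; case: hh. Qed.

Let mh : cmeasurable h.
Proof. apply: cmeasurable_continuous; exact: subchar_continuous. Qed.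

Lemma normc_subchar x : (K : set A) x -> normc (h x) = 1.
Proof. by move=> Kx; apply/normr1_normc; case: hh => _ /(_ (elt Kx)). Qed.

Lemma subchar_mulJ x : h x * (h x)^* = ind x.
Proof.
have [Kx|nKx] := pselect ((K : set A) x).
  by rewrite mulJc normc_subchar// expr1n cindic1.
by rewrite h0// mul0r cindic0.
Qed.

Let phi0 : phi 0 = 0.
Proof.
have [_ pD _] := hphi; have := pD 0 0; rewrite addr0 => /eqP.
by rewrite -subr_eq0 opprD addrA subrr sub0r oppr_eq0 => /eqP.
Qed.

(** The support of V_f f will be the set of these pairs. *)
Definition extends_phi (x : A) (xi : dual R A) : Prop :=
  exists2 t, val t = x & forall s, xi (val s) = phi t s.

(** phi x is a character of K, and characters of K extend to A. *)
Lemma extends_phi_ex x : (K : set A) x -> exists xi, extends_phi x xi.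
Proof.
move=> Kx; pose chi y := if pselect ((K : set A) y) is left Ky then phi (elt Kx) (elt Ky) else 1.
have chiE (s : subgroup_type K) : chi (val s) = phi (elt Kx) s.
  rewrite /chi; case: pselect => [Ks|]; last by move=> []; exact: subgroup_valP.
  by congr (phi _ _); exact: val_inj.
have chim : multiplicative_on_subgroup K chi.
  split=> [|y Ky|y z Ky Kz].
  - apply: cmeasurable_continuous; apply: (@continuous_extension R A K) => //.
      have -> : (fun t : subgroup_type K => ind (val t) * chi (val t)) = phi (elt Kx).
        apply/funext => t; rewrite chiE cindic1 ?mul1r//; exact: subgroup_valP.
      exact: char_continuous.
    by move=> y nKy; rewrite cindic0// mul0r.
  - by rewrite (chiE (elt Ky)) normc_char.
  - by rewrite (chiE (elt Ky)) (chiE (elt Kz)) -char_add -chiE.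
have [xi xiE] := multiplicative_extends hA hmu pl sK cK oK chim.
exists xi, (elt Kx) => // s; rewrite xiE ?chiE//; exact: subgroup_valP.
Qed.

Lemma extends_phi_ann x xi eta : extends_phi x xi ->
  (extends_phi x eta <-> ann (eta - xi)).
Proof.
move=> [t tx xit]; split=> [[s sx etas] y Ky|aeta].
  have st : s = t by apply: val_inj; rewrite sx.
  have -> : y = val (elt Ky) by [].
  by rewrite dualDE dualNE etas xit st char_mulJ.
exists t => // s; rewrite -[eta](subrK xi) dualDE aeta ?mul1r//; exact: subgroup_valP.
Qed.

Lemma extends_phi0 eta : extends_phi 0 eta <-> ann eta.
Proof.
have e0 : extends_phi 0 0 by exists 0 => // s; rewrite phi0.
by have := extends_phi_ann eta e0; rewrite subr0.
Qed.

(** phi x is uniformly close to 1 on K for x near 0, and a character of K with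
    values close to 1 is trivial. *)
Lemma nbhs_ker_phi : nbhs (0 : A) [set x | extends_phi x 0].
Proof.
have [cphi _ _] := hphi.
have nU : nbhs (phi 0) [set b | forall x, setT x -> `|phi 0 x - b x| < 1].
  by apply: dual_near => //; exact: compact_subgroup_type.
have := nbhs_subgroup_val oK (cphi 0 _ nU).
apply: filterS => x [t near1 <-]; exists t => // s; apply/esym.
have : annihilator setT (phi t).
  apply: char_trivial_on_subgroup => // y _.
  have := near1 y I; rewrite phi0 normcrE -[1 in X in _ < X]/(1%:C) ltcR; exact.
by move=> /(_ s I).
Qed.

Variables (c : R[i]) (x0 : A).
Definition subchar_atom (y : A) : R[i] := c * translation x0 h y.
Local Notation f := subchar_atom.
Hypothesis f2 : L2 mu f.
Hypothesis f1 : sqnorm mu f = 1.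
Local Notation V := (stft mu f f).
Local Notation G := (stft_support mu f).

Let mf : cmeasurable f. Proof. by have [] := (L2P mu f).1 f2. Qed.

(** h (t) = h (x) h (t - x) xi (t - x) for t in K, by the functional equation
    of h and the symmetry of phi. *)
Lemma subchar_atom_eigen x xi : extends_phi x xi ->
  exists2 a : R[i], normc a = 1 & forall y, f y = a * tf_shift (x, xi) f y.
Proof.
move=> [t tx xit]; have Kx : (K : set A) x by rewrite -tx; exact: subgroup_valP.
exists (h x * (xi (x + x0))^*) => [|y].
  by rewrite normcrM normc_conj normc_char normc_subchar// mul1r.
rewrite tf_shiftE /f /translation /= -addrA -opprD.
have [Ky|nKy] := pselect ((K : set A) (y - x0)); last first.
  have -> : h (y - (x + x0)) = 0.
    apply: h0 => Ky; apply: nKy.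
    by have := subgroup_setD sK Ky Kx; rewrite opprD [- x - _]addrC addrA subrK.
  by rewrite h0// !mulr0.
have Kyx : (K : set A) (y - (x + x0)).
  by have := subgroup_setB sK Ky Kx; rewrite opprD [- x - _]addrC addrA.
have -> : h (y - x0) = h x * h (y - (x + x0)) * xi (y - (x + x0)).
  have [_ _ hD] := hh; have [_ _ psym] := hphi.
  have := hD t (elt Kyx); rewrite psym -xit /= tx => <-.
  by congr h; rewrite [RHS]addrC opprD [- x - _]addrC addrA subrK.
have -> : xi y = xi (y - (x + x0)) * xi (x + x0) by rewrite -char_add subrK.
set u := xi (x + x0); set v := xi (y - _); set w := h (y - _).
transitivity (c * (h x * w * v) * (u * u^*)); last by ring.
by rewrite char_mulJ mulr1.
Qed.

Lemma stft_subchar_unimodular x xi : extends_phi x xi -> normc (V (x, xi)) = 1.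
Proof.
move=> /subchar_atom_eigen[a a1 fa].
by rewrite (stft_eigenvalue hmu f2 f1 (aeT mu fa)).
Qed.

Lemma subchar_atom_sqr y : f y * (f y)^* = c * c^* * translation x0 ind y.
Proof.
by rewrite /f rmorphM mulrACA /translation subchar_mulJ.
Qed.

(** V (0, eta) is the Fourier transform at eta of |f|^2, a multiple of the
    indicator of x0 + K. *)
Lemma stft_subchar_vertical eta : V (0, eta) != 0 -> ann eta.
Proof.
move=> Ve; apply: contrapT => neta; move/eqP: Ve; apply.
have ii : cintegrable mu ind.
  apply: (cintegrable_supported hmu (H := K)) => //; first exact: L2_cindic.
  by move=> y; exact: cindic0.
have ti : cintegrable mu (translation x0 ind) by exact: cintegrable_translation.
transitivity (fourier mu (fun y => c * c^* * translation x0 ind y) eta).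
  congr cintegral; apply/funext => y.
  by rewrite tf_shiftE /= subr0 rmorphM mulrCA mulrC subchar_atom_sqr.
rewrite fourierZ// fourier_translation//.
by rewrite (fourier_cindic_notann hmu sK cK oK neta) !mulr0.
Qed.

(** For x outside K the functions f and T_x f have disjoint supports. For x
    in K, let xi' extend phi x; the eigenvector equation at (x, xi') reduces
    V (x, xi) to V (0, xi - xi'). *)
Lemma stft_support_subchar x xi : G (x, xi) <-> extends_phi x xi.
Proof.
split; last first.
  by move=> /stft_subchar_unimodular V1; rewrite /stft_support /= -normc_eq0 V1 oner_eq0.
move=> Gx; have Kx : (K : set A) x.
  apply: contrapT => nKx; move/eqP: Gx; apply.
  transitivity (cintegral mu (fun y => 0 * (f y * (f y)^*))).
    congr cintegral; apply/funext => y; rewrite mul0r tf_shiftE /=.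
    rewrite /f /translation; have [Ky|nKy] := pselect ((K : set A) (y - x0)).
      rewrite [h (y - x - x0)]h0 ?(mulr0, rmorph0)// => Kyx; apply: nKx.
      by have := subgroup_setB sK Ky Kyx; rewrite [y - x - x0]addrAC subKr.
    by rewrite [h (y - x0)]h0 ?(mulr0, mul0r).
  by rewrite cintegralZ ?mul0r//; exact: cintegrable_mulJ.
have [xi' xi'x] := extends_phi_ex Kx.
apply/(extends_phi_ann xi xi'x); apply: stft_subchar_vertical.
have := stft_addl hmu f2 f1 (0, xi - xi') (stft_subchar_unimodular xi'x).
have -> : (x, xi') + (0, xi - xi') = (x, xi).
  by congr pair => /=; rewrite ?addr0// subrKC.
move=> VE; apply/eqP => V0; move/eqP: Gx; apply.
by rewrite VE V0 mulr0 mul0r.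
Qed.

Lemma stft_support_unimodular z : G z -> normc (V z) = 1.
Proof. by case: z => x xi /stft_support_subchar/stft_subchar_unimodular. Qed.

Lemma stft_support_measure : lam G = 1%E.
Proof.
have hK := haar_subgroup_gt0 hA hmu sK cK oK.
have sG := subgroup_stft_support hmu f2 f1 stft_support_unimodular.
have NE : vertical_fibre G = ann.
  by apply/seteqP; split=> eta /=; [move=> /stft_support_subchar/extends_phi0
    |move=> /extends_phi0/stft_support_subchar].
have nuN : nu (vertical_fibre G) = (haar_subgroup mu K)^-1%:E.
  by rewrite NE (nu_annihilator hA hmu pl sK cK oK).
rewrite (subgroup_product_measure hmu hnu lam_product sG (H := K)) //.
- by rewrite (haar_subgroupE hmu cK) nuN -EFinM mulfV// lt0r_neq0.
- move=> x; split=> [/extends_phi_ex[xi e]|[xi /stft_support_subchar[t <- _]]].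
    by exists xi; apply/stft_support_subchar.
  exact: subgroup_valP.
- by apply: filterS nbhs_ker_phi => x e; apply/stft_support_subchar.
- by rewrite NE; exact: (open_annihilator R sK cK).
- by rewrite nuN ltry.
Qed.

End subcharacter_window.

(** * Approximation by linear combinations *)

Section approximation.
Variables (R : realType) (A : topologicalZmodType).
Variable mu : {measure set (borel A) -> \bar R}.
Variables (I : eqType) (J : set I) (e : I -> A -> R[i]).
Hypothesis e2 : forall i, L2 mu (e i).

(** Indexed by pairs of a coefficient and an index, with possible
    repetitions, so that sums of combinations are concatenations of lists. *)
Definition combination (L : seq (R[i] * I)) (y : A) : R[i] :=
  \sum_(p <- L) p.1 * e p.2 y.

Lemma L2_combination L : L2 mu (combination L).
Proof.
elim: L => [|p L ih].
  have -> : combination [::] = (fun y => 0 * combination [::] y).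
    by apply/funext => y; rewrite mul0r /combination big_nil.
  apply/L2P; split.
    have -> : (fun y => 0 * combination [::] y) = fun=> 0 by apply/funext => y; rewrite mul0r.
    exact: cmeasurable_cst.
  by rewrite /sqint integral0_eq// => y _; rewrite mul0r normcr0 expr0n.
have -> : combination (p :: L) = (fun y => p.1 * e p.2 y + combination L y).
  by apply/funext => y; rewrite /combination big_cons.
by apply: L2D => //; exact: L2Z.
Qed.

Lemma combination_indexed (L : seq (R[i] * I)) : (forall p, p \in L -> J p.2) ->
  exists (s : seq I) (c : I -> R[i]), (forall i, i \in s -> J i) /\
    forall y, combination L y = \sum_(i <- s) c i * e i y.
Proof.
move=> LJ; exists (undup [seq p.2 | p <- L]), (fun i => \sum_(p <- L | p.2 == i) p.1).
split=> [i|y]; first by rewrite mem_undup => /mapP[p /LJ Jp ->].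
under eq_bigr do rewrite mulr_suml.
rewrite (exchange_big_dep predT)//= /combination.
rewrite big_seq [RHS]big_seq; apply: eq_bigr => p pL.
rewrite (big_rem p.2) /=; last by rewrite mem_undup; exact: map_f.
rewrite eqxx big_seq_cond big1 ?addr0// => i /andP[].
by rewrite mem_rem_uniq ?undup_uniq// inE => /andP[/negbTE ne _]; rewrite eq_sym ne.
Qed.

Definition approximable (u : A -> R[i]) : Prop := forall eps : R, 0 < eps ->
  exists L, (forall p, p \in L -> J p.2) /\
    sqnorm mu (fun y => u y + (-1) * combination L y) < eps.

Lemma approximable_dense u : L2 mu u -> approximable u ->
  forall eps : R, 0 < eps -> exists (s : seq I) (c : I -> R[i]),
    (forall i, i \in s -> J i) /\
    (cnorm_L mu 2%:E (fun y => (u y - \sum_(i <- s) c i * e i y)%R) < eps%:E)%E.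
Proof.
move=> u2 au eps eps0; have [|L [LJ ltL]] := au (eps ^+ 2); first exact: exprn_gt0.
have [s [c [sJ Lc]]] := combination_indexed LJ; exists s, c; split=> //.
rewrite cnorm_L2_lt ?ltW//.
have -> : (fun y => u y - \sum_(i <- s) c i * e i y) =
    (fun y => u y + (-1) * combination L y).
  by apply/funext => y; rewrite Lc mulN1r.
rewrite sqint_fin ?lte_fin//; apply: L2D => //; apply: L2Z; exact: L2_combination.
Qed.

Lemma sqnormD_lt u v (a : R) : L2 mu u -> L2 mu v -> sqnorm mu u < a / 4 ->
  sqnorm mu v < a / 4 -> sqnorm mu (fun y => u y + v y) < a.
Proof.
move=> u2 v2 ua va.
have := @sqint_addr_le _ _ _ u v (a / 4) (a / 4) u2 v2.
by rewrite !sqint_fin// !lte_fin => /(_ ua va) h; apply: lt_le_trans h _; lra.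
Qed.

Lemma approximable_limit u : L2 mu u ->
  (forall eps : R, 0 < eps -> exists v, [/\ L2 mu v, approximable v &
     sqnorm mu (fun y => u y + (-1) * v y) < eps]) -> approximable u.
Proof.
move=> u2 lu eps eps0; have e4 : 0 < eps / 4 by rewrite divr_gt0.
have [v [v2 av uv]] := lu _ e4; have [L [LJ vL]] := av _ e4.
exists L; split=> //; have l2 := L2_combination L.
have -> : (fun y => u y + -1 * combination L y) =
   (fun y => (u y + -1 * v y) + (v y + -1 * combination L y)).
  by apply/funext => y; ring.
by apply: sqnormD_lt => //; apply: L2D => //; exact: L2Z.
Qed.

Lemma approximableD u v : L2 mu u -> L2 mu v -> approximable u -> approximable v ->
  approximable (fun y => u y + v y).
Proof.
move=> u2 v2 au av eps eps0; have e4 : 0 < eps / 4 by rewrite divr_gt0.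
have [L [LJ uL]] := au _ e4; have [M [MJ vM]] := av _ e4.
exists (L ++ M); split=> [p|]; first by rewrite mem_cat => /orP[/LJ|/MJ].
have -> : (fun y => u y + v y + -1 * combination (L ++ M) y) =
   (fun y => (u y + -1 * combination L y) + (v y + -1 * combination M y)).
  by apply/funext => y; rewrite /combination big_cat /=; ring.
have l2 := L2_combination L; have m2 := L2_combination M.
by apply: sqnormD_lt => //; apply: L2D => //; exact: L2Z.
Qed.
End approximation.

Section cosets.
Variables (R : realType) (A : topologicalZmodType).
Variable mu : {measure set (borel A) -> \bar R}.
Hypothesis hA : hausdorff_space A.
Hypothesis hmu : haar_measure mu.
Variables (I : eqType) (J : set I) (e : I -> A -> R[i]).
Hypothesis e2 : forall i, L2 mu (e i).
Variable K : set A.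
Hypothesis sK : subgroup_set K.
Hypothesis oK : open K.

(** By tightness, finitely many cosets carry u up to a small error; adding
    them one at a time only requires pieces supported in a single coset. *)
Lemma approximable_cosets :
  (forall v x, L2 mu v -> (forall y, ~ K (y - x) -> v y = 0) ->
     approximable mu J e v) ->
  forall u, L2 mu u -> approximable mu J e u.
Proof.
move=> hcos u u2; have [mu_ ufin] := (L2P mu u).1 u2.
pose cut (E : set A) (y : A) : R[i] := (\1_E y : R)%:C * u y.
have cut2 (E : set A) : measurable (E : set (borel A)) -> L2 mu (cut E).
  move=> mE; apply: (@L2_mul_bounded _ _ _ _ _ 1) => //; first exact: cmeasurable_indic.
  by move=> y; rewrite indicE; case: (y \in E); rewrite ?normcr1 ?normcr0 ?ler01.
pose D (t : seq A) : set A := [set y | exists2 x, x \in t & K (y - x)].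
have nK : nbhs 0 K by apply: open_nbhs_nbhs; split=> //; exact: subgroup_set0.
have oD t : open (D t).
  rewrite openE => y [x xt Kyx]; apply: filterS (@nbhs_shift A y K nK) => z Kzy.
  by exists x => //; have := subgroup_setD sK Kzy Kyx; rewrite addrA subrK.
have mD t : measurable (D t : set (borel A)) by exact: open_borel.
have acut t : approximable mu J e (cut (D t)).
  elim: t => [|x t ih].
    apply: (hcos _ 0); first exact: cut2.
    by move=> y _; rewrite /cut indicE memNset ?mul0r// => -[].
  pose F : set A := D [:: x] `\` D t.
  have mF : measurable (F : set (borel A)) by apply: measurableD; exact: mD.
  have -> : cut (D (x :: t)) = (fun y => cut (D t) y + cut F y).
    apply/funext => y; rewrite /cut -mulrDl -rmorphD !indicE; congr (_%:C * _).
    have [Dt|nDt] := pselect (D t y).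
      rewrite [in RHS]mem_set// [in RHS]memNset ?addr0 ?mem_set//.
        by have [z zt Kz] := Dt; exists z => //; rewrite inE zt orbT.
      by case.
    have [Dx|nDx] := pselect (D [:: x] y).
      rewrite [in RHS]memNset// [in X in _ + X]mem_set// add0r mem_set//.
      by have [z] := Dx; rewrite inE => /eqP -> Kx; exists x => //; rewrite mem_head.
    rewrite !memNset ?addr0//; first by case.
    move=> [z]; rewrite inE => /predU1P[->|zt] Kz; last by apply: nDt; exists z.
    by apply: nDx; exists x => //; rewrite mem_head.
  apply: approximableD => //; [exact: cut2|exact: cut2|].
  apply: (hcos _ x); first exact: cut2.
  move=> y nK'; rewrite /cut indicE memNset ?mul0r//.
  by move=> [[z zx Kz] _]; apply: nK'; move: zx; rewrite inE => /eqP <-.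
apply: approximable_limit => // eps eps0.
have mp := measurable_sqr_normc mu_.
have [C [cC ltC]] := haar_tight hA hmu mp (fun y => sqr_ge0 _) ufin eps0.
have [s [_ sC]] := compact_finite_subcover cC (fun x _ => @nbhs_shift A x K nK).
exists (cut (D s)); split=> //; first exact: cut2.
have r2 : L2 mu (fun y => u y + -1 * cut (D s) y).
  by apply: L2D => //; apply: L2Z; exact: cut2.
rewrite -lte_fin -sqint_fin//; apply: le_lt_trans ltC.
have [mr _] := (L2P mu _).1 r2; have mCc : measurable (~` C : set (borel A)).
  by apply: measurableC; exact: compact_borel.
rewrite [leRHS]integral_mkcond; apply: ge0_le_integral => //.
- by move=> y _; rewrite lee_fin sqr_ge0.
- by apply/measurable_EFinP; exact: measurable_sqr_normc.
- apply: (measurable_restrictT _ mCc).1; apply: measurable_funTS.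
  exact/measurable_EFinP.
- move=> y _; rewrite patchE /cut indicE; case: ifPn => [_|].
    rewrite lee_fin lerXn2r ?nnegrE ?normc_ge0//.
    case: (y \in D s); rewrite ?mul1r ?mul0r ?mulN1r ?subrr ?mulr0 ?subr0 ?normcr0//.
    exact: normc_ge0.
  rewrite notin_setE /= => /contrapT Cy; rewrite mem_set; last exact: sC.
  by rewrite mul1r mulN1r subrr normcr0 expr0n.
Qed.
End cosets.

(** * From the subcharacter to the basis *)

Section density.
Variables (R : realType) (A : topologicalZmodType).
Variable mu : {measure set (borel A) -> \bar R}.
Variable nu : {measure set (borel (dual R A)) -> \bar R}.
Hypothesis hA : hausdorff_space A.
Hypothesis hmu : haar_measure mu.
Hypothesis hnu : haar_measure nu.
Hypothesis pl : plancherel mu nu.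
Variables (K : subgroup A) (phi : subgroup_type K -> dual R (subgroup_type K)).
Variable h : A -> R[i].
Hypothesis cK : compact (K : set A).
Hypothesis oK : open (K : set A).
Hypothesis hh : char_second_degree phi (fun x => h (val x)).
Hypothesis h0 : forall x, ~ (K : set A) x -> h x = 0.
Variables (c : R[i]) (x0 : A) (f : A -> R[i]).
Hypothesis c0 : c != 0.
Hypothesis f2 : L2 mu f.
Hypothesis f1 : sqnorm mu f = 1.
Hypothesis fh : {ae mu, forall y : A, f y = c * translation x0 h y}.
Hypothesis uni : forall z, stft_support mu f z -> normc (stft mu f f z) = 1.
Variable Gamma : set (A * dual R A).
Hypothesis rep : coset_representatives (stft_support mu f) Gamma.

Local Notation sK := (subgroup_set_subgroup K).
Local Notation ind := (cindic R (K : set A)).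
Local Notation e := (fun z : A * dual R A => tf_shift z f).

Let mh : cmeasurable h.
Proof. by apply: cmeasurable_continuous; exact: (subchar_continuous oK hh h0). Qed.
Let hJ := subchar_mulJ hh h0.

(** This function is a multiple of pi (x1 - x0, xi) f, which is itself a
    multiple of pi g f for the representative g of its coset. *)
Lemma coset_character_spanned (x1 : A) (xi : dual R A) :
  exists p : R[i] * (A * dual R A), Gamma p.2 /\
    {ae mu, forall y : A, xi (y - x1) * h (y - x1) = p.1 * tf_shift p.2 f y}.
Proof.
have [g [[Jg [k Gk kg]] _]] := rep (x1 - x0, xi).
have [a fa] := tf_shift_proportional hmu f2 f1 uni (x1 - x0, xi) Gk.
exists ((xi x1)^* * c^-1 * a, g); split=> //=.
apply: aeS2 fa (ae_shift hmu (- (x1 - x0)) fh) => y.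
rewrite kg => ay fy.
transitivity ((xi x1)^* * c^-1 * (a * tf_shift g f y)); last by rewrite mulrA.
move: fy; rewrite /translation [- (x1 - x0) + y]addrC.
have -> : y - (x1 - x0) - x0 = y - x1 by rewrite opprB addrAC addrA subrK.
move=> fy; rewrite -ay tf_shiftE /= fy.
rewrite char_add charN; transitivity (c^-1 * c * ((xi x1)^* * xi y * h (y - x1))).
  by rewrite mulVf// mul1r [(xi x1)^* * _]mulrC.
by ring.
Qed.

(** After translation by x1 and division by the unimodular function h, the
    function v lives on K, where it is approximated by combinations of
    characters. *)
Lemma coset_approximable (v : A -> R[i]) (x1 : A) : L2 mu v ->
  (forall y, ~ (K : set A) (y - x1) -> v y = 0) -> approximable mu Gamma e v.
Proof.
move=> v2 v0 eps eps0; have [mv _] := (L2P mu v).1 v2.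
pose w (y : A) : R[i] := (h y)^* * translation (- x1) v y.
have normh y : normc (h y) <= 1.
  have [Ky|nKy] := pselect ((K : set A) y); first by rewrite (normc_subchar hh).
  by rewrite h0// normcr0.
have w2 : L2 mu w.
  apply: (@L2_mul_bounded _ _ _ _ _ 1); first exact: cmeasurableJ.
    by move=> y; rewrite normc_conj.
  exact: L2_translation.
have w0 y : ~ (K : set A) y -> w y = 0 by move=> nKy; rewrite /w h0// conjC0 mul0r.
have [s rlt] := character_approximation hA hmu hnu pl sK cK oK w2 w0 eps0.
set r := char_residual mu K w s in rlt.
pose k (xi : dual R A) := fourier mu w xi / (haar_subgroup mu K)%:C.
have rE y : r y = w y - \sum_(xi <- s) k xi * (xi y * ind y).
  by rewrite /r char_residualE.
have r0 y : ~ (K : set A) y -> r y = 0.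
  by move=> nKy; rewrite rE w0// big1 ?subrr// => xi _; rewrite cindic0// !mulr0.
have r2 : L2 mu r by exact: L2_char_residual.
have [mr _] := (L2P mu r).1 r2.
have /choice[p hp] := coset_character_spanned x1.
pose L := [seq (k xi * (p xi).1, (p xi).2) | xi <- s].
have L2L : L2 mu (combination e L) by apply: L2_combination => z; exact: L2_tf_shift.
exists L; split; first by move=> _ /mapP[xi _ ->]; exact: (hp xi).1.
suff <- : sqnorm mu r = sqnorm mu (fun y => v y + -1 * combination e L y) by [].
have mhr : cmeasurable (fun y => h y * r y) by exact: cmeasurableM.
have -> : sqnorm mu r = sqnorm mu (translation x1 (fun y => h y * r y)).
  rewrite /sqnorm sqint_translation//; congr fine; apply: eq_integral => y _.
  have [Ky|nKy] := pselect ((K : set A) y); last by rewrite r0// mulr0.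
  by rewrite normcrM (normc_subchar hh)// mul1r.
congr fine; apply: sqint_ae.
- exact: cmeasurable_translation.
- by have [] := (L2P mu _).1 (L2D v2 (L2Z (-1) L2L)).
have : {ae mu, forall y : A, \sum_(xi <- s) k xi * (xi (y - x1) * h (y - x1)) =
    combination e L y}.
  rewrite /L; elim: s {rlt r rE r0 r2 mr L L2L mhr} => [|xi s ih].
    by apply: aeT => y; rewrite /combination !big_nil.
  apply: aeS2 (hp xi).2 ih => y hy ih.
  by rewrite /combination /= !big_cons -/(combination e _ y) -ih hy mulrA.
apply: aeS => y <-; rewrite /translation rE mulrBr mulr_sumr mulN1r; congr (_ - _).
  rewrite /w /translation opprK subrK mulrA hJ.
  have [Ky|nKy] := pselect ((K : set A) (y - x1)); first by rewrite cindic1// mul1r.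
  by rewrite v0// mulr0.
apply: eq_bigr => xi _; have [Ky|nKy] := pselect ((K : set A) (y - x1)).
  by rewrite cindic1//; ring.
by rewrite h0// mul0r !mulr0.
Qed.

Lemma subcharacter_basis : orthonormal_basis mu Gamma (fun z => tf_shift z f).
Proof.
split; first by move=> z _; exact: L2_tf_shift.
  exact: coset_representatives_orthonormal.
have e2 z : L2 mu (e z) by exact: L2_tf_shift.
move=> u u2; apply: (approximable_dense e2) => //.
exact: (approximable_cosets hA hmu e2 sK oK coset_approximable).
Qed.
End density.

Theorem corollary6p2 (R : realType) (A : topologicalZmodType)
    (hausdorff_A : hausdorff_space A)
    (lc_A : locally_compact [set: A])
    (mu : {measure set (borel A) -> \bar R})
    (nu : {measure set (borel (dual R A)) -> \bar R})
    (lam : {measure set (borel (A * dual R A)%type) -> \bar R})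
    (haar_mu : haar_measure mu) (haar_nu : haar_measure nu)
    (plancherel_mu_nu : plancherel mu nu)
    (haar_lam : haar_measure lam)
    (lam_product : product_measure_of mu nu lam)
    (f : A -> R[i]) (f_L2 : in_L mu 2%:E f) (f_norm1 : cnorm_L mu 2%:E f = 1%E)
    (Gamma : set (A * dual R A)) :
  (orthonormal_basis mu Gamma (fun z => tf_shift z f) /\
   lam (stft_support mu f) = 1%E)
  <->
  ((exists (c : R[i]) (x0 : A) (h : A -> R[i]),
      [/\ c != 0, subchar_second_degree h &
          {ae mu, forall y : A, f y = c * translation x0 h y}]) /\
   coset_representatives (stft_support mu f) Gamma).
Proof.
have f1 : sqint mu f = 1%E by exact: cnorm_L2_eq1.
have fn1 : sqnorm mu f = 1 by rewrite /sqnorm f1.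
split=> [[onb lam1]|[[c [x0 [h [c0 [K [phi [cK oK hphi hh h0]]] fh]]]] rep]].
  have uni z : stft_support mu f z -> normc (stft mu f f z) = 1.
    exact: (stft_unimodular hausdorff_A haar_mu haar_nu plancherel_mu_nu lam_product).
  split; last exact: (basis_coset_representatives haar_mu f_L2 fn1 uni onb).
  exact: (subcharacter_structure hausdorff_A haar_mu haar_nu plancherel_mu_nu lam_product).
(* V and its support depend only on the class of f in L^2, so f may be replaced
   by the function g, which has the required form everywhere. *)
pose g := subchar_atom h c x0.
have [mf _] := (L2P mu f).1 f_L2.
have mg : cmeasurable g.
  apply: cmeasurableM; first exact: cmeasurable_cst.
  apply: cmeasurable_translation; apply: cmeasurable_continuous.
  exact: (subchar_continuous oK hh h0).
have g1 : sqint mu g = 1%E by rewrite -f1; apply: sqint_ae => //; apply: aeS fh => y.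
have g2 : L2 mu g by apply/L2P; split=> //; rewrite g1 ltry.
have gn1 : sqnorm mu g = 1 by rewrite /sqnorm g1.
have Vfg z : stft mu f f z = stft mu g g z.
  have mtf : cmeasurable (tf_shift z f).
    by have [] := (L2P mu _).1 (L2_tf_shift haar_mu z f_L2).
  have mtg : cmeasurable (tf_shift z g).
    by have [] := (L2P mu _).1 (L2_tf_shift haar_mu z g2).
  apply: inner_ae => //; apply: aeS (ae_shift haar_mu (- z.1) fh) => y.
  by rewrite !tf_shiftE addrC => ->.
have Gfg : stft_support mu f = stft_support mu g.
  by apply/funext => z; rewrite /stft_support /= Vfg.
split.
  apply: (subcharacter_basis hausdorff_A haar_mu haar_nu plancherel_mu_nu cK oK hh h0 c0 f_L2 fn1 fh _ rep).
  move=> z; rewrite Gfg Vfg.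
  exact: (stft_support_unimodular hausdorff_A haar_mu plancherel_mu_nu cK oK hphi hh h0 g2 gn1).
rewrite Gfg.
exact: (stft_support_measure hausdorff_A haar_mu haar_nu plancherel_mu_nu lam_product cK oK hphi hh h0 g2 gn1).
Qed.
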